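(* Let $G$ be a split semisimple group over $\mathbb{Q}$ and $n\ge3$. For any $U\times U$-invariant positive function $\Delta$ on $G^{(n-1)}$, the functions $$\Delta\circ m_k^n\quad(1\le k\le n-1),\qquad \Delta\circ p_n,\qquad \Delta\circ q_n$$ are $U\times U$-invariant positive functions on $G^{(n)}$.
   Context: $H\subset G$ is a Cartan subgroup, $B,B^-$ opposite Borel subgroups with $B\cap B^-=H$, $U,U^-$ their unipotent radicals, $x_i(t)\in U$, $y_i(t)\in U^-$ the standard one-parameter subgroups. $G^{(n)}=G*\cdots*G$ ($n$ factors) is the quotient of $G^n$ by the action of $U^{n-1}$ identifying $(\dots,g_k,g_{k+1},\dots)$ with $(\dots,g_ku^{-1},ug_{k+1},\dots)$ for $u\in U$; the class of $(g_1,\dots,g_n)$ is $g_1*\cdots*g_n$, and $U\times U$ acts by $u(g_1*\cdots*g_n)u'=(ug_1)*\cdots*(g_nu')$. The maps are $$m_k^n(g_1*\cdots*g_n)=g_1*\cdots*(g_kg_{k+1})*\cdots*g_n\in G^{(n-1)},$$ $$p_n(g_1*\cdots*g_n)=[g_2*\cdots*g_n]\in U\backslash G^{(n-1)},\qquad q_n(g_1*\cdots*g_n)=[g_1*\cdots*g_{n-1}]\in G^{(n-1)}/U.$$ A $U\times U$-invariant function $\Delta$ on $G^{(n-1)}$ is also viewed as a function on $U\backslash G^{(n-1)}$ and on $G^{(n-1)}/U$. A rational $U\times U$-invariant function on $G^{(n)}$ is called positive if its restriction along $(B^-)^n\to G^{(n)}$ is positive, i.e. becomes a ratio of nonzero Laurent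 polynomials with non-negative coefficients in the product chart, where $B^-$ carries the chart $H\times\mathbb{G}_m^m\to B^-$, $(h,t)\mapsto h\,(x_{i_1}(t_1)\cdots x_{i_m}(t_m))^T$ for a reduced word $(i_1,\dots,i_m)$ of the longest element $w_0$, and $(\cdot)^T$ is the anti-automorphism of $G$ with $x_i(t)^T=y_i(t)$, $y_i(t)^T=x_i(t)$ and $h^T=h$ for $h\in H$. *)

(* Defs.v *)
From mathcomp Require Export all_boot all_order all_algebra all_field.
From mathcomp Require Export mpoly.

Set Implicit Arguments.
Unset Strict Implicit.
Unset Printing Implicit Defensive.

Import Order.TTheory GRing.Theory Num.Theory.
Local Open Scope ring_scope.

(* Conventions.  An algebraic group over Q is given by its points over algC, as
   a Zariski closed subset of the affine space of N x N matrices, defined by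
   polynomials over Q, that is a group under matrix multiplication.  Every
   linear algebraic group over Q has such a realisation: a closed subgroup of
   GL_(N-1) embeds through g |-> diag (g, (det g)^-1).  The coordinate ring is
   then the ring of polynomial functions in the entries, without 1 / det.
   The parameter iota below is the embedding into algC of the field of
   coefficients: ratr for "over Q", idfun for "over algC". *)

(** ** Polynomial and Laurent polynomial functions *)

Definition peval (F : nzRingType) (iota : F -> algC) (I : finType)
    (p : {mpoly F[#|I|]}) (v : I -> algC) : algC :=
  mmap iota (fun k => v (enum_val k)) p.

Definition torus_point (I : finType) (v : I -> algC) : Prop :=
  forall i, v i != 0.

Definition lmonom (I : finType) (v : I -> algC) (e : I -> int) : algC :=
  \prod_i v i ^ e i.

Definition entries (N : nat) (g : 'M[algC]_N) : 'I_N * 'I_N -> algC :=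
  fun x => g x.1 x.2.

Definition morphism_on (F : nzRingType) (iota : F -> algC) (M N : nat)
    (A : 'M[algC]_M -> Prop) (f : 'M[algC]_M -> 'M[algC]_N) : Prop :=
  forall i j, exists p, forall g, A g -> f g i j = peval iota p (entries g).

(** ** Linear algebraic groups *)

Definition zclosed (F : nzRingType) (iota : F -> algC) (N : nat)
    (A : 'M[algC]_N -> Prop) : Prop :=
  exists S : {mpoly F[#|{: 'I_N * 'I_N}|]} -> Prop,
  forall g, A g <-> forall p, S p -> peval iota p (entries g) = 0.

Definition included (N : nat) (A B : 'M[algC]_N -> Prop) : Prop :=
  forall g, A g -> B g.

Definition is_group (N : nat) (A : 'M[algC]_N -> Prop) : Prop :=
  [/\ A 1%:M,
      forall g h, A g -> A h -> A (g *m h),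
      forall g, A g -> g \in unitmx
    & forall g, A g -> A (invmx g)].

Definition closed_group (F : nzRingType) (iota : F -> algC) (N : nat)
    (A : 'M[algC]_N -> Prop) : Prop :=
  zclosed iota A /\ is_group A.

Definition zconnected (N : nat) (A : 'M[algC]_N -> Prop) : Prop :=
  forall C D : 'M[algC]_N -> Prop,
    zclosed idfun C -> zclosed idfun D ->
    (forall g, A g <-> C g \/ D g) -> (forall g, C g -> ~ D g) ->
    (forall g, ~ C g) \/ (forall g, ~ D g).

Definition normal_in (N : nat) (A R : 'M[algC]_N -> Prop) : Prop :=
  included R A /\ forall a g, A a -> R g -> R (a *m g *m invmx a).

Inductive derived (N : nat) (A : 'M[algC]_N -> Prop) : 'M[algC]_N -> Prop :=
| derived_one : derived A 1%:M
| derived_mul a b g : A a -> A b -> derived A g ->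
    derived A (a *m b *m invmx a *m invmx b *m g).

Definition solvable_group (N : nat) (A : 'M[algC]_N -> Prop) : Prop :=
  exists k, forall g, iter k (@derived N) A g -> g = 1%:M.

Definition unipotent_mx (N : nat) (g : 'M[algC]_N) : Prop :=
  exists k : nat, (g - 1%:M) ^+ k = 0.

(* A connected group over Q whose (geometric) radical is trivial. *)
Definition semisimple (N : nat) (G : 'M[algC]_N -> Prop) : Prop :=
  [/\ closed_group (@ratr algC) G,
      zconnected G
    & forall R, closed_group idfun R -> zconnected R -> solvable_group R ->
        normal_in G R -> forall g, R g -> g = 1%:M].

Definition is_borel (N : nat) (G B : 'M[algC]_N -> Prop) : Prop :=
  [/\ closed_group idfun B, zconnected B, solvable_group B, included B G
    & forall B', closed_group idfun B' -> zconnected B' -> solvable_group B' ->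
        included B' G -> included B B' -> included B' B].

Definition is_unipotent_radical (N : nat) (B U : 'M[algC]_N -> Prop) : Prop :=
  [/\ closed_group idfun U /\ zconnected U, normal_in B U,
      forall g, U g -> unipotent_mx g
    & forall U', closed_group idfun U' -> zconnected U' -> normal_in B U' ->
        (forall g, U' g -> unipotent_mx g) -> included U' U].

(* tau is an isomorphism from (G_m)^d onto T, over the field of coefficients;
   the polynomials in the last clause give the inverse of tau. *)
Definition torus_iso (F : nzRingType) (iota : F -> algC) (N d : nat)
    (T : 'M[algC]_N -> Prop) (tau : ('I_d -> algC) -> 'M[algC]_N) : Prop :=
  [/\ closed_group iota T,
      forall z z', torus_point z -> torus_point z' ->
        tau (fun i => z i * z' i) = tau z *m tau z',
      forall g, T g <-> exists2 z, torus_point z & tau z = g,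
      forall a b, exists (p : {mpoly F[#|'I_d|]}) (e : 'I_d -> int),
        forall z, torus_point z -> tau z a b = peval iota p z * lmonom z e
    & forall i, exists p : {mpoly F[#|{: 'I_N * 'I_N}|]},
        forall z, torus_point z -> peval iota p (entries (tau z)) = z i].

Definition maximal_torus (N : nat) (G T : 'M[algC]_N -> Prop) : Prop :=
  included T G /\
  forall d T' (tau' : ('I_d -> algC) -> 'M[algC]_N),
    torus_iso idfun T' tau' -> included T' G -> included T T' -> included T' T.

(** ** Lie algebra, roots and Weyl group *)

(* The tangent space at the identity. *)
Definition lie (N : nat) (A : 'M[algC]_N -> Prop) (X : 'M[algC]_N) : Prop :=
  forall p : {mpoly algC[#|{: 'I_N * 'I_N}|]},
    (forall g, A g -> peval idfun p (entries g) = 0) ->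
    \sum_k peval idfun (mderiv k p) (entries 1%:M)
             * entries X (enum_val k) = 0.

(* A row vector of integers stands for a character of the torus through tau. *)
Definition is_root (N d : nat) (tau : ('I_d -> algC) -> 'M[algC]_N)
    (A : 'M[algC]_N -> Prop) (lambda : 'rV[int]_d) : Prop :=
  lambda != 0 /\
  exists X, [/\ X != 0, lie A X
    & forall z, torus_point z ->
        tau z *m X *m invmx (tau z) = lmonom z (lambda 0) *: X].

Definition nonneg_comb (d r : nat) (alpha : 'I_r -> 'rV[int]_d)
    (lambda : 'rV[int]_d) : Prop :=
  exists c : 'I_r -> nat, lambda = \sum_i alpha i *+ c i.

(* alpha is the base of the root system of (G, H) consisting of the simple
   roots relative to the Borel subgroup B. *)
Definition simple_roots (N d r : nat) (tau : ('I_d -> algC) -> 'M[algC]_N)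
    (G B : 'M[algC]_N -> Prop) (alpha : 'I_r -> 'rV[int]_d) : Prop :=
  [/\ forall i, is_root tau G (alpha i),
      forall c : 'I_r -> int,
        \sum_i alpha i *~ c i = 0 -> forall i, c i = 0,
      forall lambda, is_root tau G lambda ->
        nonneg_comb alpha lambda \/ nonneg_comb alpha (- lambda)
    & forall lambda, is_root tau B lambda <->
        is_root tau G lambda /\ nonneg_comb alpha lambda].

Definition upper2 (t : algC) : 'M[algC]_2 := 1%:M + t *: delta_mx 0 1.
Definition lower2 (t : algC) : 'M[algC]_2 := 1%:M + t *: delta_mx 1 0.
Definition diag2 (a : algC) : 'M[algC]_2 :=
  diag_mx (\row_j if j == 0 then a else a^-1).

Definition SL2 (g : 'M[algC]_2) : Prop := \det g = 1.

(** ** Split semisimple groups with their standard data *)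

(* H is a split maximal torus (the Cartan subgroup), B and Bm are opposite Borel
   subgroups containing it, U and Um their unipotent radicals; sl2 i is the
   morphism SL_2 -> G over Q attached to the i-th simple root, from which the standard
   one-parameter subgroups x_i and y_i are obtained; tr is the map g |-> g^T. *)
Record split_semisimple (N : nat) : Type := SplitSemisimple {
  sdim : nat;
  srank : nat;
  sG : 'M[algC]_N -> Prop;
  sH : 'M[algC]_N -> Prop;
  sB : 'M[algC]_N -> Prop;
  sBm : 'M[algC]_N -> Prop;
  sU : 'M[algC]_N -> Prop;
  sUm : 'M[algC]_N -> Prop;
  stau : ('I_sdim -> algC) -> 'M[algC]_N;
  sroot : 'I_srank -> 'rV[int]_sdim;
  scoroot : 'I_srank -> 'rV[int]_sdim;
  sl2 : 'I_srank -> 'M[algC]_2 -> 'M[algC]_N;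
  tr : 'M[algC]_N -> 'M[algC]_N;

  sG_semisimple : semisimple sG;
  sH_split : torus_iso (@ratr algC) sH stau;
  sH_maximal : maximal_torus sG sH;
  sB_borel : is_borel sG sB /\ zclosed (@ratr algC) sB;
  sBm_borel : is_borel sG sBm /\ zclosed (@ratr algC) sBm;
  sB_opposite : forall g, sH g <-> sB g /\ sBm g;
  sU_radical : is_unipotent_radical sB sU;
  sUm_radical : is_unipotent_radical sBm sUm;
  sroot_simple : simple_roots stau sG sB sroot;

  sl2_morphism : forall i, morphism_on (@ratr algC) SL2 (sl2 i);
  sl2_in : forall i g, SL2 g -> sG (sl2 i g);
  sl2_mul : forall i g h, SL2 g -> SL2 h ->
    sl2 i (g *m h) = sl2 i g *m sl2 i h;
  sl2_upper : forall i t, sU (sl2 i (upper2 t));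
  sl2_lower : forall i t, sUm (sl2 i (lower2 t));
  sl2_diag : forall i (a : algC), a != 0 ->
    sl2 i (diag2 a) = stau (fun j => a ^ (scoroot i 0 j));
  sl2_upper_root : forall i z t, torus_point z ->
    stau z *m sl2 i (upper2 t) *m invmx (stau z)
      = sl2 i (upper2 (lmonom z (sroot i 0) * t));
  sl2_lower_root : forall i z t, torus_point z ->
    stau z *m sl2 i (lower2 t) *m invmx (stau z)
      = sl2 i (lower2 (lmonom z ((- sroot i) 0) * t));
  sl2_neq1 : forall i, sl2 i (upper2 1) <> 1%:M /\ sl2 i (lower2 1) <> 1%:M;

  tr_morphism : morphism_on (@ratr algC) sG tr;
  tr_in : forall g, sG g -> sG (tr g);
  tr_anti : forall g h, sG g -> sG h -> tr (g *m h) = tr h *m tr g;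
  tr_iso : exists2 tr' : 'M[algC]_N -> 'M[algC]_N,
    morphism_on (@ratr algC) sG tr'
    & forall g, sG g -> [/\ sG (tr' g), tr' (tr g) = g & tr (tr' g) = g];
  tr_upper : forall i t, tr (sl2 i (upper2 t)) = sl2 i (lower2 t);
  tr_lower : forall i t, tr (sl2 i (lower2 t)) = sl2 i (upper2 t);
  tr_H : forall h, sH h -> tr h = h
}.

Definition xsub (N : nat) (D : split_semisimple N) (i : 'I_(srank D))
    (t : algC) : 'M[algC]_N := sl2 i (upper2 t).

(* The simple reflection lambda |-> lambda - <lambda, alpha_i^vee> alpha_i, as
   a matrix acting on row vectors; these generate the Weyl group. *)
Definition refl (N : nat) (D : split_semisimple N) (i : 'I_(srank D)) :
    'M[int]_(sdim D) := 1%:M - (scoroot i)^T *m sroot i.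

Definition weyl_elt (N : nat) (D : split_semisimple N)
    (w : seq 'I_(srank D)) : 'M[int]_(sdim D) :=
  \big[mulmx/1%:M]_(i <- w) refl i.

Definition reduced (N : nat) (D : split_semisimple N)
    (w : seq 'I_(srank D)) : Prop :=
  forall w', weyl_elt w' = weyl_elt w -> (size w <= size w')%N.

(* w is a reduced word of the longest element of the Weyl group. *)
Definition reduced_longest (N : nat) (D : split_semisimple N)
    (w : seq 'I_(srank D)) : Prop :=
  reduced w /\ forall w' : seq 'I_(srank D), reduced w' -> (size w' <= size w)%N.

(** ** Rational functions on the iterated products *)

Definition in_pow (N n : nat) (A : 'M[algC]_N -> Prop)
    (g : 'I_n -> 'M[algC]_N) : Prop := forall k, A (g k).

Definition tentries (N n : nat) (g : 'I_n -> 'M[algC]_N) :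
    'I_n * ('I_N * 'I_N) -> algC := fun x => g x.1 x.2.1 x.2.2.

Record fraction (N n : nat) : Type := Fraction {
  num : ('I_n -> 'M[algC]_N) -> algC;
  den : ('I_n -> 'M[algC]_N) -> algC
}.

Definition regular_on_pow (N n : nat) (G : 'M[algC]_N -> Prop)
    (f : ('I_n -> 'M[algC]_N) -> algC) : Prop :=
  exists p, forall g, in_pow G g -> f g = peval (@ratr algC) p (tentries g).

(* G^n is irreducible (G being connected), so that it suffices to ask that the
   denominator does not vanish identically. *)
Definition rational_on_pow (N n : nat) (D : split_semisimple N)
    (f : fraction N n) : Prop :=
  [/\ regular_on_pow (sG D) (num f), regular_on_pow (sG D) (den f)
    & exists2 g, in_pow (sG D) g & den f g != 0].

Definition same_value (N n : nat) (f : fraction N n)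
    (g g' : 'I_n -> 'M[algC]_N) : Prop :=
  num f g * den f g' = num f g' * den f g.

Definition same_fraction (N n : nat) (D : split_semisimple N)
    (f f' : fraction N n) : Prop :=
  forall g, in_pow (sG D) g -> num f g * den f' g = num f' g * den f g.

(* g and g' have the same class in G^(n): u k is the element of U moved between
   the factors k - 1 and k (numbered from 0). *)
Definition star_eq (N n : nat) (D : split_semisimple N)
    (g g' : 'I_n -> 'M[algC]_N) : Prop :=
  exists u : nat -> 'M[algC]_N, (forall k, sU D (u k)) /\
  forall k : 'I_n,
    g' k = (if k == 0%N :> nat then 1%:M else u k) *m g k
             *m (if k.+1 == n then 1%:M else invmx (u k.+1)).

Definition UU_act (N n : nat) (u u' : 'M[algC]_N)
    (g : 'I_n -> 'M[algC]_N) : 'I_n -> 'M[algC]_N :=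
  fun k => (if k == 0%N :> nat then u else 1%:M) *m g k
             *m (if k.+1 == n then u' else 1%:M).

(* f is a rational function over Q on G^(n), i.e. on G^n and invariant under
   U^(n-1), that is moreover invariant under U x U. *)
Definition UU_invariant (N n : nat) (D : split_semisimple N)
    (f : fraction N n) : Prop :=
  rational_on_pow D f /\
  forall u u' g g', sU D u -> sU D u' -> in_pow (sG D) g ->
    star_eq D (UU_act u u' g) g' -> same_value f g g'.

Definition pullback (N n n' : nat)
    (phi : ('I_n' -> 'M[algC]_N) -> ('I_n -> 'M[algC]_N)) (f : fraction N n) :
    fraction N n' :=
  Fraction (fun g => num f (phi g)) (fun g => den f (phi g)).

(** ** Positivity *)

(* The product over n factors of the charts
   (h, t) |-> h (x_(i_1)(t_1) ... x_(i_m)(t_m))^T of B^-,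
   where H is identified with (G_m)^d through tau. *)
Definition chart (N n : nat) (D : split_semisimple N) (w : seq 'I_(srank D))
    (v : 'I_n * ('I_(sdim D) + 'I_(size w)) -> algC) : 'I_n -> 'M[algC]_N :=
  fun k => stau (fun i => v (k, inl i))
    *m tr D (\big[mulmx/1%:M]_(l < size w)
               xsub (tnth (in_tuple w) l) (v (k, inr l))).

Definition nonneg_laurent (I : finType) (f : (I -> algC) -> algC) : Prop :=
  exists (p : {mpoly rat[#|I|]}) (e : I -> int),
    [/\ p != 0, forall m, 0 <= p@_m
      & forall v, torus_point v -> f v = peval (@ratr algC) p v * lmonom v e].

(* The restriction to the chart is computed with a representative f' of f
   whose denominator does not vanish identically there. *)
Definition positive (N n : nat) (D : split_semisimple N)
    (w : seq 'I_(srank D)) (f : fraction N n) : Prop :=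
  exists f' : fraction N n,
    [/\ rational_on_pow D f', same_fraction D f f',
        exists2 v, torus_point v & den f' (chart (w := w) v) != 0
      & exists a b, [/\ nonneg_laurent a, nonneg_laurent b
        & forall v, torus_point v ->
            num f' (chart (w := w) v) * b v = a v * den f' (chart (w := w) v)]].

Definition UU_invariant_positive (N n : nat) (D : split_semisimple N)
    (w : seq 'I_(srank D)) (f : fraction N n) : Prop :=
  UU_invariant D f /\ positive w f.

(** ** The maps m_k, p and q, on representatives *)

(* Factors are numbered from 0: the factors k and k + 1 are multiplied. *)
Definition mk_map (N n : nat) (k : 'I_n) (g : 'I_n.+1 -> 'M[algC]_N) :
    'I_n -> 'M[algC]_N :=
  fun j => if (j < k)%N then g (widen_ord (leqnSn n) j)
           else if j == k then g (widen_ord (leqnSn n) j) *m g (lift ord0 j)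
           else g (lift ord0 j).

Definition p_map (N n : nat) (g : 'I_n.+1 -> 'M[algC]_N) : 'I_n -> 'M[algC]_N :=
  fun j => g (lift ord0 j).

Definition q_map (N n : nat) (g : 'I_n.+1 -> 'M[algC]_N) : 'I_n -> 'M[algC]_N :=
  fun j => g (widen_ord (leqnSn n) j).

(* Main.v *)
Require Import Defs.
From mathcomp Require Import ring zify.

Set Implicit Arguments.
Unset Strict Implicit.
Unset Printing Implicit Defensive.

Import Order.TTheory GRing.Theory Num.Theory.
Local Open Scope ring_scope.

(* Only the maps m_k need an argument: their positivity says that a product of
   two points of the chart of B^- lies again in the chart, with subtraction-free
   coordinates.  Moving the torus parts to the left, this reduces to
     x_i(a) x_w(t) = x_w(t'),  t' subtraction-free in a and t.
   As w is longest, w0 also has a reduced word starting with i, to which w is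
   connected by braid moves (Tits), so it suffices that each braid relation of
   rank two is realised by a subtraction-free change of parameters.

   For two simple roots the Serre relations follow from the SL_2-decomposition
   of x_i(t), a polynomial in t, into factors polynomial in 1 / t.  A word in
   x_e, x_f with (ad e)^4 f = (ad f)^2 e = 0 is x_e(total) times conjugates of
   x_f by powers of x_e; these lie in a Heisenberg group, so the braid relation
   becomes the equality of a few moments of a measure with atoms at the partial
   sums of the parameters of x_e.  The real roots, hence the exchange condition,
   come from conjugating root vectors by representatives of the simple
   reflections, and finiteness of the Weyl group from the existence of a longest
   word.

   Identities are first established at positive real parameters, where no
   denominator vanishes, and extended by Zariski density.  The denominator does
   not vanish identically after pulling back, because the product of two charts
   degenerates to one chart when one of the factors tends to the identity. *)

(** * One-parameter groups of matrices *)

(** The given data contain neither the Serre relations, nor <alpha_i, alpha_i^vee> = 2, nor the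
    exchange condition; all are derived from the morphisms of SL_2 and the signs of roots. Most
    matrix identities are proved by checking that two polynomial curves solve the same linear
    differential equation.

    Origin of the moments: put Y(s) = exp (s ad e) f, of degree at most 3 in s. A word is a product
    of factors exp (m_k Y(s_k)) followed by x_e(T). In a Heisenberg group such a product depends
    only on the sum of the m_k Y(s_k), hence on the moments of order at most 3, and on the sum of
    the central brackets, which are multiples of m_k m_l (s_l - s_k)^3. A word that starts with x_f
    has its first atom at 0. A braid relation therefore asks for a measure with an atom at 0 and
    prescribed moments, and solving for it gives the fractions in [braid_a2], [braid_b2] and
    [braid_g2].

    Rank two subsystems of infinite type are ruled out without classification: they would produce
    alternating prefixes longer than the word itself. *)

Section PolynomialCurves.
Variables (F : numFieldType) (N : nat).
Implicit Types (P Q : 'M[{poly F}]_N) (X Y : 'M[F]_N) (x : F -> 'M[F]_N).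

(** Positive integers serve as test points, so that a polynomial known only at positive arguments is
    covered; [sep_laurent_eq0] relies on this. *)
Lemma poly_nat_inj (p q : {poly F}) :
  (forall n, p.[n.+1%:R] = q.[n.+1%:R]) -> p = q.
Proof.
move=> pq; apply/eqP; rewrite -subr_eq0; apply/eqP.
pose rs := [seq i.+1%:R : F | i <- iota 0 (size (p - q))].
apply: (@roots_geq_poly_eq0 _ _ rs); last by rewrite size_map size_iota.
  by apply/allP=> _ /mapP[n _ ->]; rewrite /root !hornerE pq subrr.
rewrite map_inj_uniq ?iota_uniq // => m n /eqP.
by rewrite eqr_nat eqSS => /eqP.
Qed.

Lemma poly_fun_inj (p q : {poly F}) : (forall s, p.[s] = q.[s]) -> p = q.
Proof. by move=> pq; apply: poly_nat_inj. Qed.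

Definition mxeval P (s : F) : 'M[F]_N := map_mx (horner_eval s) P.
Lemma mxeval_entry P s a b : mxeval P s a b = (P a b).[s].
Proof. by rewrite mxE. Qed.

Definition mxderiv P : 'M[{poly F}]_N := map_mx (@deriv F) P.
Definition mxcst X : 'M[{poly F}]_N := map_mx polyC X.
Definition mxcomp P (q : {poly F}) : 'M[{poly F}]_N := map_mx (comp_poly q) P.

Lemma mxeval_inj P Q : (forall s, mxeval P s = mxeval Q s) -> P = Q.
Proof.
move=> PQ; apply/matrixP=> a b; apply: poly_fun_inj => s.
by have /matrixP/(_ a b) := PQ s; rewrite !mxE.
Qed.

Lemma mxevalM P Q s : mxeval (P *m Q) s = mxeval P s *m mxeval Q s.
Proof. exact: map_mxM. Qed.

Lemma mxevalD P Q s : mxeval (P + Q) s = mxeval P s + mxeval Q s.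
Proof. exact: map_mxD. Qed.

Lemma mxevalZ (p : {poly F}) P s : mxeval (p *: P) s = p.[s] *: mxeval P s.
Proof. by apply/matrixP=> a b; rewrite !mxE /= /horner_eval hornerM. Qed.

Lemma mxeval_cst X s : mxeval (mxcst X) s = X.
Proof. by apply/matrixP=> a b; rewrite !mxE /= /horner_eval hornerC. Qed.

Lemma mxeval_comp P q s : mxeval (mxcomp P q) s = mxeval P q.[s].
Proof. by apply/matrixP=> a b; rewrite !mxE /= /horner_eval horner_comp. Qed.

Definition mxevalE := (mxevalM, mxevalD, mxevalZ, mxeval_cst, mxeval_comp).

Lemma mxderivM P Q : mxderiv (P *m Q) = mxderiv P *m Q + P *m mxderiv Q.
Proof.
apply/matrixP=> a b; rewrite !mxE raddf_sum /= -big_split /=.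
by apply: eq_bigr => c _; rewrite derivM !mxE.
Qed.

Lemma mxderivD P Q : mxderiv (P + Q) = mxderiv P + mxderiv Q.
Proof. exact: map_mxD. Qed.

Lemma mxderivZ (p : {poly F}) P :
  mxderiv (p *: P) = p^`() *: P + p *: mxderiv P.
Proof. by apply/matrixP=> a b; rewrite !mxE derivM. Qed.

Lemma mxderiv_cst X : mxderiv (mxcst X) = 0.
Proof. by apply/matrixP=> a b; rewrite !mxE derivC. Qed.

Lemma mxderiv_comp P q : mxderiv (mxcomp P q) = q^`() *: mxcomp (mxderiv P) q.
Proof. by apply/matrixP=> a b; rewrite !mxE deriv_comp mulrC. Qed.

Lemma mxcstM X Y : mxcst (X *m Y) = mxcst X *m mxcst Y.
Proof. exact: map_mxM. Qed.

Lemma mxcstD X Y : mxcst (X + Y) = mxcst X + mxcst Y.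
Proof. exact: map_mxD. Qed.

(** In degree k the equation expresses k + 1 times the next coefficient of [P] through coefficients
    of degree at most k, and the characteristic is 0. *)
Lemma linear_ode0 P A B :
  mxderiv P = A *m P + P *m B -> mxeval P 0 = 0 -> P = 0.
Proof.
move=> ode P0; suff P_ k a b : (P a b)`_k = 0.
  by apply/matrixP=> a b; apply/polyP=> k; rewrite P_ mxE coef0.
elim/ltn_ind: k a b => -[|k] IH a b.
  by have /matrixP/(_ a b) := P0; rewrite !mxE /= /horner_eval horner_coef0.
have /matrixP/(_ a b) := ode; rewrite !mxE => /(congr1 (fun p : {poly F} =>
  p`_k)).
rewrite coef_deriv coefD !coef_sum !big1 ?addr0.
- by move/eqP; rewrite mulrn_eq0 => /eqP.
- move=> c _; rewrite coefM big1 // => l _.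
  by rewrite IH ?mul0r // ltnS -ltnS ltn_ord.
move=> c _; rewrite coefM big1 // => l _.
by rewrite IH ?mulr0 // ltnS leq_subr.
Qed.

Lemma linear_ode_unique P Q A B :
    mxderiv P = A *m P + P *m B -> mxderiv Q = A *m Q + Q *m B ->
  mxeval P 0 = mxeval Q 0 -> P = Q.
Proof.
move=> odeP odeQ PQ0; apply/eqP; rewrite -subr_eq0; apply/eqP.
apply: (@linear_ode0 _ A B); last by rewrite /mxeval map_mxB [X in X - _]PQ0
  subrr.
rewrite /mxderiv map_mxB [X in X - _]odeP [X in _ - X]odeQ mulmxBr mulmxBl.
by rewrite opprD addrACA.
Qed.

Lemma right_ode_unique P Q B :
    mxderiv P = P *m B -> mxderiv Q = Q *m B ->
  mxeval P 0 = mxeval Q 0 -> P = Q.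
Proof.
by move=> odeP odeQ; apply: (@linear_ode_unique _ _ 0 B); rewrite mul0mx add0r.
Qed.

Lemma left_ode_unique P Q A :
    mxderiv P = A *m P -> mxderiv Q = A *m Q ->
  mxeval P 0 = mxeval Q 0 -> P = Q.
Proof.
by move=> odeP odeQ; apply: (@linear_ode_unique _ _ A 0); rewrite mulmx0 addr0.
Qed.

(** [P] plays the part of exp (s X), polynomial in s as X is then nilpotent. *)
Definition exp_curve P X := mxeval P 0 = 1%:M /\ mxderiv P = P *m mxcst X.

Definition one_param x X :=
  exists2 P, exp_curve P X & forall s, x s = mxeval P s.

(** Differentiate x (s + t) = x s x t with respect to t at t = 0. *)
Lemma one_param_of_hom x P :
    (forall s, x s = mxeval P s) -> (forall s t, x (s + t) = x s *m x t) ->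
  x 0 = 1%:M -> one_param x (mxeval (mxderiv P) 0).
Proof.
move=> xP xD x0; exists P => //; split; first by rewrite -xP.
apply: mxeval_inj => s.
have E : mxcomp P ('X + s%:P) = mxcst (mxeval P s) *m P.
  by apply: mxeval_inj => t; rewrite !mxevalE !hornerE -!xP -xD addrC.
have := congr1 (fun Q => mxeval (mxderiv Q) 0) E.
rewrite mxderiv_comp mxderivM mxderiv_cst mul0mx add0r !mxevalE.
by rewrite derivD derivX derivC addr0 !hornerE scale1r => ->.
Qed.

(** Both sides solve Q' = Q X with value Y at 0. The identities of curves below follow this
    pattern. *)
Lemma exp_curve_comm P X Y : exp_curve P X -> X *m Y = Y *m X ->
  mxcst Y *m P = P *m mxcst Y.
Proof.
move=> [P0 dP] XY; apply: (@right_ode_unique _ _ (mxcst X)).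
- by rewrite mxderivM mxderiv_cst mul0mx add0r dP mulmxA.
- by rewrite mxderivM mxderiv_cst mulmx0 addr0 dP -!mulmxA -!mxcstM XY.
by rewrite !mxevalE P0 mulmx1 mul1mx.
Qed.

Lemma one_param_comm x X Y s : one_param x X -> X *m Y = Y *m X ->
  Y *m x s = x s *m Y.
Proof.
move=> [P eP xP] XY; have := congr1 (fun Q => mxeval Q s)
  (exp_curve_comm eP XY).
by rewrite !mxevalE -xP.
Qed.

Lemma one_paramD x X s t : one_param x X -> x (s + t) = x s *m x t.
Proof.
move=> [P [P0 dP] xP]; rewrite !xP.
suff /(congr1 (fun Q => mxeval Q t)) : mxcomp P ('X + s%:P)
  = mxcst (mxeval P s) *m P.
  by rewrite !mxevalE !hornerE addrC.
apply: (@right_ode_unique _ _ (mxcst X)).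
- rewrite mxderiv_comp derivD derivX derivC addr0 scale1r dP.
  apply: mxeval_inj => u; rewrite !mxevalE //.
- by rewrite mxderivM mxderiv_cst mul0mx add0r dP mulmxA.
by rewrite !mxevalE !hornerE P0 mulmx1.
Qed.

Lemma one_param0 x X : one_param x X -> x 0 = 1%:M.
Proof. by move=> [P [P0 _] ->]. Qed.

Lemma one_paramN x X s : one_param x X -> x s *m x (- s) = 1%:M.
Proof. by move=> xX; rewrite -(one_paramD _ _ xX) subrr (one_param0 xX). Qed.

Lemma one_param_unique x y X : one_param x X -> one_param y X -> x =1 y.
Proof.
move=> [P [P0 dP] xP] [Q [Q0 dQ] yQ] s; rewrite xP yQ.
by rewrite (right_ode_unique dP dQ) ?P0.
Qed.

Lemma one_param_gen x X Y : one_param x X -> one_param x Y -> X = Y.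
Proof.
move=> [P [P0 dP] xP] [Q [Q0 dQ] xQ].
have PQ : P = Q by apply: mxeval_inj => s; rewrite -xP xQ.
have := congr1 (fun Q => mxeval Q 0) dP; rewrite PQ dQ !mxevalE Q0 !mul1mx.
exact: esym.
Qed.

Lemma one_paramZ x X c : one_param x X -> one_param (fun s => x (c * s))
  (c *: X).
Proof.
move=> [P [P0 dP] xP]; exists (mxcomp P (c *: 'X)).
  split; first by rewrite !mxevalE !hornerE.
  rewrite mxderiv_comp derivZ derivX dP.
  by apply: mxeval_inj => s; rewrite !mxevalE !hornerE -scalemxAr.
by move=> s; rewrite mxevalE !hornerE.
Qed.

Lemma one_param_conj x X g h : g *m h = 1%:M -> one_param x X ->
  one_param (fun s => g *m x s *m h) (g *m X *m h).
Proof.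
move=> gh [P [P0 dP] xP]; exists (mxcst g *m P *m mxcst h).
  split; first by rewrite !mxevalE P0 mulmx1 gh.
  rewrite !mxderivM !mxderiv_cst mulmx0 mul0mx add0r addr0 dP !mxcstM !mulmxA.
  rewrite -[_ *m mxcst h *m mxcst g]mulmxA -mxcstM (mulmx1C gh).
  by rewrite /mxcst map_mx1 mulmx1.
by move=> s; rewrite !mxevalE -xP.
Qed.

End PolynomialCurves.

(** * Brackets and products in Heisenberg groups *)

Section Bracket.
Variables (F : numFieldType) (N : nat).
Implicit Types (A B X Y e f : 'M[F]_N) (x : F -> 'M[F]_N).

Definition br A B : 'M[F]_N := A *m B - B *m A.

Lemma brDl A B X : br (A + B) X = br A X + br B X.
Proof. by rewrite /br mulmxDl mulmxDr opprD addrACA. Qed.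
Lemma brDr A B X : br X (A + B) = br X A + br X B.
Proof. by rewrite /br mulmxDl mulmxDr opprD addrACA. Qed.
Lemma brZl c A X : br (c *: A) X = c *: br A X.
Proof. by rewrite /br -scalemxAl -scalemxAr scalerBr. Qed.
Lemma brZr c A X : br X (c *: A) = c *: br X A.
Proof. by rewrite /br -scalemxAl -scalemxAr scalerBr. Qed.
Lemma brC A B : br A B = - br B A.
Proof. by rewrite /br opprB. Qed.
Lemma brr A : br A A = 0.
Proof. exact: subrr. Qed.
Lemma brNr A X : br X (- A) = - br X A.
Proof. by rewrite -scaleN1r brZr scaleN1r. Qed.
Lemma br0r X : br X 0 = 0.
Proof. by rewrite /br mulmx0 mul0mx subrr. Qed.

Lemma addmxE A B a b : (A + B) a b = A a b + B a b. Proof. by rewrite mxE. Qed.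
Lemma oppmxE A a b : (- A) a b = - A a b. Proof. by rewrite mxE. Qed.

Lemma br0l X : br 0 X = 0.
Proof. by rewrite /br mulmx0 mul0mx subrr. Qed.

Lemma br_jacobi e A B : br e (br A B) = br (br e A) B + br A (br e B).
Proof.
rewrite /br !mulmxBl !mulmxBr !mulmxA; apply/matrixP=> a b.
by rewrite !(addmxE, oppmxE); ring.
Qed.

Lemma br0_comm A B : br A B = 0 -> A *m B = B *m A.
Proof. by move/subr0_eq. Qed.

(** The series exp (- s ad B) A = A + s [A, B] + ... stops there because [A, B] commutes with B. *)
Lemma mul_exp_curve A B (P : 'M[{poly F}]_N) : exp_curve P B ->
    br (br A B) B = 0 ->
  mxcst A *m P = P *m (mxcst A + 'X *: mxcst (br A B)).
Proof.
move=> [P0 dP] /br0_comm cAB; apply: (@right_ode_unique _ _ _ _ (mxcst B)).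
- by rewrite mxderivM mxderiv_cst mul0mx add0r dP mulmxA.
- rewrite mxderivM mxderivD mxderivZ !mxderiv_cst scaler0 add0r addr0 derivX.
  rewrite scale1r dP -!mulmxA -mulmxDr; congr (P *m _).
  rewrite mulmxDr mulmxDl -scalemxAl -scalemxAr -!mxcstM cAB addrAC -mxcstD.
  by congr (mxcst _ + _); rewrite /br addrC subrK.
by rewrite !mxevalE hornerX scale0r addr0 P0 mulmx1 mul1mx.
Qed.

(* The brackets being central, the logarithmic derivative of the product is
   affine in the parameter, so it only depends on two matrices. *)
Lemma heisenberg_ode (A1 A2 A3 : 'M[F]_N) (P1 P2 P3 : 'M[{poly F}]_N) :
    exp_curve P1 A1 -> exp_curve P2 A2 -> exp_curve P3 A3 ->
    br (br A1 A2) A2 = 0 -> br (br A1 A2) A3 = 0 ->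
    br (br A1 A3) A3 = 0 -> br (br A2 A3) A3 = 0 ->
  mxderiv (P1 *m P2 *m P3) = P1 *m P2 *m P3 *m
    (mxcst (A1 + A2 + A3) + 'X *: mxcst (br A1 A2 + br A1 A3 + br A2 A3)).
Proof.
move=> e1 e2 e3 c122 c123 c133 c233.
have [_ d1] := e1; have [_ d2] := e2; have [_ d3] := e3.
have c : mxcst (br A1 A2) *m P3 = P3 *m mxcst (br A1 A2).
  by apply: exp_curve_comm e3 _; apply: esym (br0_comm c123).
rewrite 2!mxderivM d1 d2 d3 mulmxDl -!mulmxA -!mulmxDr; congr (P1 *m _).
rewrite [_ *m (P2 *m P3)]mulmxA (mul_exp_curve e2 c122) -mulmxA -!mulmxDr.
congr (P2 *m _); rewrite [_ *m P3]mulmxDl -scalemxAl c.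
rewrite (mul_exp_curve e3 c133) (mul_exp_curve e3 c233).
rewrite scalemxAr -!mulmxDr; congr (P3 *m _).
apply: mxeval_inj => s; rewrite !mxevalE !hornerX.
by apply/matrixP=> a b; rewrite !mxE; ring.
Qed.

Lemma heisenberg_mul (x1 x2 x3 x1' x2' x3' : F -> 'M[F]_N)
    (A1 A2 A3 A1' A2' A3' : 'M[F]_N) :
    one_param x1 A1 -> one_param x2 A2 -> one_param x3 A3 ->
    one_param x1' A1' -> one_param x2' A2' -> one_param x3' A3' ->
    br (br A1 A2) A2 = 0 -> br (br A1 A2) A3 = 0 ->
    br (br A1 A3) A3 = 0 -> br (br A2 A3) A3 = 0 ->
    br (br A1' A2') A2' = 0 -> br (br A1' A2') A3' = 0 ->
    br (br A1' A3') A3' = 0 -> br (br A2' A3') A3' = 0 ->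
    A1 + A2 + A3 = A1' + A2' + A3' ->
    br A1 A2 + br A1 A3 + br A2 A3 = br A1' A2' + br A1' A3' + br A2' A3' ->
  forall s, x1 s *m x2 s *m x3 s = x1' s *m x2' s *m x3' s.
Proof.
move=> [P1 e1 E1] [P2 e2 E2] [P3 e3 E3] [Q1 e1' E1'] [Q2 e2' E2'] [Q3 e3' E3'].
move=> c122 c123 c133 c233 c122' c123' c133' c233' sumA sumC s.
rewrite E1 E2 E3 E1' E2' E3' -!mxevalM; congr (mxeval _ s).
apply: (right_ode_unique (heisenberg_ode e1 e2 e3 c122 c123 c133 c233)).
  by rewrite sumA sumC; apply: heisenberg_ode.
by rewrite !mxevalM !(proj1 e1, proj1 e2, proj1 e3, proj1 e1', proj1 e2', proj1
  e3').
Qed.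

End Bracket.

(** * Rank two: the conjugates of f by exp (s e) *)

Section RankTwo.
Variables (F : numFieldType) (N : nat).
Variables (xe xf : F -> 'M[F]_N) (e f X1 X2 X3 : 'M[F]_N).
Hypotheses (xeP : one_param xe e) (xfP : one_param xf f).
Hypotheses (eX0 : br e f = X1) (eX1 : br e X1 = X2) (eX2 : br e X2 = X3).
Hypotheses (eX3 : br e X3 = 0) (fX1 : br f X1 = 0).

(** For root vectors e and f, [Z] has weight 3 e + 2 f, the highest root in type G_2. By the Jacobi
    identity all brackets among f, [X1], [X2], [X3] are multiples of it. *)
Let Z := br f X3.

Let X02 : br f X2 = 0.
Proof. by have := br_jacobi e f X1; rewrite fX1 eX0 brr br0r add0r eX1. Qed.

Let X12 : br X1 X2 = - Z.
Proof.
have := br_jacobi e f X2; rewrite X02 eX0 br0r eX2 => /esym/eqP.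
by rewrite addr_eq0 => /eqP.
Qed.

(** Applying ad e to Z = [f, X3] and to - Z = [X1, X2] gives [X1, X3] both times, so that [X1, X3]
    is its own opposite. *)
Let X13 : br X1 X3 = 0.
Proof.
have := br_jacobi e f X3; rewrite eX3 br0r addr0 eX0 -/Z => eZ.
have := br_jacobi e X1 X2; rewrite X12 eX1 brr add0r brNr eX2 eZ => /eqP.
by rewrite eq_sym -addr_eq0 -mulr2n -scaler_nat scaler_eq0 pnatr_eq0 => /eqP.
Qed.

Let X23 : br X2 X3 = 0.
Proof.
by have := br_jacobi e X1 X3; rewrite X13 eX3 eX1 !br0r addr0.
Qed.

Let ZE : Z = - br X1 X2. Proof. by rewrite X12 opprK. Qed.

Let Z0 : br Z f = 0.
Proof. by rewrite ZE brC brNr br_jacobi fX1 X02 br0r br0l addr0 !oppr0. Qed.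

Let Z1 : br Z X1 = 0.
Proof.
by rewrite brC br_jacobi X13 br0r addr0 (brC X1) fX1 oppr0 br0l oppr0.
Qed.

Let Z2 : br Z X2 = 0.
Proof.
by rewrite brC br_jacobi X23 br0r addr0 (brC X2) X02 oppr0 br0l oppr0.
Qed.

Let Z3 : br Z X3 = 0.
Proof.
rewrite ZE brC brNr br_jacobi (brC X3 X1) (brC X3 X2) X13 X23.
by rewrite !oppr0 br0r br0l addr0 !oppr0.
Qed.

(** This is exp (s ad e) f, whose series stops because of [eX3]. *)
Definition conj_gen (s : F) : 'M[F]_N :=
  f + s *: X1 + (s ^+ 2 / 2) *: X2 + (s ^+ 3 / 6) *: X3.

(** Conceptually, exp (- s ad e) fixes Z and turns the bracket into that of f with exp ((t - s) ad
    e) f, where only the term in [X3] survives: hence the cube of t - s. *)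
Lemma br_conj_gen s t :
  br (conj_gen s) (conj_gen t) = ((t - s) ^+ 3 / 6) *: Z.
Proof.
rewrite /conj_gen !(brDl, brDr) !(brZl, brZr) !brr.
rewrite (brC X1 f) (brC X2 f) (brC X3 f) (brC X2 X1) (brC X3 X1) (brC X3 X2).
rewrite fX1 X02 X12 X13 X23 -/Z; move: Z => z.
by apply/matrixP=> a b; rewrite !mxE; field.
Qed.

Lemma br_Z_conj_gen s : br Z (conj_gen s) = 0.
Proof.
by rewrite /conj_gen !(brDr, brZr) Z0 Z1 Z2 Z3 !scaler0 !addr0.
Qed.

(** Both sides solve Q' = e Q in s, since the derivative of [conj_gen] is its bracket with e. *)
Lemma conj_genE s : xe s *m f = conj_gen s *m xe s.
Proof.
have [P eP xP] := xeP; have [P0 dP] := eP.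
have [Y YE dYE] : exists2 Y, forall t, mxeval Y t = conj_gen t
    & forall t, mxeval (mxderiv Y) t = br e (conj_gen t).
  exists (mxcst f + 'X *: mxcst X1 + ('X^2 * (2%:R^-1)%:P) *: mxcst X2
      + ('X^3 * (6%:R^-1)%:P) *: mxcst X3) => t.
    by rewrite !mxevalE !hornerE.
  rewrite !mxderivD !mxderivZ !mxderiv_cst !scaler0 !addr0 add0r !mxevalE.
  rewrite !derivE !hornerE /conj_gen !(brDr, brZr)
    eX0 eX1 eX2 eX3 scaler0 addr0.
  by apply/matrixP=> a b; rewrite !mxE; field.
suff /(congr1 (fun Q => mxeval Q s)) : P *m mxcst f = Y *m P.
  by rewrite !mxevalM mxeval_cst YE -xP.
have dPl : mxderiv P = mxcst e *m P by rewrite dP (exp_curve_comm eP).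
apply: (@left_ode_unique _ _ _ _ (mxcst e)).
- by rewrite mxderivM mxderiv_cst mulmx0 addr0 dPl mulmxA.
- rewrite mxderivM dPl mulmxA -mulmxDl mulmxA; congr (_ *m P).
  apply: mxeval_inj => t; rewrite mxevalD !mxevalM dYE YE mxeval_cst.
  by rewrite /br subrK.
rewrite !mxevalM YE mxeval_cst P0 mul1mx mulmx1 /conj_gen.
by rewrite !expr0n /= !mul0r !scale0r !addr0.
Qed.

Definition conj_root (s m : F) := xe s *m xf m *m xe (- s).

Lemma one_param_conj_root s m :
  one_param (fun t => conj_root s (m * t)) (m *: conj_gen s).
Proof.
have -> : m *: conj_gen s = xe s *m (m *: f) *m xe (- s).
  rewrite -scalemxAr -scalemxAl conj_genE -mulmxA.
  by rewrite (one_paramN _ xeP) mulmx1.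
exact: one_param_conj (one_paramN _ xeP) (one_paramZ _ xfP).
Qed.

(* The conjugates of xf generate a Heisenberg group, in which a product is
   determined by the moments of the masses m k placed at the points s k and
   by their cubic energy. *)
Lemma conj_root_mul (m1 m2 m3 s1 s2 s3 m1' m2' m3' s1' s2' s3' : F) :
    m1 + m2 + m3 = m1' + m2' + m3' ->
    m1 * s1 + m2 * s2 + m3 * s3 = m1' * s1' + m2' * s2' + m3' * s3' ->
    (X2 != 0 -> m1 * s1 ^+ 2 + m2 * s2 ^+ 2 + m3 * s3 ^+ 2
       = m1' * s1' ^+ 2 + m2' * s2' ^+ 2 + m3' * s3' ^+ 2) ->
    (X3 != 0 -> m1 * s1 ^+ 3 + m2 * s2 ^+ 3 + m3 * s3 ^+ 3
       = m1' * s1' ^+ 3 + m2' * s2' ^+ 3 + m3' * s3' ^+ 3) ->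
    (X3 != 0 -> m1 * m2 * (s2 - s1) ^+ 3 + m1 * m3 * (s3 - s1) ^+ 3
         + m2 * m3 * (s3 - s2) ^+ 3
       = m1' * m2' * (s2' - s1') ^+ 3 + m1' * m3' * (s3' - s1') ^+ 3
         + m2' * m3' * (s3' - s2') ^+ 3) ->
  conj_root s1 m1 *m conj_root s2 m2 *m conj_root s3 m3
    = conj_root s1' m1' *m conj_root s2' m2' *m conj_root s3' m3'.
Proof.
move=> mom0 mom1 mom2 mom3 energy; pose g s m t := conj_root s (m * t).
have gP s m : one_param (g s m) (m *: conj_gen s) by apply: one_param_conj_root.
have g1 s m : conj_root s m = g s m 1 by rewrite /g mulr1.
have brg n1 t1 n2 t2 : br (n1 *: conj_gen t1) (n2 *: conj_gen t2)
    = (n1 * n2 * (t2 - t1) ^+ 3 / 6) *: Z.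
  rewrite brZl brZr br_conj_gen !scalerA; congr (_ *: _); by field.
have brgg n1 t1 n2 t2 n3 t3 :
    br (br (n1 *: conj_gen t1) (n2 *: conj_gen t2)) (n3 *: conj_gen t3) = 0.
  by rewrite brg brZl brZr br_Z_conj_gen !scaler0.
(* A moment enters only as the coefficient of its X_k. The conditional hypotheses thus let one lemma
   serve types A_2 and B_2 too, where [X2] or [X3] vanishes and the higher moments differ. *)
have mulX (V : 'M[F]_N) a a' : (V != 0 -> a = a') -> a *: V = a' *: V.
  by have [->|_ ->//] := eqVneq V 0; rewrite !scaler0.
have {}mom2 := mulX _ _ _ mom2; have {}mom3 := mulX _ _ _ mom3.
have nzX3 : Z != 0 -> X3 != 0.
  by apply: contra_neq => X3_0; rewrite /Z X3_0 br0r.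
have {}energy := mulX Z _ _ (fun h => energy (nzX3 h)).
rewrite !g1; apply: heisenberg_mul (gP _ _) (gP _ _) (gP _ _) (gP _ _) (gP _ _)
  (gP _ _) _ _ _ _ _ _ _ _ _ _ _; rewrite ?brgg //.
- have D n1 n2 n3 t1 t2 t3 :
      n1 *: conj_gen t1 + n2 *: conj_gen t2 + n3 *: conj_gen t3
      = (n1 + n2 + n3) *: f + (n1 * t1 + n2 * t2 + n3 * t3) *: X1
      + 2^-1 *: ((n1 * t1 ^+ 2 + n2 * t2 ^+ 2 + n3 * t3 ^+ 2) *: X2)
      + 6^-1 *: ((n1 * t1 ^+ 3 + n2 * t2 ^+ 3 + n3 * t3 ^+ 3) *: X3).
    by apply/matrixP=> a b; rewrite !mxE; field.
  by rewrite !D mom0 mom1 mom2 mom3.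
rewrite !brg -!scalerDl.
have D (a b c : F) : (a / 6 + b / 6 + c / 6) *: Z = 6^-1 *: ((a + b + c) *: Z).
  by rewrite scalerA; congr (_ *: _); field.
by rewrite !D energy.
Qed.

End RankTwo.

(** * Braid relations of rank two *)

(* The polynomials in the transition map of type G_2, from Berenstein and
   Zelevinsky, "Total positivity in Schubert varieties". *)
Section G2Polynomials.
Variables (R : comNzRingType) (t1 t2 t3 t4 t5 t6 : R).

Definition g2pi1 := t1 * t2 * t3 ^+ 2 * t4 + t1 * t2 * (t3 + t5) ^+ 2 * t6
  + (t1 + t3) * t4 * t5 ^+ 2 * t6.
Definition g2pi2 := t1 ^+ 2 * t2 ^+ 2 * t3 ^+ 3 * t4
  + t1 ^+ 2 * t2 ^+ 2 * (t3 + t5) ^+ 3 * t6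
  + (t1 + t3) ^+ 2 * t4 ^+ 2 * t5 ^+ 3 * t6
  + t1 * t2 * t4 * t5 ^+ 2 * t6
    * (3 * t1 * t3 + 2 * t3 ^+ 2 + 2 * t3 * t5 + 2 * t1 * t5).
Definition g2pi3 := t1 ^+ 3 * t2 ^+ 2 * t3 ^+ 3 * t4
  + t1 ^+ 3 * t2 ^+ 2 * (t3 + t5) ^+ 3 * t6
  + (t1 + t3) ^+ 3 * t4 ^+ 2 * t5 ^+ 3 * t6
  + t1 ^+ 2 * t2 * t4 * t5 ^+ 2 * t6
    * (3 * t1 * t3 + 3 * t3 ^+ 2 + 3 * t3 * t5 + 2 * t1 * t5).
Definition g2pi4 := t1 ^+ 2 * t2 ^+ 2 * t3 ^+ 3 * t4
    * (t1 * t2 * t3 ^+ 3 * t4 + 2 * t1 * t2 * (t3 + t5) ^+ 3 * t6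
       + (3 * t1 * t3 + 3 * t3 ^+ 2 + 3 * t3 * t5 + 2 * t1 * t5)
         * t4 * t5 ^+ 2 * t6)
  + t6 ^+ 2 * (t1 * t2 * (t3 + t5) ^+ 2 + (t1 + t3) * t4 * t5 ^+ 2) ^+ 3.
Definition g2mu := t2 * t3 ^+ 3 * t4 ^+ 2 * t5 ^+ 3 * t6.
Definition g2nu := t1 * t2 * t3 ^+ 2 * t4 * t5.

Let T := t1 + t3 + t5.
Let mom k := t2 * t1 ^+ k + t4 * (t1 + t3) ^+ k + t6 * T ^+ k.

(** These are the hypotheses of [conj_root_mul] with denominators cleared, for the masses mu / pi3,
    pi2^3 / (pi3 pi4), pi1^3 / pi4 at the nodes 0, pi3 / pi2, T - nu / pi1, against t2, t4, t6 at
    t1, t1 + t3, T. The present one says that the partial sum pi3 / pi2 + pi4 / (pi1 pi2) is the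
    third node. *)
Lemma g2_nodes : g2pi1 * g2pi3 + g2pi4 = g2pi2 * (T * g2pi1 - g2nu).
Proof. rewrite /g2pi1 /g2pi2 /g2pi3 /g2pi4 /g2nu /T; ring. Qed.

Lemma g2_mom0 : g2mu * g2pi4 + g2pi2 ^+ 3 + g2pi1 ^+ 3 * g2pi3
  = mom 0 * (g2pi3 * g2pi4).
Proof. rewrite /mom /g2mu /g2pi1 /g2pi2 /g2pi3 /g2pi4 /T; ring. Qed.

Lemma g2_mom1 : g2pi2 ^+ 2 + g2pi1 ^+ 2 * (T * g2pi1 - g2nu) = mom 1 * g2pi4.
Proof. rewrite /mom /g2nu /g2pi1 /g2pi2 /g2pi4 /T; ring. Qed.

Lemma g2_mom2 : g2pi2 * g2pi3 + g2pi1 * (T * g2pi1 - g2nu) ^+ 2 = mom 2 * g2pi4.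
Proof. rewrite /mom /g2nu /g2pi1 /g2pi2 /g2pi3 /g2pi4 /T; ring. Qed.

Lemma g2_mom3 : g2pi3 ^+ 2 + (T * g2pi1 - g2nu) ^+ 3 = mom 3 * g2pi4.
Proof. rewrite /mom /g2nu /g2pi1 /g2pi3 /g2pi4 /T; ring. Qed.

(** As the first new node is 0, the two energy terms that involve it add up to mu / pi3 times the
    third moment; the remaining term is pi4 / pi3. *)
Lemma g2_energy : g2mu * mom 3 + g2pi4
  = (t2 * t4 * t3 ^+ 3 + t2 * t6 * (t3 + t5) ^+ 3 + t4 * t6 * t5 ^+ 3) * g2pi3.
Proof. rewrite /mom /g2mu /g2pi3 /g2pi4 /T; ring. Qed.

End G2Polynomials.

Ltac solve_gt0 := do ?[assumption | exact: ltr01 | apply: addr_gt0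
  | apply: divr_gt0 | apply: mulr_gt0 | apply: exprn_gt0 | by rewrite ltr0n].

Section G2Positivity.
Variables (F : numFieldType) (t1 t2 t3 t4 t5 t6 : F).
Hypotheses (h1 : 0 < t1) (h2 : 0 < t2) (h3 : 0 < t3).
Hypotheses (h4 : 0 < t4) (h5 : 0 < t5) (h6 : 0 < t6).

Lemma g2pi1_gt0 : 0 < g2pi1 t1 t2 t3 t4 t5 t6.
Proof. by rewrite /g2pi1; solve_gt0. Qed.
Lemma g2pi2_gt0 : 0 < g2pi2 t1 t2 t3 t4 t5 t6.
Proof. by rewrite /g2pi2; solve_gt0. Qed.
Lemma g2pi3_gt0 : 0 < g2pi3 t1 t2 t3 t4 t5 t6.
Proof. by rewrite /g2pi3; solve_gt0. Qed.
Lemma g2pi4_gt0 : 0 < g2pi4 t1 t2 t3 t4 t5 t6.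
Proof. by rewrite /g2pi4; solve_gt0. Qed.
End G2Positivity.

Section BraidRelations.
Variables (F : numFieldType) (N : nat).
Variables (xe xf : F -> 'M[F]_N) (e f : 'M[F]_N).
Hypotheses (xeP : one_param xe e) (xfP : one_param xf f).

Let xeK s t (A : 'M[F]_N) : A *m xe s *m xe t = A *m xe (s + t).
Proof. by rewrite (one_paramD _ _ xeP) mulmxA. Qed.

Let xe0 : xe 0 = 1%:M. Proof. exact: one_param0 xeP. Qed.
Let xf0 : xf 0 = 1%:M. Proof. exact: one_param0 xfP. Qed.

Local Notation c := (conj_root xe xf).

(** The atoms sit at the partial sums of the parameters of [xe]. Six letters suffice up to type G_2;
    shorter words, and those starting with [xf], are obtained by setting parameters to 0. *)
Lemma word_conj_root t1 t2 t3 t4 t5 t6 :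
  xe t1 *m xf t2 *m xe t3 *m xf t4 *m xe t5 *m xf t6
  = c t1 t2 *m c (t1 + t3) t4 *m c (t1 + t3 + t5) t6 *m xe (t1 + t3 + t5).
Proof.
by rewrite /conj_root !mulmxA !xeK addNr xe0 mulmx1 !addKr.
Qed.

Lemma braid_a1a1 : br e f = 0 -> forall t1 t2,
  xe t1 *m xf t2 = xf t2 *m xe t1.
Proof.
move=> /br0_comm ef t1 t2; apply: one_param_comm xfP _.
exact: one_param_comm xeP ef.
Qed.

(** The mass t2 at t1 is split between the nodes 0 and t1 + t3 with the same total and the same
    first moment. *)
Lemma braid_a2 : br e (br e f) = 0 -> br f (br f e) = 0 ->
    forall t1 t2 t3, 0 < t1 -> 0 < t2 -> 0 < t3 ->
  xe t1 *m xf t2 *m xe t3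
  = xf (t2 * t3 / (t1 + t3)) *m xe (t1 + t3) *m xf (t1 * t2 / (t1 + t3)).
Proof.
move=> eef ffe t1 t2 t3 h1 h2 h3.
have h13 : t1 + t3 != 0 by rewrite gt_eqF ?addr_gt0.
have := word_conj_root t1 t2 t3 0 0 0.
rewrite xe0 xf0 !mulmx1 => ->.
set p1 := t2 * t3 / _; set p3 := t1 * t2 / _.
have := word_conj_root 0 p1 (t1 + t3) p3 0 0.
rewrite xe0 xf0 mul1mx !mulmx1 => ->; rewrite !addr0 !add0r; congr (_ *m _).
have fef : br f (br e f) = 0 by rewrite (brC e f) brNr ffe oppr0.
apply: (conj_root_mul xeP xfP erefl eef (br0r e) (br0r e)) => //.
- by rewrite /p1 /p3; field.
- by rewrite /p1 /p3; field.
- by rewrite eqxx.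
- by rewrite eqxx.
by rewrite eqxx.
Qed.

(** [m1] and [m2] are the first and second moments of t2 at t1 and t4 at t1 + t3. A mass at 0
    contributes to neither, so the other atom is m1^2 / m2 at m2 / m1. The mass left for 0 is
    positive by the Cauchy-Schwarz identity (t2 + t4) m2 - m1^2 = t2 t4 t3^2. *)
Lemma braid_b2 : br e (br e (br e f)) = 0 -> br f (br f e) = 0 ->
    forall t1 t2 t3 t4, 0 < t1 -> 0 < t2 -> 0 < t3 -> 0 < t4 ->
  let m1 := t1 * t2 + (t1 + t3) * t4 in
  let m2 := t1 ^+ 2 * t2 + (t1 + t3) ^+ 2 * t4 in
  xe t1 *m xf t2 *m xe t3 *m xf t4
  = xf (t2 * t3 ^+ 2 * t4 / m2) *m xe (m2 / m1) *m xf (m1 ^+ 2 / m2)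
    *m xe (t1 * t2 * t3 / m1).
Proof.
move=> eeef ffe t1 t2 t3 t4 h1 h2 h3 h4 m1 m2.
have n1 : m1 != 0 by rewrite gt_eqF // /m1; solve_gt0.
have n2 : m2 != 0 by rewrite gt_eqF // /m2; solve_gt0.
have := word_conj_root t1 t2 t3 t4 0 0.
rewrite xe0 xf0 !mulmx1 => ->.
set p1 := t2 * _ * _ / _; set p2 := m2 / m1; set p3 := m1 ^+ 2 / m2.
set p4 := _ / m1.
have := word_conj_root 0 p1 p2 p3 0 0.
rewrite xe0 xf0 mul1mx !mulmx1 => ->; rewrite !addr0 !add0r xeK.
have -> : p2 + p4 = t1 + t3 by rewrite /p2 /p4 /m2; move: n1;
  rewrite /m1 => ?; field.
congr (_ *m _).
have fef : br f (br e f) = 0 by rewrite (brC e f) brNr ffe oppr0.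
apply: (conj_root_mul xeP xfP erefl erefl eeef (br0r e)) => //.
- by rewrite /p1 /p3; move: n2; rewrite /m1 /m2 => ?; field.
- by rewrite /p1 /p2 /p3; move: n1 n2; rewrite /m1 /m2 => ? ?; field;
  apply/andP.
- by move=> _; rewrite /p1 /p2 /p3; move: n1 n2; rewrite /m1 /m2 => ? ?;
  field; apply/andP.
- by rewrite eqxx.
by rewrite eqxx.
Qed.

Lemma braid_g2 : br e (br e (br e (br e f))) = 0 -> br f (br f e) = 0 ->
    forall t1 t2 t3 t4 t5 t6,
    0 < t1 -> 0 < t2 -> 0 < t3 -> 0 < t4 -> 0 < t5 -> 0 < t6 ->
  let pi1 := g2pi1 t1 t2 t3 t4 t5 t6 in
  let pi2 := g2pi2 t1 t2 t3 t4 t5 t6 in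
  let pi3 := g2pi3 t1 t2 t3 t4 t5 t6 in
  let pi4 := g2pi4 t1 t2 t3 t4 t5 t6 in
  xe t1 *m xf t2 *m xe t3 *m xf t4 *m xe t5 *m xf t6
  = xf (g2mu t2 t3 t4 t5 t6 / pi3) *m xe (pi3 / pi2)
    *m xf (pi2 ^+ 3 / (pi3 * pi4)) *m xe (pi4 / (pi1 * pi2))
    *m xf (pi1 ^+ 3 / pi4) *m xe (g2nu t1 t2 t3 t4 t5 / pi1).
Proof.
move=> e4f ffe t1 t2 t3 t4 t5 t6 h1 h2 h3 h4 h5 h6 pi1 pi2 pi3 pi4.
have n1 : pi1 != 0 by rewrite gt_eqF ?g2pi1_gt0.
have n2 : pi2 != 0 by rewrite gt_eqF ?g2pi2_gt0.
have n3 : pi3 != 0 by rewrite gt_eqF ?g2pi3_gt0.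
have n4 : pi4 != 0 by rewrite gt_eqF ?g2pi4_gt0.
have Nd := g2_nodes t1 t2 t3 t4 t5 t6; have E := g2_energy t1 t2 t3 t4 t5 t6.
have M0 := g2_mom0 t1 t2 t3 t4 t5 t6; have M1 := g2_mom1 t1 t2 t3 t4 t5 t6.
have M2 := g2_mom2 t1 t2 t3 t4 t5 t6; have M3 := g2_mom3 t1 t2 t3 t4 t5 t6.
rewrite -/pi1 -/pi2 -/pi3 -/pi4 in Nd E M0 M1 M2 M3.
set mu := g2mu _ _ _ _ _ in E M0 *; set nu := g2nu _ _ _ _ _ in Nd M1 M2 M3 *.
have {}Nd : pi3 / pi2 + pi4 / (pi1 * pi2) = t1 + t3 + t5 - nu / pi1.
  apply: (mulIf (mulf_neq0 n1 n2)); transitivity (pi1 * pi3 + pi4).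
    by field; apply/andP.
  by rewrite Nd; field.
rewrite word_conj_root.
have := word_conj_root 0 (mu / pi3) (pi3 / pi2) (pi2 ^+ 3 / (pi3 * pi4))
  (pi4 / (pi1 * pi2)) (pi1 ^+ 3 / pi4).
rewrite xe0 mul1mx => ->; rewrite !add0r xeK Nd subrK; congr (_ *m _).
have fef : br f (br e f) = 0 by rewrite (brC e f) brNr ffe oppr0.
set T := t1 + t3 + t5 in Nd M0 M1 M2 M3 E *.
have D : T - nu / pi1 - pi3 / pi2 = pi4 / (pi1 * pi2)
  by rewrite -Nd addrC addKr.
have nuE : T - nu / pi1 = (T * pi1 - nu) / pi1 by field.
apply: (conj_root_mul xeP xfP erefl erefl erefl e4f) => //.
- apply: (mulIf (mulf_neq0 n3 n4)); rewrite !expr0 !mulr1 in M0.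
  by rewrite -M0; field; apply/andP.
- apply: (mulIf n4); rewrite !expr1 in M1; rewrite -M1 nuE.
  by field; rewrite n1 n2 n3 n4.
- move=> _; apply: (mulIf n4); rewrite -M2 nuE.
  by field; rewrite n1 n2 n3 n4.
- move=> _; apply: (mulIf n4); rewrite -M3 nuE.
  by field; rewrite n1 n2 n3 n4.
move=> _; apply: (mulIf n3); rewrite D !subr0.
transitivity ((t2 * t4 * t3 ^+ 3 + t2 * t6 * (t3 + t5)
  ^+ 3 + t4 * t6 * t5 ^+ 3) * pi3).
  by rewrite /T; ring.
rewrite -E.
transitivity (mu * (pi2 ^+ 3 / (pi3 * pi4) * (pi3 / pi2) ^+ 3
   + pi1 ^+ 3 / pi4 * (T - nu / pi1) ^+ 3) + pi4).
  congr (mu * _ + _); apply: (mulIf n4); rewrite -M3 nuE.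
  by field; rewrite n1 n2 n3 n4.
by field; rewrite n1 n2 n3 n4.
Qed.

End BraidRelations.

(** * Tangent vectors *)

Lemma mpoly_ring_ind (R : nzRingType) n (P : {mpoly R[n]} -> Prop) :
    (forall c, P c%:MP) -> (forall i, P 'X_i) ->
    (forall p q, P p -> P q -> P (p + q)) ->
    (forall p q, P p -> P q -> P (p * q)) ->
  forall p, P p.
Proof.
move=> PC PX PD PM; elim/mpolyind => [|c m p _ _ Pp].
  by rewrite -mpolyC0; apply: PC.
apply: PD => //; rewrite -mul_mpolyC; apply: (PM) (PC c) _.
rewrite mpolyXE_id; apply: big_ind => // [|i _]; first by rewrite -mpolyC1.
elim: (m i) => [|k IH]; first by rewrite expr0 -mpolyC1.
by rewrite exprS; apply: PM.
Qed.

(** Applied to [poly_fun], [regular_on_pow] and [sep_laurent]; the first hypothesis stands in for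
    functional extensionality. *)
Lemma peval_closed (F : nzRingType) (iota : F -> algC) (I : finType) (X : Type)
    (C : (X -> algC) -> Prop) (phi : I -> X -> algC) :
    (forall f g, f =1 g -> C f -> C g) ->
    (forall c, C (fun=> iota c)) -> C (fun=> 0) -> C (fun=> 1) ->
    (forall f g, C f -> C g -> C (fun x => f x + g x)) ->
    (forall f g, C f -> C g -> C (fun x => f x * g x)) ->
    (forall i, C (phi i)) ->
  forall p : {mpoly F[#|I|]}, C (fun x => peval iota p (phi^~ x)).
Proof.
move=> Cext Ccst C0 C1 CD CM Cphi p; rewrite /peval /mmap.
elim: (msupp p) => [|m s IH]; first by apply: (Cext) C0 => x; rewrite big_nil.
suff Cm : C (fun x => mmap1 (fun k => phi (enum_val k) x) m).
  apply: (Cext) (CD _ _ (CM _ _ (Ccst p@_m) Cm) IH) => x.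
  by rewrite [RHS]big_cons.
rewrite /mmap1; elim: (index_enum _) => [|i l IHl].
  by apply: (Cext) C1 => x; rewrite big_nil.
suff Ci : C (fun x => phi (enum_val i) x ^+ m i).
  by apply: (Cext) (CM _ _ Ci IHl) => x; rewrite [RHS]big_cons.
elim: (m i) => [|k IHk]; first exact: (Cext) C1.
by apply: (Cext) (CM _ _ (Cphi (enum_val i)) IHk) => x; rewrite exprS.
Qed.

Definition poly_fun (f : algC -> algC) := exists q, forall s, f s = q.[s].

Lemma poly_fun_peval (F : nzRingType) (iota : F -> algC) (I : finType)
    (phi : I -> algC -> algC) (p : {mpoly F[#|I|]}) :
  (forall i, poly_fun (phi i)) -> poly_fun (fun s => peval iota p (phi^~ s)).
Proof.
move=> phiP; apply: peval_closed => //.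
- by move=> f g fg [q fq]; exists q => s; rewrite -fg.
- by move=> c; exists (iota c)%:P => s; rewrite hornerC.
- by exists 0 => s; rewrite horner0.
- by exists 1 => s; rewrite hornerC.
- by move=> f g [q fq] [r gr]; exists (q + r) => s; rewrite hornerD fq gr.
by move=> f g [q fq] [r gr]; exists (q * r) => s; rewrite hornerM fq gr.
Qed.

Definition curve (N : nat) (g : algC -> 'M[algC]_N) :=
  exists P, forall s, g s = mxeval P s.

Lemma curve_entries N (g : algC -> 'M[algC]_N) :
  (forall a b, poly_fun (fun s => g s a b)) -> curve g.
Proof.
move=> h; have /fin_all_exists[P PE] (x : 'I_N * 'I_N) :
    exists q, forall s, g s x.1 x.2 = q.[s] by apply: h.
exists (\matrix_(a, b) P (a, b)) => s; apply/matrixP=> a b.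
by rewrite !mxE /= /horner_eval -(PE (a, b)).
Qed.

Lemma curve_entry N (g : algC -> 'M[algC]_N) a b :
  curve g -> poly_fun (fun s => g s a b).
Proof. by move=> [P PE]; exists (P a b) => s; rewrite PE mxE. Qed.

Lemma curve_morphism (F : nzRingType) (iota : F -> algC) M N
    (A : 'M[algC]_M -> Prop) (f : 'M[algC]_M -> 'M[algC]_N) g :
  morphism_on iota A f -> (forall s, A (g s)) -> curve g -> curve (f \o g).
Proof.
move=> fA Ag gP; apply: curve_entries => a b; have [p pE] := fA a b.
have [q qE] : poly_fun (fun s => peval iota p (entries (g s))).
  apply: (@poly_fun_peval _ iota _ (fun x s => entries (g s) x)) => x.
  exact: curve_entry.
by exists q => s; rewrite /= pE.
Qed.

Lemma curveM N (g h : algC -> 'M[algC]_N) :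
  curve g -> curve h -> curve (fun s => g s *m h s).
Proof.
by move=> [P PE] [Q QE]; exists (P *m Q) => s; rewrite mxevalM PE QE.
Qed.

Lemma deriv_mmap n (q : 'I_n -> {poly algC}) (p : {mpoly algC[n]}) :
  (mmap polyC q p)^`() = \sum_k mmap polyC q (mderiv k p) * (q k)^`().
Proof.
elim/mpoly_ring_ind: p => [c|i|p r IHp IHr|p r IHp IHr].
- rewrite mmapC derivC big1 // => k _.
  by rewrite mderivC mmap0 mul0r.
- rewrite mmapX mmap1U (bigD1 i) //= big1 => [|k ki].
    by rewrite mderivX mnm1E eqxx -[X in (X - _)%MM]add0m addmK mpolyX0 scale1r
      rmorph1 mul1r addr0.
  by rewrite mderivX mnm1E eq_sym (negbTE ki) scale0r mmap0 mul0r.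
- rewrite mmapD derivD IHp IHr -big_split; apply: eq_bigr => k _ /=.
  by rewrite mderivD mmapD mulrDl.
rewrite rmorphM derivM IHp IHr mulr_suml mulr_sumr -big_split.
apply: eq_bigr => k _ /=; rewrite mderivM rmorphD !rmorphM /=.
by rewrite mulrDl mulrAC !mulrA.
Qed.

Lemma horner_mmap n (q : 'I_n -> {poly algC}) (p : {mpoly algC[n]}) s :
  (mmap polyC q p).[s] = mmap idfun (fun k => (q k).[s]) p.
Proof.
rewrite /mmap horner_sum; apply: eq_bigr => m _.
rewrite hornerM hornerC horner_prod; congr (_ * _).
by apply: eq_bigr => i _; rewrite horner_exp.
Qed.

Lemma eq_peval (F : nzRingType) (iota : F -> algC) (I : finType)
    (p : {mpoly F[#|I|]}) (v v' : I -> algC) :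
  v =1 v' -> peval iota p v = peval iota p v'.
Proof.
move=> vv'; apply: eq_bigr => m _; congr (_ * _); apply: eq_bigr => i _.
by rewrite vv'.
Qed.

Lemma lie_curve N (A : 'M[algC]_N -> Prop) P :
    (forall s, A (mxeval P s)) -> mxeval P 0 = 1%:M ->
  lie A (mxeval (mxderiv P) 0).
Proof.
move=> AP P0 p pA; pose q (k : 'I_#|{: 'I_N * 'I_N}|)
  := P (enum_val k).1 (enum_val k).2.
have qE r s : (mmap polyC q r).[s] = peval idfun r (entries (mxeval P s)).
  rewrite horner_mmap; apply: eq_bigr => m _; congr (_ * _).
  by apply: eq_bigr => i _; rewrite /entries mxE.
have q0 : mmap polyC q p = 0.
  by apply: poly_fun_inj => s; rewrite qE (pA _ (AP s)) horner0.
have := deriv_mmap q p; rewrite q0 deriv0 => /(congr1 (horner^~ 0)).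
rewrite horner0 horner_sum => /esym E; rewrite -[RHS]E; apply: eq_bigr => k _.
by rewrite hornerM qE P0 /entries !mxE.
Qed.

Lemma lie_one_param N (A : 'M[algC]_N -> Prop) x X :
  one_param x X -> (forall s, A (x s)) -> lie A X.
Proof.
move=> xX Ax; have [P eP xP] := xX.
suff <- : mxeval (mxderiv P) 0 = X.
  by apply: lie_curve; [move=> s; rewrite -xP|case: eP].
by case: eP => P0 ->; rewrite mxevalM mxeval_cst P0 mul1mx.
Qed.

(** The equations of [lie A] are linear with constant coefficients, so they can be differentiated
    along a curve. This places brackets in the Lie algebra in [br_f_e]. *)
Lemma lie_mxderiv N (A : 'M[algC]_N -> Prop) (Q : 'M[{poly algC}]_N) s :
  (forall t, lie A (mxeval Q t)) -> lie A (mxeval (mxderiv Q) s).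
Proof.
move=> AQ p pA; pose c k := peval idfun (mderiv k p) (entries (1%:M : 'M_N)).
have E : \sum_k (c k)%:P * Q (enum_val k).1 (enum_val k).2 = 0.
  apply: poly_fun_inj => t; rewrite horner0 -[RHS](AQ t p pA) horner_sum.
  by apply: eq_bigr => k _; rewrite hornerM hornerC /entries mxE.
have := congr1 (fun q : {poly _} => q^`().[s]) E.
rewrite deriv0 horner0 raddf_sum /= horner_sum => {}E; rewrite -[RHS]E.
apply: eq_bigr => k _; rewrite derivM derivC mul0r add0r hornerM hornerC.
by rewrite /entries !mxE.
Qed.

(** * Words in a Weyl group *)

Section Words.
Variable I : Type.
Implicit Types (i j : I) (k : nat).

Fixpoint alt i j k : seq I := if k is k'.+1 then i :: alt j i k' else [::].

Lemma size_alt i j k : size (alt i j k) = k.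
Proof. by elim: k i j => //= k IH i j; rewrite IH. Qed.

Lemma alt_rcons i j k :
  alt i j k.+1 = rcons (alt i j k) (if odd k then j else i).
Proof.
elim: k i j => // k IH i j; rewrite [LHS]/= -[j :: _]/(alt j i k.+1) IH /=.
by case: (odd k).
Qed.

End Words.

(* The coordinates in (alpha_i, alpha_j) of the image of alpha_j under the
   alternating word s_i s_j s_i ... of length k, for off-diagonal Cartan
   integers - a = <alpha_j, alpha_i^vee> and - b = <alpha_i, alpha_j^vee>. *)
Fixpoint dihedral_coef (a b : int) (k : nat) : int * int :=
  if k is k'.+1 then
    let: (p, q) := dihedral_coef a b k' in
    if odd k' then (p, b * p - q) else (a * q - p, q)
  else (0, 1).

Definition coef_ge0 (x : int * int) := (0 <= x.1) && (0 <= x.2).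

(** A computable test for the length m of the braid relation: the images stay positive below m and
    the last of them is a simple root, which by [srefl_conj] makes both alternating words of length
    m equal in the group. *)
Definition dihedral_order (a b : int) (m : nat) :=
  [&& (0 < m)%N, all (fun k => coef_ge0 (dihedral_coef a b k)) (iota 0 m)
    & dihedral_coef a b m.-1 == if odd m.-1 then (0, 1) else (1, 0)].

Lemma dihedral_infinite (a b : int) : 0 <= a -> 0 <= b -> 4 <= a * b ->
  forall k, coef_ge0 (dihedral_coef a b k).
Proof.
move=> a0 b0 ab k.
(* The invariant says that the next reflection does not decrease the coefficient it changes; the
   bound 4 <= a b propagates it. *)
suff: coef_ge0 (dihedral_coef a b k) /\
   let: (p, q) := dihedral_coef a b k in
   if odd k then 2 * q <= b * p else 2 * p <= a * q by case.
elim: k => [|k] /=; first by rewrite /coef_ge0 /=; split => //; lia.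
case: (dihedral_coef a b k) => p q; rewrite /coef_ge0 /=.
by case: (odd k) => -[/andP[p0 q0] h] /=; split; nia.
Qed.

Lemma dihedral_cases (a b : int) : 0 <= a -> 0 <= b -> (a = 0 <-> b = 0) ->
  4 <= a * b \/ [\/ a = 0 /\ b = 0, a = 1 /\ b = 1,
    (a = 2 /\ b = 1) \/ (a = 1 /\ b = 2)
    | (a = 3 /\ b = 1) \/ (a = 1 /\ b = 3)].
Proof.
move=> a0 b0 ab; have [h|h] := leP 4 (a * b); [by left | right].
have [a_0|na] := eqVneq a 0; first by constructor 1; split => //; apply/ab.
have nb : b != 0 by apply: contra_neq na => /ab.
have [a3 b3] : a <= 3 /\ b <= 3 by split; nia.
have three (c : int) : 0 <= c -> c != 0 -> c <= 3 -> [\/ c = 1, c = 2 | c = 3].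
  by case: c => [[|[|[|[|c]]]]|c] // _ _ _;
    [constructor 1|constructor 2|constructor 3].
case: (three a a0 na a3) h => -> h; case: (three b b0 nb b3) h => -> // _;
  [constructor 2|constructor 3|constructor 4|constructor 3|constructor 4];
  intuition.
Qed.

(** * Exchange condition and connectedness of reduced words *)

Section WeylGroup.
Variables (d r : nat) (alpha coroot : 'I_r -> 'rV[int]_d).

Definition srefl i : 'M[int]_d := 1%:M - (coroot i)^T *m alpha i.
(** On row vectors the first letter acts first: [alpha j *m weyl u] is the image of alpha_j under
    the inverse of u for the usual left action. Its sign tells whether prefixing j lengthens u. *)
Definition weyl (u : seq 'I_r) : 'M[int]_d := \big[mulmx/1%:M]_(i <- u) srefl i.
Definition cartan i j : int := (alpha i *m (coroot j)^T) 0 0.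
Definition reduced_word u := forall u', weyl u' = weyl u -> (size u <= size
  u')%N.

Local Notation pos := (nonneg_comb alpha).

Hypothesis alpha_free : forall c : 'I_r -> int,
  \sum_i alpha i *~ c i = 0 -> forall i, c i = 0.
Hypothesis cartan_diag : forall i, cartan i i = 2.
Hypothesis root_sign : forall j u,
  pos (alpha j *m weyl u) \/ pos (- (alpha j *m weyl u)).
(** This will be the length of the word given by [reduced_longest]; finiteness of the Weyl group is
    available in this form. *)
Variable max_len : nat.
Hypothesis reduced_bounded : forall u, reduced_word u -> (size u <= max_len)%N.

Lemma mulmxMnl m n p (A : 'M[int]_(m, n)) (B : 'M_(n, p)) k :
  (A *+ k) *m B = A *m B *+ k.
Proof. by rewrite -!(scaler_nat k) -scalemxAl. Qed.

Lemma mulmxMnr m n p (A : 'M[int]_(m, n)) (B : 'M_(n, p)) k :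
  A *m (B *+ k) = A *m B *+ k.
Proof. by rewrite -!(scaler_nat k) -scalemxAr. Qed.

Lemma weyl_nil : weyl [::] = 1%:M. Proof. by rewrite /weyl big_nil. Qed.

Lemma weyl_cons i u : weyl (i :: u) = srefl i *m weyl u.
Proof. by rewrite /weyl big_cons. Qed.

Lemma weyl_cat u v : weyl (u ++ v) = weyl u *m weyl v.
Proof.
by elim: u => [|i u IH] /=; rewrite ?weyl_nil ?mul1mx // !weyl_cons IH mulmxA.
Qed.

Lemma weyl1 i : weyl [:: i] = srefl i.
Proof. by rewrite weyl_cons weyl_nil mulmx1. Qed.

Lemma weyl_rcons u i : weyl (rcons u i) = weyl u *m srefl i.
Proof. by rewrite -cats1 weyl_cat weyl1. Qed.

Lemma mul_srefl (v : 'rV_d) i :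
  v *m srefl i = v - (v *m (coroot i)^T) 0 0 *: alpha i.
Proof.
by rewrite /srefl mulmxBr mulmx1 mulmxA [in LHS](mx11_scalar (v *m (coroot
  i)^T)) mul_scalar_mx.
Qed.

Lemma alpha_srefl i j : alpha i *m srefl j = alpha i - cartan i j *: alpha j.
Proof. exact: mul_srefl. Qed.

Lemma alpha_srefl_diag i : alpha i *m srefl i = - alpha i.
Proof.
by rewrite alpha_srefl cartan_diag scaler_nat mulr2n opprD addrA subrr sub0r.
Qed.

Lemma sreflK i : srefl i *m srefl i = 1%:M.
Proof.
rewrite {1}/srefl mulmxBl mul1mx -mulmxA alpha_srefl_diag mulmxN opprK.
by rewrite /srefl subrK.
Qed.

Lemma weyl_rev u : weyl u *m weyl (rev u) = 1%:M.
Proof.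
elim: u => [|i u IH]; first by rewrite !weyl_nil mulmx1.
rewrite rev_cons weyl_cons weyl_rcons mulmxA -(mulmxA (srefl i)) IH mulmx1.
exact: sreflK.
Qed.

Lemma weyl_revl u : weyl (rev u) *m weyl u = 1%:M.
Proof. exact/mulmx1C/weyl_rev. Qed.

Lemma alpha_free_eq (b c : 'I_r -> int) :
  \sum_i alpha i *~ b i = \sum_i alpha i *~ c i -> b =1 c.
Proof.
move=> bc i; apply/eqP; rewrite -subr_eq0; apply/eqP.
apply: (alpha_free (c := fun i => b i - c i)).
under eq_bigr do rewrite mulrzBr.
by rewrite sumrB bc subrr.
Qed.

Lemma alpha_sum i (c : int) : alpha i *~ c
  = \sum_k alpha k *~ (if k == i then c else 0).
Proof.
rewrite (bigD1 i) //= eqxx big1 ?addr0 // => k /negbTE ->.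
by rewrite mulr0z.
Qed.

Lemma pos_alpha i : pos (alpha i).
Proof.
exists (fun k => (k == i : nat)); rewrite -[LHS]mulr1z alpha_sum.
by apply: eq_bigr => k _; case: (k == i).
Qed.

Lemma posD v v' : pos v -> pos v' -> pos (v + v').
Proof.
move=> [c ->] [c' ->]; exists (fun i => c i + c' i)%N.
by rewrite -big_split; apply: eq_bigr => i _; rewrite mulrnDr.
Qed.

Lemma posZ (c : int) v : 0 <= c -> pos v -> pos (c *: v).
Proof.
case: c => // n _ [c ->]; exists (fun i => c i * n)%N.
rewrite scaler_sumr; apply: eq_bigr => i _.
by rewrite -[Posz n]intz -pmulrn scaler_nat mulrnA.
Qed.

Lemma pos_antisym v : pos v -> pos (- v) -> v = 0.
Proof.
move=> [c cE] [c' c'E]; rewrite cE big1 // => i _.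
have /alpha_free/(_ i) : \sum_i alpha i *~ (c i + c' i)%N%:Z = 0.
  under eq_bigr do rewrite -pmulrn mulrnDr.
  by rewrite big_split /= -cE -c'E subrr.
by move=> /eqP; rewrite eqz_nat addn_eq0 => /andP[/eqP-> _]; rewrite mulr0n.
Qed.

Lemma alpha_neq0 i : alpha i != 0.
Proof.
apply/eqP=> a0; have := alpha_sum i 1; rewrite mulr1z a0.
by move/esym/alpha_free/(_ i); rewrite eqxx.
Qed.

Lemma root_neq0 j u : alpha j *m weyl u != 0.
Proof.
apply: contra_neq (alpha_neq0 j) => h.
by rewrite -[LHS]mulmx1 -(weyl_rev u) mulmxA h mul0mx.
Qed.

Lemma root_signN j u : pos (alpha j *m weyl u) -> ~ pos (- (alpha j *m weyl u)).
Proof. by move=> p n; have /eqP := root_neq0 j u; apply;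
  apply: pos_antisym. Qed.

(** Only the coefficient of alpha_i changes under s_i. The other ones are nonnegative before and
    nonpositive after, hence zero, and the root is a multiple of alpha_i. *)
Lemma pos_srefl_neg j u i : pos (alpha j *m weyl u) ->
  pos (- (alpha j *m weyl u *m srefl i)) -> alpha j *m weyl u = alpha i.
Proof.
move=> [c cE] [c' c'E].
have [n bE] : exists n : nat, alpha j *m weyl u = alpha i *+ n.
  exists (c i); rewrite cE (bigD1 i) //= big1 ?addr0 // => k ki.
  move: c'E; rewrite mul_srefl; set p := fun_of_matrix _ 0 0.
  move/(congr1 -%R); rewrite opprK cE => /esym/eqP.
  rewrite eq_sym subr_eq addrC -sumrN.
  have -> : p *: alpha i = alpha i *~ p by rewrite -[p in LHS]intz scaler_int.
  rewrite alpha_sum -big_split /= => /eqP E.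
  have /alpha_free_eq/(_ k) : \sum_k alpha k *~ (c k)%:Z
     = \sum_k alpha k *~ ((if k == i then p else 0) - (c' k)%:Z).
    rewrite -[LHS]/(\sum_k alpha k *+ c k) E; apply: eq_bigr => l _.
    by rewrite mulrzBr.
  rewrite (negbTE ki); case: (c k) => // ck; lia.
(* Transported back by the inverse of u, alpha_j is n times an integral combination of simple roots,
   so n divides 1. *)
suff n1 : n = 1%N by rewrite bE n1.
have h : alpha j = alpha i *m weyl (rev u) *+ n.
  by rewrite -mulmxMnl -bE -mulmxA weyl_rev mulmx1.
have [x xE] : exists x : 'I_r -> int,
    alpha i *m weyl (rev u) = \sum_k alpha k *~ x k.
  case: (root_sign i (rev u)) => -[x xE]; first by exists x.
  exists (fun k => - (x k)%:Z); rewrite -[LHS]opprK xE -sumrN.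
  by apply: eq_bigr => k _; rewrite mulrNz.
have := alpha_sum j 1; rewrite mulr1z h xE -sumrMnl.
have -> : \sum_k alpha k *~ x k *+ n = \sum_k alpha k *~ (x k * n%:Z).
  by apply: eq_bigr => k _; rewrite mulrzA -pmulrn.
move/alpha_free_eq/(_ j); rewrite eqxx; case: n {bE h} => [|[|n]] //; first lia.
by case: (x j) => y; lia.
Qed.

Lemma exists_reduced u : exists2 u', reduced_word u' & weyl u' = weyl u.
Proof.
pose P n := [exists t : n.-tuple 'I_r, weyl t == weyl u].
have exP : exists n, P n by exists (size u); apply/existsP; exists (in_tuple u).
have [n /existsP[t /eqP tE] nmin] := ex_minnP exP.
exists t => // u' u'E; rewrite size_tuple; apply: nmin.
by apply/existsP; exists (in_tuple u'); rewrite u'E tE.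
Qed.

(** Pigeonhole: each power has a reduced word of length at most [max_len], and there are finitely
    many such words. *)
Lemma weyl_powers_collide u : exists k l,
  (k < l)%N /\ weyl (flatten (nseq k u)) = weyl (flatten (nseq l u)).
Proof.
pose T := max_len.-bseq 'I_r.
have /fin_all_exists[g gE] (k : 'I_(#|{: T}|).+1) :
    exists t : T, weyl t = weyl (flatten (nseq k u)).
  have [u' /reduced_bounded sz uE] := exists_reduced (flatten (nseq k u)).
  by exists (Bseq sz).
have /injectivePn[k [l kl gkl]] : ~~ injectiveb g.
  apply/negP=> /injectiveP/leq_card; rewrite card_ord ltnn; done.
have E : weyl (flatten (nseq k u)) = weyl (flatten (nseq l u)).
  by rewrite -!gE gkl.
case: (ltngtP k l) => kl'; first by exists k, l.
  by exists l, k.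
by move/eqP: kl; case; apply: val_inj.
Qed.

(* The two reflections have the same root; as the Weyl group is finite, their
   product, which is unipotent, is trivial. *)
Lemma srefl_conj j u i : alpha j *m weyl u = alpha i ->
  weyl (j :: u) = weyl (rcons u i).
Proof.
move=> ji; pose v := weyl u; pose y := weyl (rev u) *m (coroot j)^T.
(* [y] is the coroot of j transported by u; [z] measures how far it is from the coroot of i, which
   has the same root. *)
pose z := y - (coroot i)^T.
have rj : weyl (rev u) *m srefl j *m v = 1%:M - y *m alpha i.
  rewrite /srefl mulmxBr mulmx1 mulmxBl weyl_revl -ji /y /v.
  by rewrite !mulmxA.
have cii : alpha i *m (coroot i)^T = 2%:M.
  by rewrite [LHS]mx11_scalar -[X in X%:M]/(cartan i i) cartan_diag.
have az : alpha i *m z = 0.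
  rewrite /z mulmxBr cii /y -ji -[alpha j *m _ *m _]mulmxA.
  rewrite [weyl u *m _]mulmxA weyl_rev mul1mx [alpha j *m _]mx11_scalar.
  by rewrite -[X in X%:M - _]/(cartan j j) cartan_diag subrr.
have ME : weyl (rev u ++ j :: rcons u i) = 1%:M + z *m alpha i.
  rewrite weyl_cat weyl_cons weyl_rcons !mulmxA rj mulmxBl mul1mx.
  rewrite -mulmxA alpha_srefl_diag mulmxN opprK /srefl /z mulmxBl.
  by rewrite -addrA [- _ + _]addrC.
have Mk k : weyl (flatten (nseq k (rev u ++ j :: rcons u i)))
    = 1%:M + (z *m alpha i) *+ k.
  elim: k => [|k IH]; first by rewrite mulr0n addr0 weyl_nil.
  rewrite -[flatten _]/(_ ++ flatten (nseq k _)) weyl_cat IH ME.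
  rewrite mulmxDl mul1mx mulmxDr mulmx1 mulmxMnr mulmxA -(mulmxA z) az.
  by rewrite mulmx0 mul0mx mul0rn addr0 -addrA -mulrSr.
have [k [l [kl]]] := weyl_powers_collide (rev u ++ j :: rcons u i).
rewrite !Mk => /addrI/eqP; rewrite -(subnKC (ltnW kl)) mulrnDr.
rewrite -subr_eq0 opprD addrA subrr sub0r oppr_eq0 => /eqP zn.
have z0 : z *m alpha i = 0.
  apply/matrixP=> a b; move/matrixP/(_ a b): zn; rewrite mulmxnE !mxE => /eqP.
  by rewrite mulrn_eq0 subn_eq0 leqNgt kl /= => /eqP.
have: weyl u *m weyl (rev u ++ j :: rcons u i) *m srefl i = weyl u *m srefl i.
  by rewrite ME z0 addr0 mulmx1.
rewrite weyl_cat weyl_cons weyl_rcons !mulmxA weyl_rev mul1mx.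
by rewrite -[_ *m srefl i *m srefl i]mulmxA sreflK mulmx1 weyl_cons.
Qed.

(** Along u the image of alpha_j passes from positive to negative; just before the letter i where
    this happens it equals alpha_i. *)
Lemma exchange j u : pos (- (alpha j *m weyl u)) -> exists u1 i u2,
  u = u1 ++ i :: u2 /\ weyl (j :: u1) = weyl (rcons u1 i).
Proof.
elim/last_ind: u => [|u i IH].
  by rewrite weyl_nil mulmx1 => /(pos_antisym (pos_alpha j)) /eqP;
     rewrite (negbTE (alpha_neq0 j)).
rewrite weyl_rcons mulmxA => neg; have [p|] := root_sign j u; last first.
  move=> /IH[u1 [k [u2 [-> E]]]]; exists u1, k, (rcons u2 i); split => //.
  by rewrite rcons_cat.
exists u, i, [::]; rewrite cats1; split => //.
exact/srefl_conj/pos_srefl_neg.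
Qed.

Lemma weyl_consK i u : weyl (i :: i :: u) = weyl u.
Proof. by rewrite !weyl_cons mulmxA sreflK mul1mx. Qed.

Lemma weyl_cons_inj i u v : weyl (i :: u) = weyl (i :: v) -> weyl u = weyl v.
Proof. by move=> h; rewrite -(weyl_consK i u)
  weyl_cons h -weyl_cons weyl_consK. Qed.

Lemma neg_descent i u : pos (- (alpha i *m weyl u)) ->
  exists2 u', weyl (i :: u') = weyl u & (size u').+1 = size u.
Proof.
move=> /exchange[u1 [k [u2 [-> E]]]]; exists (u1 ++ u2).
  by rewrite -cat_cons !weyl_cat E weyl_rcons weyl_cons mulmxA.
by rewrite !size_cat addnS.
Qed.

Lemma reduced_catr u v : reduced_word (u ++ v) -> reduced_word v.
Proof.
move=> red v' v'E; rewrite -(leq_add2l (size u)) -!size_cat; apply: red.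
by rewrite !weyl_cat v'E.
Qed.

Lemma reduced_eq_size u v : reduced_word u -> weyl v = weyl u ->
  size v = size u -> reduced_word v.
Proof. by move=> red E sz v' v'E; rewrite sz; apply: red; rewrite v'E E. Qed.

Lemma reduced_cons_pos i u : reduced_word (i :: u) -> pos (alpha i *m weyl u).
Proof.
move=> red; have [//|/neg_descent[u' E sz]] := root_sign i u.
suff /red : weyl u' = weyl (i :: u) by rewrite /= -sz; lia.
by rewrite weyl_cons -E -weyl_cons weyl_consK.
Qed.

Lemma pos_reduced_cons i u :
  reduced_word u -> pos (alpha i *m weyl u) -> reduced_word (i :: u).
Proof.
move=> red p u' u'E.
have : pos (- (alpha i *m weyl u')).
  by rewrite u'E weyl_cons mulmxA alpha_srefl_diag mulNmx opprK.
move=> /neg_descent[u'' E sz]; rewrite /= -sz ltnS; apply: red.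
by apply: (@weyl_cons_inj i); rewrite E.
Qed.

Lemma longest_neg w : reduced_word w ->
    (forall u, reduced_word u -> (size u <= size w)%N) ->
  forall i, pos (- (alpha i *m weyl w)).
Proof.
move=> red longest i; have [|//] := root_sign i w.
by move=> /(pos_reduced_cons red)/longest; rewrite ltnn.
Qed.

Lemma dihedral_root i j k : i != j ->
  alpha j *m weyl (alt i j k)
  = (dihedral_coef (- cartan j i) (- cartan i j) k).1 *: alpha i
    + (dihedral_coef (- cartan j i) (- cartan i j) k).2 *: alpha j.
Proof.
move=> ij; elim: k => [|k IH].
  by rewrite weyl_nil mulmx1 /= scale0r add0r scale1r.
rewrite alt_rcons weyl_rcons mulmxA IH /=.
case: (dihedral_coef _ _ k) => p q /=; rewrite mulmxDl -!scalemxAl.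
case: (odd k) => /=; rewrite alpha_srefl_diag alpha_srefl;
  by apply/matrixP=> a b; rewrite !mxE; ring.
Qed.

(** Letters are peeled off in alternation. If the next one could not be, alpha_i and alpha_j would
    both have positive images under the remaining word z, and the image of alpha_j under u, a
    nonnegative combination of these, would be positive. *)
Lemma peel_dihedral i j u k : i != j -> reduced_word u ->
    pos (- (alpha i *m weyl u)) -> pos (- (alpha j *m weyl u)) ->
    (forall l, (l < k)%N ->
       coef_ge0 (dihedral_coef (- cartan j i) (- cartan i j) l)) ->
  exists2 z, weyl (alt i j k ++ z) = weyl u & size (alt i j k ++ z) = size u.
Proof.
move=> ij red negi negj; elim: k => [|k IH] coef; first by exists u.
have [z zE zsz] := IH (fun l lk => coef l (ltnW lk)).
pose l := if odd k then j else i.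
have [posl|/neg_descent[z' z'E z'sz]] := root_sign l z; last first.
  exists z'.
    by rewrite alt_rcons cat_rcons weyl_cat z'E -weyl_cat zE.
  by rewrite alt_rcons cat_rcons -zsz !size_cat /= z'sz.
case: k => [|k] in IH coef zE zsz l posl *.
  by case: (root_signN posl); rewrite zE.
pose l' := if odd k then j else i.
have posl' : pos (alpha l' *m weyl z).
  apply: reduced_cons_pos; apply: (@reduced_catr (alt i j k)).
  by rewrite -cat_rcons -alt_rcons; apply: reduced_eq_size zE zsz.
have [posi posj] : pos (alpha i *m weyl z) /\ pos (alpha j *m weyl z).
  by move: posl posl'; rewrite /l /l' /=; case: (odd k).
have /andP[p0 q0] := coef k.+1 (ltnSn _).
suff /root_signN : pos (alpha j *m weyl u) by [].
rewrite -zE weyl_cat mulmxA dihedral_root // mulmxDl -!scalemxAl.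
by apply: posD; apply: posZ.
Qed.

Variable E : seq 'I_r -> seq 'I_r -> Prop.
Hypothesis E_refl : forall u, E u u.
Hypothesis E_trans : forall u v z, E u v -> E v z -> E u z.
Hypothesis E_cons : forall i u v, E u v -> E (i :: u) (i :: v).
(** The first alternative is a rank two subsystem of infinite type, for which there is no braid
    relation to apply. *)
Hypothesis E_braid : forall i j, i != j ->
  (forall k, coef_ge0 (dihedral_coef (- cartan j i) (- cartan i j) k)) \/
  exists2 m, dihedral_order (- cartan j i) (- cartan i j) m
    & forall z, E (alt i j m ++ z) (alt j i m ++ z).

(** By induction on the length. If the first letters i and j differ, both are descents, so the
    element has a reduced word [alt i j m ++ z]. Induction links it to the word starting with i, and
    its braid transform [alt j i m ++ z] to the word starting with j. *)
Lemma tits_reduced_words_connected u u' :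
  reduced_word u -> reduced_word u' -> weyl u = weyl u' -> E u u'.
Proof.
have [n] := ubnP (size u).
elim: n => // n IH in u u' * => + redu redu' uu'.
have sz : size u = size u' by apply/eqP; rewrite eqn_leq redu // redu'.
case: u u' => [|i u] [|j u'] // in redu redu' uu' sz *.
rewrite /= ltnS => un; have [un' [sz']] := (leq_trans (leqnSn _) un, sz).
have [ij|ij] := eqVneq i j.
  rewrite -ij in redu' uu' *; apply/E_cons/IH => //.
  - exact: (@reduced_catr [:: i]).
  - exact: (@reduced_catr [:: i]).
  exact: weyl_cons_inj uu'.
have neg k v : reduced_word (k :: v) -> pos (- (alpha k *m weyl (k :: v))).
  move=> /reduced_cons_pos.
  by rewrite weyl_cons mulmxA alpha_srefl_diag mulNmx opprK.
have negi := neg _ _ redu; have negj := neg _ _ redu'; rewrite -uu' in negj.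
case: (E_braid ij) => [inf|[m /and3P[m0 /allP ge0 /eqP mE] Em]].
  (* The prefix has one letter more than the word [i :: u]. *)
  have [z _] := peel_dihedral (k := (size u).+2)
    ij redu negi negj (fun l _ => inf l).
  by rewrite size_cat size_alt /=; lia.
have [] := peel_dihedral (k := m) ij redu negi negj.
  by move=> l lm; apply: ge0; rewrite mem_iota.
case: m m0 ge0 mE Em => // m _ ge0 mE Em z zE zsz.
have W : weyl (alt j i m.+1) = weyl (alt i j m.+1).
  rewrite [alt i j _]alt_rcons; apply: srefl_conj; rewrite dihedral_root // mE.
  by case: (odd m); rewrite /= ?scale0r ?scale1r ?add0r ?addr0.
have zE' : weyl (alt j i m.+1 ++ z) = weyl (j :: u').
  by rewrite weyl_cat W -weyl_cat zE.
have zsz' : size (alt j i m.+1 ++ z) = size (j :: u').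
  by rewrite -sz -zsz !size_cat !size_alt.
apply: (E_trans (v := alt i j m.+1 ++ z)); last apply: E_trans (Em z) _.
  apply/E_cons/IH => //.
  - exact: (@reduced_catr [:: i]).
  - by apply: (@reduced_catr [:: i]); apply: reduced_eq_size redu zE zsz.
  exact/esym/(weyl_cons_inj zE).
apply/E_cons/IH.
- by case: zsz' => ->; rewrite -sz'.
- by apply: (@reduced_catr [:: j]); apply: reduced_eq_size redu' zE' zsz'.
- exact: (@reduced_catr [:: j]).
exact: weyl_cons_inj zE'.
Qed.

End WeylGroup.

(** * The Chevalley generators *)

Section Monomials.
Variable I : finType.
Implicit Types (v : I -> algC) (e : I -> int).

Lemma lmonomD v (e e' : I -> int) : torus_point v ->
  lmonom v (fun i => e i + e' i) = lmonom v e * lmonom v e'.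
Proof.
move=> v0; rewrite /lmonom -big_split; apply: eq_bigr => i _ /=.
by rewrite expfzDr.
Qed.

Lemma lmonomN v e : lmonom v (fun i => - e i) = (lmonom v e)^-1.
Proof.
rewrite /lmonom -prodfV; apply: eq_bigr => i _.
by rewrite invr_expz.
Qed.

Lemma lmonomMl v v' e :
  lmonom (fun i => v i * v' i) e = lmonom v e * lmonom v' e.
Proof.
rewrite /lmonom -big_split; apply: eq_bigr => i _ /=.
by rewrite expfzMl.
Qed.

Lemma lmonom_neq0 v e : torus_point v -> lmonom v e != 0.
Proof. by move=> v0; apply/prodf_neq0 => i _; rewrite expfz_neq0. Qed.

Lemma lmonom0 v : lmonom v (fun=> 0) = 1.
Proof. by rewrite /lmonom big1 // => i _; rewrite expr0z. Qed.

Lemma lmonom_pow (a : algC) (c e : I -> int) : a != 0 ->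
  lmonom (fun i => a ^ c i) e = a ^ (\sum_i c i * e i).
Proof.
move=> a0; rewrite /lmonom; elim/big_rec2: _ => [|i x y _ ->].
  by rewrite expr0z.
by rewrite exprz_exp -expfzDr.
Qed.

Lemma lmonomZ v (c : int) e : lmonom v (fun i => c * e i) = lmonom v e ^ c.
Proof.
rewrite /lmonom (big_morph (fun x => x ^ c) (fun x y => expfzMl x y c)
  (exp1rz _ c)).
by apply: eq_bigr => i _; rewrite exprz_exp mulrC.
Qed.

Lemma eq_lmonom v e e' : e =1 e' -> lmonom v e = lmonom v e'.
Proof. by move=> ee'; apply: eq_bigr => i _; rewrite ee'. Qed.

End Monomials.

(** * Computations in SL_2 *)

Section SL2.
Implicit Types (a s t : algC).

Lemma ord2P (i : 'I_2) : i = 0 \/ i = 1.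
Proof. by case: i => -[|[|//]] ?; [left|right]; apply: val_inj. Qed.

Lemma big_ord2 (f : 'I_2 -> algC) : \sum_i f i = f 0 + f 1.
Proof.
rewrite big_ord_recl big_ord_recl big_ord0 addr0; congr (_ + f _).
exact: val_inj.
Qed.

Lemma prod_ord2 (f : 'I_2 -> algC) : \prod_i f i = f 0 * f 1.
Proof.
rewrite big_ord_recl big_ord_recl big_ord0 mulr1; congr (_ * f _).
exact: val_inj.
Qed.

Lemma mx2P (A B : 'M[algC]_2) : A 0 0 = B 0 0 -> A 0 1 = B 0 1 ->
  A 1 0 = B 1 0 -> A 1 1 = B 1 1 -> A = B.
Proof.
move=> h00 h01 h10 h11; apply/matrixP => i j.
by have [] := ord2P i => ->; have [] := ord2P j => ->.
Qed.

Lemma mulmx2E (A B : 'M[algC]_2) i j :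
  (A *m B) i j = A i 0 * B 0 j + A i 1 * B 1 j.
Proof.
by rewrite mxE big_ord2.
Qed.

Definition anti2 a : 'M[algC]_2 := upper2 a *m lower2 (- a^-1) *m upper2 a.

Ltac mx2 := apply: mx2P; rewrite ?mulmx2E !mxE /=
  ?(mulr0n, mulr1n, mulr0, mulr1, mul0r, mul1r, addr0, add0r).

Lemma upper2D s t : upper2 s *m upper2 t = upper2 (s + t).
Proof. by rewrite /upper2; mx2 => //; rewrite addrC. Qed.

Lemma lower2D s t : lower2 s *m lower2 t = lower2 (s + t).
Proof. by rewrite /lower2; mx2. Qed.

Lemma upper20 : upper2 0 = 1%:M. Proof. by rewrite /upper2 scale0r addr0. Qed.
Lemma lower20 : lower2 0 = 1%:M. Proof. by rewrite /lower2 scale0r addr0. Qed.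

Lemma anti2E a : a != 0 ->
  [/\ anti2 a 0 0 = 0, anti2 a 0 1 = a, anti2 a 1 0 = - a^-1 & anti2 a 1 1 = 0].
Proof.
move=> a0; rewrite /anti2 /upper2 /lower2 !mulmx2E !mxE /=.
by split; rewrite ?mulr0n ?mulr1n; field.
Qed.

Lemma diag2E a : [/\ diag2 a 0 0 = a, diag2 a 0 1 = 0, diag2 a 1 0 = 0
  & diag2 a 1 1 = a^-1].
Proof. by rewrite /diag2 !mxE /= !(mulr0n, mulr1n). Qed.

Lemma upper2E t : [/\ upper2 t 0 0 = 1, upper2 t 0 1 = t, upper2 t 1 0 = 0
  & upper2 t 1 1 = 1].
Proof. by rewrite /upper2 !mxE /= !(mulr0n, mulr1n); split; ring. Qed.

Lemma lower2E t : [/\ lower2 t 0 0 = 1, lower2 t 0 1 = 0, lower2 t 1 0 = t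
  & lower2 t 1 1 = 1].
Proof. by rewrite /lower2 !mxE /= !(mulr0n, mulr1n); split; ring. Qed.

Lemma diag2_anti2 a : a != 0 -> diag2 a *m anti2 1 = anti2 a.
Proof.
move=> a0; have [a1 a2 a3 a4] := anti2E (oner_neq0 _).
have [b1 b2 b3 b4] := anti2E a0; have [d1 d2 d3 d4] := diag2E a.
by apply: mx2P; rewrite mulmx2E !(d1, d2, d3, d4, a1, a2, a3, a4, b1, b2, b3,
  b4); field.
Qed.

Lemma anti2_diag2 a : a != 0 -> anti2 1 *m diag2 a^-1 = anti2 a.
Proof.
move=> a0; have [a1 a2 a3 a4] := anti2E (oner_neq0 _).
have [b1 b2 b3 b4] := anti2E a0; have [d1 d2 d3 d4] := diag2E a^-1.
by apply: mx2P; rewrite mulmx2E !(d1, d2, d3, d4, a1, a2, a3, a4, b1, b2, b3,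
  b4); field.
Qed.

(** The outer factors are polynomial in 1 / t and the middle one is a Weyl representative times a
    torus element: this drives [serre]. *)
Lemma upper2_bruhat t : t != 0 ->
  upper2 t = lower2 t^-1 *m anti2 t *m lower2 t^-1.
Proof.
move=> t0; have [b1 b2 b3 b4] := anti2E t0; have [l1 l2 l3 l4] := lower2E t^-1.
have [u1 u2 u3 u4] := upper2E t.
by apply: mx2P; rewrite mulmx2E !(mulmx2E (lower2 _))
  !(u1, u2, u3, u4, l1, l2, l3, l4, b1, b2, b3, b4); field.
Qed.

Lemma diag2_upper2 a t : a != 0 ->
  diag2 a *m upper2 t = upper2 (a ^+ 2 * t) *m diag2 a.
Proof.
move=> a0; have [d1 d2 d3 d4] := diag2E a.
have [u1 u2 u3 u4] := upper2E t; have [v1 v2 v3 v4] := upper2E (a ^+ 2 * t).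
by apply: mx2P; rewrite !mulmx2E !(d1, d2, d3, d4, u1, u2, u3, u4, v1, v2, v3,
  v4); field.
Qed.

Lemma SL2_lower t : SL2 (lower2 t).
Proof.
rewrite /SL2 det_trig; last first.
  apply/is_trig_mxP=> i j ij; have [_ l01 _ _] := lower2E t.
  by have [] := ord2P i => iE; have [] := ord2P j => jE;
    rewrite iE jE // in ij *.
by have [l00 _ _ l11] := lower2E t; rewrite prod_ord2 l00 l11 mulr1.
Qed.

Lemma SL2_upper t : SL2 (upper2 t).
Proof.
rewrite /SL2 -det_tr; have <- : lower2 t = (upper2 t)^T; last exact: SL2_lower.
by rewrite /upper2 /lower2 raddfD /= trmx1 linearZ /= trmx_delta.
Qed.

Lemma SL2_mul g h : SL2 g -> SL2 h -> SL2 (g *m h).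
Proof. by rewrite /SL2 det_mulmx => -> ->; rewrite mulr1. Qed.

Lemma SL2_anti a : SL2 (anti2 a).
Proof. exact: SL2_mul (SL2_mul (SL2_upper _) (SL2_lower _)) (SL2_upper _). Qed.

Lemma SL2_diag a : a != 0 -> SL2 (diag2 a).
Proof.
move=> a0; rewrite /SL2 det_diag prod_ord2 !mxE /=.
by rewrite divff.
Qed.

Lemma SL2_1 : SL2 1%:M. Proof. exact: det1. Qed.

Lemma curve_upper2 : curve upper2.
Proof.
exists (1%:M + 'X *: mxcst (delta_mx 0 1)) => s.
by rewrite mxevalD mxevalZ mxeval_cst hornerX /mxeval map_mx1.
Qed.

Lemma curve_lower2 : curve lower2.
Proof.
exists (1%:M + 'X *: mxcst (delta_mx 1 0)) => s.
by rewrite mxevalD mxevalZ mxeval_cst hornerX /mxeval map_mx1.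
Qed.

End SL2.

(** * Polynomials in t compared with polynomials in 1 / t *)

Section InversePolynomials.
Implicit Types (q h : {poly algC}).

(** Reversal with respect to [size h] instead of the degree, so that h = 0 is no special case. *)
Let rev_poly h := \poly_(k < (size h).+1) h`_(size h - k).

Let horner_rev h t : t != 0 -> (rev_poly h).[t] = t ^+ size h * h.[t^-1].
Proof.
move=> t0; rewrite horner_poly (horner_coef_wide _ (leqnSn _)) mulr_sumr.
rewrite (reindex_inj rev_ord_inj) /=; apply: eq_bigr => k _.
have kh : (k <= size h)%N by rewrite -ltnS.
rewrite subSS subKn // [RHS]mulrCA exprVn -[in t ^+ size h](subnK kh) exprD.
by rewrite -mulrA divff ?mulr1 // expf_neq0.
Qed.

Let poly_ext_neq0 q h : (forall t, t != 0 -> q.[t] = h.[t]) -> q = h.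
Proof.
move=> qh; have /eqP : 'X * (q - h) = 0.
  apply: poly_fun_inj => t; rewrite hornerM hornerX hornerD hornerN horner0.
  by have [->|/qh->] := eqVneq t 0; rewrite ?mul0r // subrr mulr0.
by rewrite mulf_eq0 polyX_eq0 subr_eq0 => /eqP.
Qed.

(** A polynomial in t that is also a polynomial in 1 / t is constant, and t^k q(t) has no constant
    term. *)
Lemma inverse_poly_eq0 q h k : (0 < k)%N ->
  (forall t, t != 0 -> t ^+ k * q.[t] = h.[t^-1]) -> q = 0.
Proof.
move=> k0 qh; apply/eqP/negPn/negP => q0.
have E : 'X^(k + size h) * q = rev_poly h.
  apply: poly_ext_neq0 => t t0; rewrite horner_rev // -qh // hornerM hornerXn
    exprD.
  by rewrite -mulrA mulrCA.
have sz := size_poly (size h).+1 (fun k => h`_(size h - k)).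
rewrite -/(rev_poly h) -E mulrC size_mulXn // in sz.
by move: q0 sz k0; rewrite -size_poly_gt0; lia.
Qed.

Lemma inverse_poly_top q h m :
    (forall t, t != 0 -> q.[t] = t ^+ m * h.[t^-1]) ->
  (size q <= m.+1)%N /\ q`_m = h`_0.
Proof.
move=> qh; have E : 'X^(size h) * q = 'X^m * rev_poly h.
  apply: poly_ext_neq0 => t t0; rewrite !(hornerM, hornerXn)
    horner_rev // qh //.
  by rewrite mulrCA.
split.
  have [->|q0] := eqVneq q 0; first by rewrite size_poly0.
  have : (size ('X^(size h) * q)%R <= m + (size h).+1)%N.
    rewrite E (leq_trans (size_polyMleq _ _)) // size_polyXn /= leq_add2l.
    exact: size_poly.
  by rewrite mulrC size_mulXn //; lia.
have := congr1 (fun p : {poly algC} => p`_(size h + m)) E.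
rewrite !coefXnM ltnNge leq_addr /= ltnNge leq_addl /= addKn addnK => ->.
by rewrite coef_poly ltnSn subnn.
Qed.

End InversePolynomials.

(** * Root vectors and representatives of the simple reflections *)

Section SplitSemisimple.
Variables (N : nat) (D : split_semisimple N).
Implicit Types (i j : 'I_(srank D)) (z : 'I_(sdim D) -> algC).
Implicit Types (lambda mu : 'rV[int]_(sdim D)) (X Y : 'M[algC]_N).

Definition ysub i t : 'M[algC]_N := sl2 i (lower2 t).

Lemma sG_group : is_group (sG D).
Proof. by have [[_ h] _ _] := sG_semisimple D. Qed.

Lemma sGM g h : sG D g -> sG D h -> sG D (g *m h).
Proof. by have [_ gM _ _] := sG_group; apply: gM. Qed.

Lemma sG1 : sG D 1%:M. Proof. by case: sG_group. Qed.

Lemma sG_unit g : sG D g -> g \in unitmx.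
Proof. by have [_ _ gU _] := sG_group; apply: gU. Qed.

Lemma stau_in z : torus_point z -> sG D (stau z).
Proof.
move=> z0; have [HG _] := sH_maximal D; apply: HG.
by have [_ _ h _ _] := sH_split D; apply/h; exists z.
Qed.

Lemma stau_unit z : torus_point z -> stau z \in unitmx.
Proof. by move=> /stau_in/sG_unit. Qed.

Lemma stauM z z' : torus_point z -> torus_point z' ->
  stau (s := D) (fun k => z k * z' k) = stau z *m stau z'.
Proof. by have [_ h _ _ _] := sH_split D; apply: h. Qed.

Lemma mulmx_inv_swap (A X Y : 'M[algC]_N) : A \in unitmx ->
  A *m X *m invmx A = Y -> A *m X = Y *m A.
Proof. by move=> uA <-; rewrite mulmxKV. Qed.

Lemma sl2_1 i : sl2 i 1%:M = 1%:M :> 'M[algC]_N.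
Proof.
have u := sG_unit (sl2_in i SL2_1).
have /(congr1 (mulmx (invmx (sl2 i 1%:M)))) := sl2_mul i SL2_1 SL2_1.
by rewrite mulmx1 mulVmx // mulKmx.
Qed.

Lemma xsubD i s t : xsub i (s + t) = xsub i s *m xsub i t.
Proof. by rewrite /xsub -upper2D sl2_mul //; apply: SL2_upper. Qed.

Lemma ysubD i s t : ysub i (s + t) = ysub i s *m ysub i t.
Proof. by rewrite /ysub -lower2D sl2_mul //; apply: SL2_lower. Qed.

Lemma xsub0 i : xsub i 0 = 1%:M :> 'M[algC]_N.
Proof. by rewrite /xsub upper20 sl2_1. Qed.

Lemma ysub0 i : ysub i 0 = 1%:M.
Proof. by rewrite /ysub lower20 sl2_1. Qed.

Lemma xsub_in i t : sG D (xsub i t). Proof. exact/sl2_in/SL2_upper. Qed.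
Lemma ysub_in i t : sG D (ysub i t). Proof. exact/sl2_in/SL2_lower. Qed.

Lemma one_param_xsub i : exists e, one_param (xsub i) e.
Proof.
have [P PE] : curve (xsub i).
  exact: (curve_morphism (sl2_morphism i) SL2_upper curve_upper2).
by exists (mxeval (mxderiv P) 0); apply: one_param_of_hom (@xsubD i) (xsub0 i).
Qed.

Lemma one_param_ysub i : exists f, one_param (ysub i) f.
Proof.
have [P PE] : curve (ysub i).
  exact: (curve_morphism (sl2_morphism i) SL2_lower curve_lower2).
by exists (mxeval (mxderiv P) 0); apply: one_param_of_hom (@ysubD i) (ysub0 i).
Qed.

Definition weight (lambda : 'rV[int]_(sdim D)) (X : 'M[algC]_N) :=
  forall z, torus_point z ->
    stau z *m X *m invmx (stau z) = lmonom z (lambda 0) *: X.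

(** Asking for a one-parameter subgroup of G, rather than for membership in [lie], makes stability
    under conjugation by G immediate. *)
Definition root_vector lambda (X : 'M[algC]_N) :=
  [/\ X != 0, weight lambda X
    & exists2 x, one_param x X & forall t, sG D (x t)].

Lemma root_vector_root lambda X : lambda != 0 -> root_vector lambda X ->
  is_root (stau (s := D)) (sG D) lambda.
Proof.
move=> l0 [X0 wX [x xX xG]]; split => //; exists X; split => //.
exact: lie_one_param xX xG.
Qed.

Lemma weight_one_param x X lambda : one_param x X ->
    (forall z t, torus_point z ->
      stau z *m x t *m invmx (stau z) = x (lmonom z (lambda 0) * t)) ->
  weight lambda X.
Proof.
move=> xX conj z z0; have u := stau_unit z0.
apply: one_param_gen (one_param_conj (mulmxV u) xX) _.
have [P eP xP] := one_paramZ (lmonom z (lambda 0)) xX.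
by exists P => // t; rewrite conj.
Qed.

Lemma weight_br lambda mu X Y : weight lambda X -> weight mu Y ->
  weight (lambda + mu) (br X Y).
Proof.
move=> wX wY z z0; have u := stau_unit z0.
have -> : lmonom z ((lambda + mu) 0) = lmonom z (lambda 0) * lmonom z (mu 0).
  by rewrite -lmonomD //; apply: eq_lmonom => k; rewrite mxE.
have E A B : stau z *m (A *m B) *m invmx (stau z)
    = (stau z *m A *m invmx (stau z)) *m (stau z *m B *m invmx (stau z)).
  by rewrite !mulmxA mulmxKV.
rewrite /br mulmxBr mulmxBl !E wX // wY //.
by rewrite -!scalemxAl -!scalemxAr !scalerA [_ (mu 0) * _]mulrC scalerBr.
Qed.

Definition weyl_rep i : 'M[algC]_N := sl2 i (anti2 1).

Lemma weyl_rep_in i : sG D (weyl_rep i). Proof. exact/sl2_in/SL2_anti. Qed.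

Lemma sl2_antiE i a : sl2 i (anti2 a)
  = xsub i a *m ysub i (- a^-1) *m xsub i a.
Proof.
by rewrite /anti2 !sl2_mul //; do ?[exact: SL2_upper|exact: SL2_lower|apply:
  SL2_mul].
Qed.

Lemma stau_coroot_weyl_rep i a : a != 0 ->
  stau (fun k => a ^ scoroot i 0 k) *m weyl_rep i = sl2 i (anti2 a).
Proof.
move=> a0; rewrite -sl2_diag // -sl2_mul ?diag2_anti2 //.
  exact: SL2_diag.
exact: SL2_anti.
Qed.

(** Conjugation by z multiplies the parameters in n_i = x_i(1) y_i(-1) x_i(1) by alpha_i(z) or its
    inverse, which gives the image of [anti2 (alpha_i z)]. Equivalently, n_i z n_i^-1 = s_i(z). *)
Lemma stau_weyl_rep i z : torus_point z ->
  stau z *m weyl_rep i = stau (fun k => lmonom z (sroot i 0) ^ scoroot i 0 k)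
    *m weyl_rep i *m stau z.
Proof.
move=> z0; have u := stau_unit z0.
have a0 := lmonom_neq0 (sroot i 0) z0; set a := lmonom z _ in a0 *.
have xE t := sl2_upper_root i t z0; have yE t := sl2_lower_root i t z0.
have aV : lmonom z ((- sroot i) 0) = a^-1.
  by rewrite /a -lmonomN; apply: eq_lmonom => k; rewrite mxE.
rewrite stau_coroot_weyl_rep //; apply: mulmx_inv_swap => //.
rewrite /weyl_rep !sl2_antiE invr1.
have E A B : stau z *m (A *m B) *m invmx (stau z)
    = (stau z *m A *m invmx (stau z)) *m (stau z *m B *m invmx (stau z)).
  by rewrite !mulmxA mulmxKV.
by rewrite !E xE yE aV -/a mulr1 mulrN1.
Qed.

(** Pointwise equality is enough because the entries of [stau] are Laurent polynomials. *)
Lemma eq_stau z z' : torus_point z -> z =1 z' -> stau (s := D) z = stau z'.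
Proof.
move=> z0 zz'; have z0' : torus_point z' by move=> k; rewrite -zz'.
apply/matrixP=> a b; have [_ _ _ h _] := sH_split D.
have [p [e pe]] := h a b; rewrite !pe // (eq_peval _ _ zz').
by congr (_ * _); apply: eq_bigr => k _; rewrite zz'.
Qed.

Lemma mulmx_conj_inv (A B C : 'M[algC]_N) :
    A \in unitmx -> B \in unitmx -> C \in unitmx ->
  A *m invmx B = invmx B *m C -> B *m invmx A = invmx C *m B.
Proof.
move=> uA uB uC E.
have CB : C *m B = B *m A by rewrite -[C](mulKVmx uB)
  -E -!mulmxA mulVmx ?mulmx1.
by rewrite -[invmx C *m B](mulmxK uA) -!mulmxA (mulmxA B)
  -CB !mulmxA mulVmx ?mul1mx.
Qed.

Lemma root_vector_srefl i lambda X : root_vector lambda X ->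
  root_vector (lambda *m refl i) (invmx (weyl_rep i) *m X *m weyl_rep i).
Proof.
move=> [X0 wX [x xX xG]]; set n := weyl_rep i.
have nU : n \in unitmx by apply/sG_unit/weyl_rep_in.
split.
- apply: contra_neq X0 => h; rewrite -(mulKVmx nU X)
  -(mulmxK nU (invmx n *m X)).
  by rewrite h mul0mx mulmx0.
- move=> z z0; have u := stau_unit z0.
  have a0 := lmonom_neq0 (sroot i 0) z0; set a := lmonom z _ in a0.
  (* [c] is alpha_i^vee(alpha_i(z)) and [y] is s_i(z). *)
  pose c k := a ^ scoroot i 0 k; pose y k := z k * (c k)^-1.
  have c0 : torus_point c by move=> k; rewrite expfz_neq0.
  have y0 : torus_point y by move=> k; rewrite mulf_neq0 ?invr_neq0.
  have uy := stau_unit y0.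
  have tE : stau z *m invmx n = invmx n *m stau y.
    have cy : stau z = stau c *m stau y.
      rewrite -stauM //; apply: eq_stau => // k.
      by rewrite /y mulrCA divff ?mulr1.
    have := stau_weyl_rep i z0; rewrite {1}cy -!mulmxA => /(congr1 (mulmx
      (invmx (stau c)))).
    rewrite !mulKmx ?stau_unit // => yn.
    by rewrite -[stau y](mulmxK nU) yn !mulmxA mulVmx // mul1mx.
  have tE' : n *m invmx (stau z) = invmx (stau y) *m n.
    exact: mulmx_conj_inv tE.
  rewrite !mulmxA tE -!mulmxA tE' !mulmxA.
  have -> : invmx n *m stau y *m X *m invmx (stau y) *m n
      = invmx n *m (stau y *m X *m invmx (stau y)) *m n by rewrite !mulmxA.
  rewrite wX // -scalemxAr -scalemxAl; congr (_ *: _).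
  have -> : lmonom y (lambda 0) = lmonom z (lambda 0)
    * lmonom (fun k => a ^ - scoroot i 0 k) (lambda 0).
    rewrite -lmonomMl; apply: eq_bigr => k _; congr (_ ^ _).
    by rewrite /y /c invr_expz.
  rewrite lmonom_pow // mul_srefl.
  have -> : lmonom z ((lambda - (lambda *m (scoroot i)^T) 0 0 *: sroot i) 0)
     = lmonom z (lambda 0) * lmonom z (fun k => - (lambda *m (scoroot i)^T)
       0 0 * sroot i 0 k).
    by rewrite -lmonomD //; apply: eq_lmonom => k; rewrite !mxE mulNr.
  congr (_ * _); rewrite lmonomZ mxE -sumrN; congr (_ ^ _).
  by apply: eq_bigr => k _; rewrite mxE mulNr mulrC.
exists (fun t => invmx n *m x t *m n);
  first exact: one_param_conj (mulVmx nU) xX.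
move=> t; apply: sGM; last exact: weyl_rep_in.
by apply: sGM => //; have [_ _ _ gV] := sG_group; apply/gV/weyl_rep_in.
Qed.

End SplitSemisimple.

(** * The curve exp (s ad e) X and its coefficients *)

Section AdjointString.
Variables (N : nat).
Implicit Types (P Q : 'M[{poly algC}]_N) (X Y : 'M[algC]_N).

Definition coefmx k Q : 'M[algC]_N := map_mx (coefp k) Q.

Lemma coefmxMl k X Q : coefmx k (mxcst X *m Q) = X *m coefmx k Q.
Proof.
apply/matrixP=> a b; rewrite !mxE /= coef_sum; apply: eq_bigr => c _.
by rewrite !mxE /= coefCM.
Qed.

Lemma coefmxMr k X Q : coefmx k (Q *m mxcst X) = coefmx k Q *m X.
Proof.
apply/matrixP=> a b; rewrite !mxE /= coef_sum; apply: eq_bigr => c _.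
by rewrite !mxE /= coefMC.
Qed.

Definition adjoint_curve P X := P *m mxcst X *m mxcomp P (- 'X).

Lemma adjoint_curveE x e P X s : one_param x e -> (forall t, x t = mxeval P t)
  ->
  mxeval (adjoint_curve P X) s *m x s = x s *m X.
Proof.
move=> xe xP; rewrite /adjoint_curve !mxevalE !hornerE -!xP -mulmxA.
by rewrite (mulmx1C (one_paramN s xe)) mulmx1.
Qed.

(** The curve Q satisfies Q' = [e, Q]; compare the coefficients of degree k. *)
Lemma adjoint_coef P e X k : exp_curve P e ->
  coefmx k (adjoint_curve P X) *+ k`! = iter k (br e) X.
Proof.
move=> eP; have [P0 dP] := eP; set Q := adjoint_curve P X.
have dPl : mxderiv P = mxcst e *m P by rewrite dP (exp_curve_comm eP).
have dQ : mxderiv Q = mxcst e *m Q - Q *m mxcst e.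
  rewrite /Q /adjoint_curve !mxderivM mxderiv_cst mulmx0 addr0 mxderiv_comp.
  have E : mxcomp (P *m mxcst e) (- 'X) = mxcomp P (- 'X) *m mxcst e.
    by apply: mxeval_inj => s; rewrite !mxevalE.
  by rewrite {1}dPl derivN derivX scaleN1r dP E mulmxN !mulmxA.
elim: k => [|k IH].
  suff <- : mxeval Q 0 = X.
    by rewrite fact0 mulr1n; apply/matrixP=> a b; rewrite !mxE /= -horner_coef0.
  by rewrite /Q !mxevalE hornerN hornerX oppr0 P0 mul1mx mulmx1.
rewrite iterS -IH factS mulrnA.
rewrite -!(scaler_nat k`!) brZr; congr (_ *: _).
rewrite /br -coefmxMl -coefmxMr.
apply/matrixP=> a b; have /matrixP/(_ a b) := dQ.
rewrite mxE => /(congr1 (fun q : {poly algC} => q`_k)).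
by rewrite coef_deriv mulmxnE !mxE /= coefB => ->.
Qed.

End AdjointString.

(** * Serre relations and signs of real roots *)

Section Serre.
Variables (N : nat) (D : split_semisimple N).
Implicit Types (i j : 'I_(srank D)) (z : 'I_(sdim D) -> algC).

Local Notation W := (weyl (@sroot N D) (@scoroot N D)).
Local Notation pos := (nonneg_comb (@sroot N D)).

Lemma sroot_free (c : 'I_(srank D) -> int) :
  \sum_i sroot i *~ c i = 0 -> forall i, c i = 0.
Proof. by have [_ h _ _] := sroot_simple D; apply: h. Qed.

Lemma root_sign_of lambda : is_root (stau (s := D)) (sG D) lambda ->
  pos lambda \/ pos (- lambda).
Proof. by have [_ _ h _] := sroot_simple D; apply: h. Qed.

Variables e f : 'I_(srank D) -> 'M[algC]_N.
Hypothesis eP : forall i, one_param (xsub i) (e i).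
Hypothesis fP : forall i, one_param (@ysub N D i) (f i).

Lemma simple_gen_neq0 i : e i != 0.
Proof.
apply/eqP=> e0; have := eP i; rewrite e0 => h.
have [+ _] := sl2_neq1 i; apply; rewrite -/(xsub i 1).
apply: (one_param_unique (y := fun=> 1%:M) h).
exists (mxcst 1%:M) => [|s]; last by rewrite mxeval_cst.
by split; rewrite ?mxeval_cst // mxderiv_cst -mxcstM mulmx0 /mxcst map_mx0.
Qed.

Lemma weight_e i : weight (sroot i) (e i).
Proof.
apply: weight_one_param (eP i) _ => z t z0.
by rewrite /xsub sl2_upper_root.
Qed.

Lemma weight_f i : weight (- sroot i) (f i).
Proof.
apply: weight_one_param (fP i) _ => z t z0.
by rewrite /ysub sl2_lower_root.
Qed.

Lemma root_vector_e i : root_vector (sroot i) (e i).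
Proof.
split; [exact: simple_gen_neq0|exact: weight_e|].
by exists (xsub i); [exact: eP|exact: xsub_in].
Qed.

(** Conjugation by alpha_i^vee(2) multiplies e_i by 2 to the power <alpha_i, alpha_i^vee> according
    to its weight, and by 4 according to SL_2. *)
Lemma cartan_diag2 i : cartan (@sroot N D) (@scoroot N D) i i = 2.
Proof.
set c := cartan _ _ i i; pose z := fun k => (2 : algC) ^ (scoroot i 0 k : int).
have n2 : (2 : algC) != 0 by rewrite pnatr_eq0.
have z0 : torus_point z by move=> k; rewrite expfz_neq0.
have zE : lmonom z (sroot i 0) = 2 ^ c.
  rewrite lmonom_pow // /c /cartan mxE; congr (_ ^ _).
  by apply: eq_bigr => k _; rewrite !mxE mulrC.
have wE := weight_e i z0; rewrite zE in wE.
have dE t : stau z *m xsub i t *m invmx (stau z) = xsub i (4 * t).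
  rewrite -sl2_diag // /xsub -sl2_mul ?diag2_upper2 //; last exact: SL2_upper.
    rewrite sl2_mul; last exact: SL2_diag; last exact: SL2_upper.
    rewrite mulmxK; last by apply/sG_unit/sl2_in/SL2_diag.
    by rewrite -natrX.
  exact: SL2_diag.
have : stau z *m e i *m invmx (stau z) = 4 *: e i.
  apply: one_param_gen (one_param_conj (mulmxV (stau_unit z0)) (eP i)) _.
  by have [P PE xP] := one_paramZ 4 (eP i); exists P => // t; rewrite dE.
rewrite wE => /eqP; rewrite -subr_eq0 -scalerBl scaler_eq0 (negbTE
  (simple_gen_neq0 i)).
rewrite orbF subr_eq0 => /eqP E; apply/eqP.
have n1 : (2 : algC) != 1 by rewrite -subr_eq0 -[2]natr1 addrK oner_eq0.
have : (2 : algC) ^ (c - 2) == 1.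
  by rewrite expfzDr // E -invr_expz -[2 ^ 2]natrX divff // pnatr_eq0.
by rewrite pexprz_eq1 ?ler0n // (negbTE n1) orbF subr_eq0.
Qed.

(** Otherwise alpha_j - alpha_i would be a root with coefficients of opposite signs. *)
Lemma br_f_e i j : i != j -> br (f i) (e j) = 0.
Proof.
move=> ij; have [//|X0] := eqVneq (br (f i) (e j)) 0; exfalso.
pose lambda := - sroot i + sroot j.
have lE (c : 'I_(srank D) -> nat) (s : int) : s != 0 ->
    lambda *~ s = \sum_k sroot k *+ c k ->
    (c i)%:Z = - s /\ (c j)%:Z = s.
  move=> s0; rewrite /lambda mulrzDl mulNrz -mulrNz !(alpha_sum (@sroot N D)).
  rewrite -big_split /= => E.
  have {}E : \sum_k sroot k *~ ((if k == i then - s else 0)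
    + (if k == j then s else 0))
      = \sum_k sroot k *~ (c k)%:Z.
    by rewrite -[RHS]E; apply: eq_bigr => k _; rewrite mulrzDr.
  have := alpha_free_eq sroot_free E i; have := alpha_free_eq sroot_free E j.
  by rewrite /= !eqxx eq_sym (negbTE ij) add0r addr0.
have l0 : lambda != 0.
  apply/eqP=> l0; have := lE (fun=> 0%N) 1 isT.
  by rewrite l0 mul0rz big1 => [/(_ erefl)[]|k _]; rewrite ?mulr0n.
have : is_root (stau (s := D)) (sG D) lambda.
  split=> //; exists (br (f i) (e j)); split=> //; last first.
    exact: weight_br (weight_f i) (weight_e j).
  have [P eP' yP] := fP i; have [P0 dP] := eP'.
  have -> : br (f i) (e j) = mxeval (mxderiv (adjoint_curve P (e j))) 0.
    rewrite !mxderivM mxderiv_cst mulmx0 addr0 mxderiv_comp derivN derivX dP.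
    by rewrite !mxevalE !hornerE oppr0 P0 scaleN1r !mul1mx mulmx1 mulmxN.
  (* The bracket is the derivative at 0 of the conjugates of e_j by y_i(s), which are tangent to
     G. *)
  apply: lie_mxderiv => s.
  have -> : mxeval (adjoint_curve P (e j)) s = ysub i s *m e j *m ysub i (- s).
    by rewrite /adjoint_curve !mxevalE !hornerE -!yP.
  apply: lie_one_param (one_param_conj (one_paramN s (fP i)) (eP j)) _ => t.
  by apply: sGM; [apply: sGM; [exact: ysub_in|exact: xsub_in]|exact: ysub_in].
move=> /root_sign_of[] [c cE].
  by have := lE c 1 isT; rewrite mulr1z => /(_ cE)[].
by have := lE c (-1) isT; rewrite mulrN1z => /(_ cE)[].
Qed.

Lemma root_vector_weyl j u : exists X, root_vector (sroot j *m W u) X.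
Proof.
elim/last_ind: u => [|u i [X XP]].
  by exists (e j); rewrite weyl_nil mulmx1; apply: root_vector_e.
exists (invmx (weyl_rep i) *m X *m weyl_rep i).
by rewrite weyl_rcons mulmxA; apply: root_vector_srefl.
Qed.

Lemma weyl_root_sign j u : pos (sroot j *m W u) \/ pos (- (sroot j *m W u)).
Proof.
have [X XP] := root_vector_weyl j u; apply/root_sign_of/(root_vector_root _ XP).
exact: root_neq0 sroot_free cartan_diag2 _ _.
Qed.

(* Conjugating e j by the decomposition of x_i(t) in the big cell of SL_2
   turns a polynomial in t into t ^ m times a polynomial in 1 / t. *)
Lemma serre i j : i != j -> exists m : nat,
  [/\ cartan (@sroot N D) (@scoroot N D) j i = - m%:Z,
      iter m.+1 (br (e i)) (e j) = 0 & iter m (br (e i)) (e j) != 0].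
Proof.
move=> ij; set a := cartan _ _ j i.
have [P ePi xP] := eP i; have [R fPi yR] := fP i.
pose n := weyl_rep i; have nU : n \in unitmx by apply/sG_unit/weyl_rep_in.
pose X' := n *m e j *m invmx n.
pose Q := adjoint_curve P (e j); pose S := adjoint_curve R X'.
have X'0 : X' != 0.
  apply: contra_neq (simple_gen_neq0 j) => h.
  by rewrite -(mulKmx nU (e j)) -(mulmxKV nU (n *m e j)) -/X' h mul0mx mulmx0.
have Q0 : mxeval Q 0 = e j.
  by rewrite !mxevalE hornerN hornerX oppr0 -!xP xsub0 mul1mx mulmx1.
have yC s : ysub i s *m e j = e j *m ysub i s.
  by rewrite (one_param_comm _ (fP i)) //; apply/br0_comm/br_f_e.
(* [Q] is the conjugate of e_j by x_i(t). In the factorisation of x_i(t), the right-hand y_i(1 / t)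
   commutes with e_j, the torus element scales it, n turns it into [X'], and the left-hand y_i(1 /
   t) yields [S]. *)
have QS t : t != 0 -> mxeval Q t = (t^-1) ^ a *: mxeval S t^-1.
  move=> t0; have tV0 : t^-1 != 0 by rewrite invr_eq0.
  have xtU : xsub i t \in unitmx by apply/sG_unit/xsub_in.
  apply: (can_inj (mulmxK xtU)); rewrite (adjoint_curveE _ _ (eP i) xP).
  pose z k := t^-1 ^ (scoroot i 0 k : int).
  have z0 : torus_point z by move=> k; rewrite expfz_neq0.
  have xE : xsub i t = ysub i t^-1 *m (n *m stau z) *m ysub i t^-1.
    have sd := SL2_diag tV0; have sad := SL2_mul (SL2_anti 1) sd.
    rewrite /xsub (upper2_bruhat t0) -(anti2_diag2 t0).
    rewrite (sl2_mul i (SL2_mul (SL2_lower _) sad) (SL2_lower _)).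
    rewrite (sl2_mul i (SL2_lower _) sad) (sl2_mul i (SL2_anti 1) sd).
    by rewrite (sl2_diag i tV0).
  have zE : stau z *m e j = t^-1 ^ a *: (e j *m stau z).
    rewrite -[stau z *m e j](mulmxKV (stau_unit z0)) weight_e // lmonom_pow //.
    rewrite -scalemxAl; congr (_ ^ _ *: _); rewrite /a /cartan mxE.
    by apply: eq_bigr => k _; rewrite !mxE mulrC.
  rewrite xE -!mulmxA yC (mulmxA (stau z)) zE -!scalemxAl -!scalemxAr.
  congr (_ *: _); rewrite !mulmxA (adjoint_curveE _ _ (fP i) yR) /X' !mulmxA.
  by rewrite mulmxKV.
(* [Q] then has degree at most m with coefficient S(0) = X' in degree m, and X' is non-zero; up to
   factorials these coefficients are the powers of ad e_i applied to e_j. *)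
have top m : (forall t, t != 0 -> mxeval Q t = t ^+ m *: mxeval S t^-1) ->
    iter m.+1 (br (e i)) (e j) = 0 /\ iter m (br (e i)) (e j) != 0.
  move=> E; have h b c : (size (Q b c) <= m.+1)%N /\ (Q b c)`_m = (S b c)`_0.
    apply: inverse_poly_top => t t0.
    by rewrite -!mxeval_entry E // [LHS]mxE.
  rewrite -!(adjoint_coef _ _ ePi); split.
    suff -> : coefmx m.+1 Q = 0 by rewrite mul0rn.
    apply/matrixP=> b c; rewrite [LHS]mxE [RHS]mxE /=.
    by have [sz _] := h b c; apply: nth_default.
  have -> : coefmx m Q = X'.
    suff <- : mxeval S 0 = X'.
      apply/matrixP=> b c; rewrite mxeval_entry horner_coef0 [LHS]mxE.
      exact: (proj2 (h b c)).
    by rewrite !mxevalE hornerN hornerX oppr0 -!yR ysub0 mul1mx mulmx1.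
  by rewrite -scaler_nat scaler_eq0 negb_or pnatr_eq0 -lt0n fact_gt0.
case aE: a QS => [[|k]|k] QS.
- exists 0%N; have [] := top 0%N; last by rewrite oppr0.
  by move=> t t0; rewrite QS // expr0z expr0.
(* A positive Cartan integer would make a positive power of t times [Q] polynomial in 1 / t, forcing
   e_j = 0. *)
- exfalso; have /eqP[] := simple_gen_neq0 j; rewrite -Q0.
  suff -> : Q = 0 by rewrite /mxeval map_mx0.
  apply/matrixP=> b c; rewrite [RHS]mxE.
  apply: (@inverse_poly_eq0 _ (S b c) k.+1) => // t t0.
  rewrite -!mxeval_entry QS // [X in _ * X]mxE.
  by rewrite mulrA -exprMn divff // expr1n mul1r.
exists k.+1; have [] := top k.+1; last by rewrite NegzE.
by move=> t t0; rewrite QS // NegzE -exprz_inv invrK.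
Qed.

End Serre.

(** * Subtraction-free functions *)

Section ReversedBraids.
Variables (F : numFieldType) (N : nat).
Variables (xe xf : F -> 'M[F]_N) (e f : 'M[F]_N).
Hypotheses (xeP : one_param xe e) (xfP : one_param xf f).

Lemma mulmx_eq_rinv (A B C : 'M[F]_N) :
  A *m C = 1%:M -> B *m C = 1%:M -> A = B.
Proof.
by move=> hA hB; rewrite -[A]mulmx1 -(mulmx1C hB) mulmxA hA mul1mx.
Qed.

Let oppP (x : F -> 'M[F]_N) X : one_param x X -> one_param (fun t : F => x (-
  t)) (- X).
Proof.
move=> /(one_paramZ (-1)) [P]; rewrite scaleN1r => PX xP.
by exists P => // s; rewrite -xP mulN1r.
Qed.

Let xeK s (A : 'M[F]_N) : A *m xe s *m xe (- s) = A.
Proof. by rewrite -mulmxA (one_paramN _ xeP) mulmx1. Qed.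
Let xfK s (A : 'M[F]_N) : A *m xf s *m xf (- s) = A.
Proof. by rewrite -mulmxA (one_paramN _ xfP) mulmx1. Qed.

Let brNl (A B : 'M[F]_N) : br (- A) B = - br A B.
Proof. by rewrite -!scaleN1r brZl. Qed.

Let one_xe s : xe s = 1%:M *m xe s. Proof. by rewrite mul1mx. Qed.
Let one_xf s : xf s = 1%:M *m xf s. Proof. by rewrite mul1mx. Qed.

(* These follow from braid_b2 and braid_g2, applied to the inverse one-parameter
   subgroups, by taking inverses. *)
Lemma braid_b2_rev : br e (br e (br e f)) = 0 -> br f (br f e) = 0 ->
    forall t1 t2 t3 t4, 0 < t1 -> 0 < t2 -> 0 < t3 -> 0 < t4 ->
  let m1 := t4 * t3 + (t4 + t2) * t1 in
  let m2 := t4 ^+ 2 * t3 + (t4 + t2) ^+ 2 * t1 in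
  xf t1 *m xe t2 *m xf t3 *m xe t4
  = xe (t4 * t3 * t2 / m1) *m xf (m1 ^+ 2 / m2) *m xe (m2 / m1)
    *m xf (t3 * t2 ^+ 2 * t1 / m2).
Proof.
move=> eeef ffe t1 t2 t3 t4 h1 h2 h3 h4 m1 m2.
have := braid_b2 (oppP xeP) (oppP xfP) _ _ h4 h3 h2 h1.
rewrite -/m1 -/m2 !(brNl, brNr) eeef ffe !oppr0 => /(_ erefl erefl) E.
apply: (mulmx_eq_rinv (C := xe (- t4) *m xf (- t3) *m xe (- t2) *m xf (- t1))).
  by rewrite !mulmxA xeK xfK xeK [X in X *m _]one_xf xfK.
by rewrite E !mulmxA xfK xeK xfK [X in X *m _]one_xe xeK.
Qed.

Lemma braid_g2_rev : br e (br e (br e (br e f))) = 0 -> br f (br f e) = 0 ->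
    forall t1 t2 t3 t4 t5 t6,
    0 < t1 -> 0 < t2 -> 0 < t3 -> 0 < t4 -> 0 < t5 -> 0 < t6 ->
  let pi1 := g2pi1 t6 t5 t4 t3 t2 t1 in
  let pi2 := g2pi2 t6 t5 t4 t3 t2 t1 in
  let pi3 := g2pi3 t6 t5 t4 t3 t2 t1 in
  let pi4 := g2pi4 t6 t5 t4 t3 t2 t1 in
  xf t1 *m xe t2 *m xf t3 *m xe t4 *m xf t5 *m xe t6
  = xe (g2nu t6 t5 t4 t3 t2 / pi1) *m xf (pi1 ^+ 3 / pi4)
    *m xe (pi4 / (pi1 * pi2)) *m xf (pi2 ^+ 3 / (pi3 * pi4))
    *m xe (pi3 / pi2) *m xf (g2mu t5 t4 t3 t2 t1 / pi3).
Proof.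
move=> e4f ffe t1 t2 t3 t4 t5 t6 h1 h2 h3 h4 h5 h6 pi1 pi2 pi3 pi4.
have := braid_g2 (oppP xeP) (oppP xfP) _ _ h6 h5 h4 h3 h2 h1.
rewrite -/pi1 -/pi2 -/pi3 -/pi4 !(brNl, brNr) e4f ffe !oppr0.
move=> /(_ erefl erefl) E.
apply: (mulmx_eq_rinv (C := xe (- t6) *m xf (- t5) *m xe (- t4) *m xf (- t3)
   *m xe (- t2) *m xf (- t1))).
  by rewrite !mulmxA xeK xfK xeK xfK xeK [X in X *m _]one_xf xfK.
by rewrite E !mulmxA xfK xeK xfK xeK xfK [X in X *m _]one_xe xeK.
Qed.

End ReversedBraids.

Section SubtractionFree.
Variable J : finType.
Implicit Types (p q : {mpoly rat[#|J|]}) (v : J -> algC).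
Implicit Types (f g : (J -> algC) -> algC).

Definition pos_point v := forall i, 0 < v i.

Lemma pos_torus v : pos_point v -> torus_point v.
Proof. by move=> v0 i; rewrite gt_eqF. Qed.

Definition nonneg_poly p := p != 0 /\ forall m, 0 <= p@_m.

Lemma peval_gt0 p v : nonneg_poly p -> pos_point v -> 0 < peval (@ratr algC)
  p v.
Proof.
move=> [p0 pge0] v0; rewrite /peval /mmap.
have : msupp p != [::] by rewrite msupp_eq0.
have : all (fun m => 0 < ratr p@_m * mmap1 (fun k => v (enum_val k)) m)
  (msupp p).
  apply/allP=> m; rewrite mcoeff_msupp => pm; apply: mulr_gt0.
    by rewrite ltr0q lt0r pm pge0.
  by apply: prodr_gt0 => i _; apply/exprn_gt0/v0.
case: (msupp p) => // m s /= /andP[m0 s0] _; rewrite big_cons.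
apply: ltr_wpDr m0; rewrite big_seq; apply: sumr_ge0 => m' ms.
exact/ltW/(allP s0).
Qed.

Lemma nonneg_polyC c : 0 < c -> nonneg_poly c%:MP.
Proof.
move=> c0; split; first by rewrite mpolyC_eq0 gt_eqF.
by move=> m; rewrite mcoeffC; case: eqP => _; rewrite ?mulr1 ?mulr0 // ltW.
Qed.

Lemma nonneg_polyX i : nonneg_poly 'X_i.
Proof.
split; last by move=> m; rewrite mcoeffX; case: eqP.
apply/eqP=> /(congr1 (fun p => p@_U_(i))).
by rewrite mcoeffX eqxx mcoeff0.
Qed.

Lemma nonneg_polyD p q : nonneg_poly p -> nonneg_poly q -> nonneg_poly (p + q).
Proof.
move=> [p0 pge0] [q0 qge0]; split; last by move=> m; rewrite mcoeffD addr_ge0.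
apply: contra_neq p0 => pq0; apply/mpolyP=> m; rewrite mcoeff0.
have /eqP := congr1 (mcoeff m) pq0.
by rewrite mcoeff0 mcoeffD paddr_eq0 // => /andP[/eqP].
Qed.

Lemma nonneg_polyM p q : nonneg_poly p -> nonneg_poly q -> nonneg_poly (p * q).
Proof.
move=> [p0 pge0] [q0 qge0]; split; first by rewrite mulf_neq0.
move=> m; rewrite mcoeffM; apply: sumr_ge0 => k _.
by rewrite mulr_ge0.
Qed.

Lemma pevalD p q v : peval (@ratr algC) (p + q) v
  = peval (@ratr algC) p v + peval (@ratr algC) q v.
Proof. exact: mmapD. Qed.

Lemma pevalC c v : peval (@ratr algC) c%:MP v = ratr c.
Proof. exact: mmapC. Qed.

Lemma peval1 v : peval (@ratr algC) 1%:MP v = 1.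
Proof. by rewrite pevalC; apply: rmorph1. Qed.

Lemma pevalM p q v : peval (@ratr algC) (p * q) v
  = peval (@ratr algC) p v * peval (@ratr algC) q v.
Proof. exact: rmorphM. Qed.

Definition subfree f := exists p q, [/\ nonneg_poly p, nonneg_poly q
  & forall v, pos_point v -> f v = peval (@ratr algC) p v / peval (@ratr algC)
    q v].

Lemma subfree_gt0 f v : subfree f -> pos_point v -> 0 < f v.
Proof.
by move=> [p [q [pP qP fE]]] v0; rewrite fE // divr_gt0 // peval_gt0.
Qed.

Lemma eq_subfree f g :
  (forall v, pos_point v -> f v = g v) -> subfree f -> subfree g.
Proof.
move=> fg [p [q [pP qP fE]]]; exists p, q; split=> // v v0.
by rewrite -fg // fE.
Qed.

Lemma subfreeD f g : subfree f -> subfree g -> subfree (fun v => f v + g v).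
Proof.
move=> [p [q [pP qP fE]]] [p' [q' [pP' qP' gE]]].
exists (p * q' + p' * q), (q * q'); split.
- exact: nonneg_polyD (nonneg_polyM _ _) (nonneg_polyM _ _).
- exact: nonneg_polyM.
move=> v v0; rewrite fE // gE // !(pevalD, pevalM) addf_div //.
  by rewrite gt_eqF // peval_gt0.
by rewrite gt_eqF // peval_gt0.
Qed.

Lemma subfreeM f g : subfree f -> subfree g -> subfree (fun v => f v * g v).
Proof.
move=> [p [q [pP qP fE]]] [p' [q' [pP' qP' gE]]].
exists (p * p'), (q * q'); split; do ?exact: nonneg_polyM.
by move=> v v0; rewrite fE // gE // !pevalM mulf_div.
Qed.

Lemma subfreeV f : subfree f -> subfree (fun v => (f v)^-1).
Proof.
move=> [p [q [pP qP fE]]]; exists q, p; split=> // v v0.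
by rewrite fE // invf_div.
Qed.

Lemma subfree_div f g : subfree f -> subfree g -> subfree (fun v => f v / g v).
Proof. by move=> fP gP; apply: subfreeM fP (subfreeV gP). Qed.

Lemma subfree_ratr c : 0 < c -> subfree (fun=> ratr c).
Proof.
move=> c0; exists c%:MP, 1%:MP.
split; do ?exact: nonneg_polyC; move=> v _.
by rewrite pevalC peval1 divr1.
Qed.

Lemma subfree_natr n : subfree (fun=> n.+1%:R).
Proof.
by apply: eq_subfree (subfree_ratr (_ : 0 < n.+1%:R)) => // v _;
  rewrite ratr_nat.
Qed.

Lemma subfree1 : subfree (fun=> 1). Proof. exact: (subfree_natr 0). Qed.

Lemma subfreeX f n : subfree f -> subfree (fun v => f v ^+ n).
Proof.
move=> fP; elim: n => [|n IH]; first exact: subfree1.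
by apply: eq_subfree (subfreeM fP IH) => v _; rewrite exprS.
Qed.

Lemma subfreeXz f (n : int) : subfree f -> subfree (fun v => f v ^ n).
Proof.
case: n => n fP; first exact: subfreeX.
exact: subfreeV (subfreeX _ fP).
Qed.

Lemma subfree_coord i : subfree (fun v => v i).
Proof.
exists 'X_(enum_rank i), 1%:MP; split; first exact: nonneg_polyX.
  exact: nonneg_polyC.
by move=> v _; rewrite peval1 divr1 /peval mmapX mmap1U enum_rankK.
Qed.

Lemma subfree_prod (I : Type) (s : seq I) (F : I -> (J -> algC) -> algC) :
  (forall i, subfree (F i)) -> subfree (fun v => \prod_(i <- s) F i v).
Proof.
move=> FP; elim: s => [|i s IH].
  by apply: eq_subfree subfree1 => v _; rewrite big_nil.
by apply: eq_subfree (subfreeM (FP i) IH) => v _; rewrite big_cons.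
Qed.

Lemma subfree_lmonom (I : finType) (F : I -> (J -> algC) -> algC)
  (e : I -> int) :
  (forall i, subfree (F i)) -> subfree (fun v => lmonom (F^~ v) e).
Proof. by move=> FP; apply: subfree_prod => i; apply: subfreeXz. Qed.

Lemma subfree_nonneg_laurent (I : finType) (F : I -> (J -> algC) -> algC) a :
    (forall i, subfree (F i)) -> nonneg_laurent a ->
  subfree (fun v => a (F^~ v)).
Proof.
move=> FP [p [e [p0 pge0 aE]]].
suff pP : subfree (fun v => peval (@ratr algC) p (F^~ v)).
  apply: eq_subfree (subfreeM pP (subfree_lmonom e FP)) => v v0.
  by rewrite aE // => i; rewrite gt_eqF // (subfree_gt0 (FP i)).
pose mono m v := ratr p@_m * mmap1 (fun k => F (enum_val k) v) m.
have monoP m : m \in msupp p -> subfree (mono m).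
  rewrite mcoeff_msupp => pm; apply: subfreeM.
    by apply: subfree_ratr; rewrite lt0r pm pge0.
  by apply: subfree_prod => i; apply: subfreeX.
have : msupp p != [::] by rewrite msupp_eq0.
(* The induction starts from one term: the empty sum 0 is not subtraction-free. *)
suff h (s : seq 'X_{1.. #|I|}) : {subset s <= msupp p} -> s != [::] ->
    subfree (fun v => \sum_(m <- s) mono m v) by move=> /h; apply.
elim: s => // m s IH sp _; have mp := monoP _ (sp m (mem_head _ _)).
case: s => [|m' s] in IH sp *.
  by apply: eq_subfree mp => v _; rewrite big_seq1.
apply: eq_subfree (subfreeD mp (IH _ _)) => [v _||//];
  first by rewrite [RHS]big_cons.
by move=> k ks; apply: sp; rewrite inE ks orbT.
Qed.

End SubtractionFree.

(** * Products along a reduced word *)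

Ltac solve_subfree :=
  lazymatch goal with
  | |- subfree (fun v => _ + _) => apply: subfreeD; solve_subfree
  | |- subfree (fun v => _ / _) => apply: subfree_div; solve_subfree
  | |- subfree (fun v => _ * _) => apply: subfreeM; solve_subfree
  | |- subfree (fun v => _ ^+ _) => apply: subfreeX; solve_subfree
  | |- subfree (fun v => _%:R) => apply: subfree_natr
  | |- _ => exact: svalP
  end.

Section WordProducts.
Variables (N : nat) (D : split_semisimple N) (J : finType).
Variables e f : 'I_(srank D) -> 'M[algC]_N.
Hypothesis eP : forall i, one_param (xsub i) (e i).
Hypothesis fP : forall i, one_param (@ysub N D i) (f i).
Implicit Types (i j : 'I_(srank D)) (u : seq 'I_(srank D)).

Definition subfree_fun := {F : (J -> algC) -> algC | subfree F}.
Implicit Types L : seq ('I_(srank D) * subfree_fun).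

Definition word_prod L (v : J -> algC) : 'M[algC]_N :=
  \big[mulmx/1%:M]_(p <- L) xsub p.1 (sval p.2 v).

Lemma word_prod_cons p L v :
  word_prod (p :: L) v = xsub p.1 (sval p.2 v) *m word_prod L v.
Proof. by rewrite /word_prod big_cons. Qed.

Lemma word_prod_nil v : word_prod [::] v = 1%:M.
Proof. by rewrite /word_prod big_nil. Qed.

Lemma word_prod_cat L L' v : word_prod (L ++ L')
  v = word_prod L v *m word_prod L' v.
Proof.
elim: L => [|p L IH]; first by rewrite word_prod_nil mul1mx.
by rewrite cat_cons !word_prod_cons IH mulmxA.
Qed.

(** The parameters on both sides are functions of the same point v, so composing changes of
    parameters takes no substitution. *)
Definition transition u u' := forall L, map fst L = u ->
  exists2 L', map fst L' = u' &
    forall v, pos_point v -> word_prod L v = word_prod L' v.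

Lemma transition_refl u : transition u u. Proof. by move=> L Lu; exists L. Qed.

Lemma transition_trans u v z : transition u v -> transition v z -> transition u
  z.
Proof.
move=> uv vz L /uv[L' /vz[L'' L''z E'] E]; exists L'' => // t t0.
by rewrite E // E'.
Qed.

Lemma transition_cons i u v : transition u v -> transition (i :: u) (i :: v).
Proof.
move=> uv [//|[k F] L] [-> Lu]; have [L' L'v E] := uv L Lu.
exists ((i, F) :: L'); first by rewrite /= L'v.
by move=> t t0; rewrite !word_prod_cons E.
Qed.

Lemma transition_catr u v z : transition u v -> transition (u ++ z) (v ++ z).
Proof.
move=> uv L Luz; have Lu : map fst (take (size u) L) = u.
  by rewrite map_take Luz take_size_cat.
have Lz : map fst (drop (size u) L) = z by rewrite map_drop Luz drop_size_cat.
have [L' L'v E] := uv _ Lu; exists (L' ++ drop (size u) L).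
  by rewrite map_cat L'v Lz.
by move=> t t0; rewrite -{1}(cat_take_drop (size u) L) !word_prod_cat E.
Qed.

Local Notation cartan := (cartan (@sroot N D) (@scoroot N D)).
Local Notation dihedral i j :=
  (dihedral_order (- cartan j i) (- cartan i j)).

Let gen := @exist ((J -> algC) -> algC) (@subfree J).

Lemma transition_a1a1 i j : br (e i) (e j) = 0 -> transition (alt i j 2)
  (alt j i 2).
Proof.
move=> eij [|[? s1] [|[? s2] [|? ?]]] // [-> ->].
exists [:: (j, s2); (i, s1)] => // v _; rewrite !word_prod_cons word_prod_nil.
by rewrite !mulmx1 /=; apply: braid_a1a1 (eP i) (eP j) eij _ _.
Qed.

Lemma transition_a2 i j : br (e i) (br (e i) (e j)) = 0 ->
  br (e j) (br (e j) (e i)) = 0 -> transition (alt i j 3) (alt j i 3).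
Proof.
move=> eij eji [|[? s1] [|[? s2] [|[? s3] [|? ?]]]] // [-> -> ->].
have p1 : subfree (fun v => sval s2 v * sval s3 v / (sval s1 v + sval s3 v)).
  by solve_subfree.
have p2 : subfree (fun v => sval s1 v + sval s3 v) by solve_subfree.
have p3 : subfree (fun v => sval s1 v * sval s2 v / (sval s1 v + sval s3 v)).
  by solve_subfree.
exists [:: (j, gen p1); (i, gen p2); (j, gen p3)] => // v v0.
rewrite !word_prod_cons word_prod_nil !mulmx1 /gen /= !mulmxA.
have gt0 (s : subfree_fun) : 0 < sval s v := subfree_gt0 (svalP s) v0.
exact: (braid_a2 (eP i) (eP j) eij eji (gt0 s1) (gt0 s2) (gt0 s3)).
Qed.

(** [transition] is directed: the inverse change of parameters must be shown subtraction-free as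
    well. *)
Lemma transition_b2 i j : br (e i) (br (e i) (br (e i) (e j))) = 0 ->
    br (e j) (br (e j) (e i)) = 0 ->
  transition (alt i j 4) (alt j i 4) /\ transition (alt j i 4) (alt i j 4).
Proof.
move=> eij eji; split; move=> [|[? s1] [|[? s2] [|[? s3] [|[? s4] [|? ?]]]]] //;
  move=> [-> -> -> ->].
- have m1 : subfree (fun v => sval s1 v * sval s2 v + (sval s1 v + sval s3 v)
  * sval s4 v).
    by solve_subfree.
  have m2 : subfree (fun v => sval s1 v ^+ 2 * sval s2 v
      + (sval s1 v + sval s3 v) ^+ 2 * sval s4 v) by solve_subfree.
  have p1 := subfree_div (subfreeM (subfreeM (svalP s2)
    (subfreeX 2 (svalP s3))) (svalP s4)) m2.
  have p2 := subfree_div m2 m1.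
  have p3 := subfree_div (subfreeX 2 m1) m2.
  have p4 := subfree_div (subfreeM (subfreeM (svalP s1) (svalP s2))
    (svalP s3)) m1.
  exists [:: (j, gen p1); (i, gen p2); (j, gen p3); (i, gen p4)] => // v v0.
  rewrite !word_prod_cons word_prod_nil !mulmx1 /gen /= !mulmxA.
  have gt0 (s : subfree_fun) : 0 < sval s v := subfree_gt0 (svalP s) v0.
exact: (braid_b2 (eP i) (eP j) eij eji (gt0 s1) (gt0 s2) (gt0 s3) (gt0 s4)).
have m1 : subfree (fun v => sval s4 v * sval s3 v + (sval s4 v + sval s2 v)
  * sval s1 v).
  by solve_subfree.
have m2 : subfree (fun v => sval s4 v ^+ 2 * sval s3 v
    + (sval s4 v + sval s2 v) ^+ 2 * sval s1 v) by solve_subfree.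
have p1 := subfree_div (subfreeM (subfreeM (svalP s4) (svalP s3)) (svalP s2))
  m1.
have p2 := subfree_div (subfreeX 2 m1) m2.
have p3 := subfree_div m2 m1.
have p4 := subfree_div (subfreeM (subfreeM (svalP s3) (subfreeX 2 (svalP s2)))
  (svalP s1)) m2.
exists [:: (i, gen p1); (j, gen p2); (i, gen p3); (j, gen p4)] => // v v0.
rewrite !word_prod_cons word_prod_nil !mulmx1 /gen /= !mulmxA.
have gt0 (s : subfree_fun) : 0 < sval s v := subfree_gt0 (svalP s) v0.
exact: (braid_b2_rev (eP i) (eP j) eij eji (gt0 s1) (gt0 s2) (gt0 s3) (gt0 s4)).
Qed.

Section G2Subfree.
Variables s1 s2 s3 s4 s5 s6 : subfree_fun.
Lemma subfree_g2pi1 : subfree (fun v => g2pi1 (sval s1 v) (sval s2 v)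
  (sval s3 v)
  (sval s4 v) (sval s5 v) (sval s6 v)).
Proof. by rewrite /g2pi1; solve_subfree. Qed.
Lemma subfree_g2pi2 : subfree (fun v => g2pi2 (sval s1 v) (sval s2 v)
  (sval s3 v)
  (sval s4 v) (sval s5 v) (sval s6 v)).
Proof. by rewrite /g2pi2; solve_subfree. Qed.
Lemma subfree_g2pi3 : subfree (fun v => g2pi3 (sval s1 v) (sval s2 v)
  (sval s3 v)
  (sval s4 v) (sval s5 v) (sval s6 v)).
Proof. by rewrite /g2pi3; solve_subfree. Qed.
Lemma subfree_g2pi4 : subfree (fun v => g2pi4 (sval s1 v) (sval s2 v)
  (sval s3 v)
  (sval s4 v) (sval s5 v) (sval s6 v)).
Proof. by rewrite /g2pi4; solve_subfree. Qed.
Lemma subfree_g2mu : subfree (fun v => g2mu (sval s2 v) (sval s3 v)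
  (sval s4 v) (sval s5 v) (sval s6 v)).
Proof. by rewrite /g2mu; solve_subfree. Qed.
Lemma subfree_g2nu : subfree (fun v => g2nu (sval s1 v) (sval s2 v) (sval s3 v)
  (sval s4 v) (sval s5 v)).
Proof. by rewrite /g2nu; solve_subfree. Qed.
End G2Subfree.

Lemma transition_g2 i j : br (e i) (br (e i) (br (e i) (br (e i) (e j)))) = 0 ->
    br (e j) (br (e j) (e i)) = 0 ->
  transition (alt i j 6) (alt j i 6) /\ transition (alt j i 6) (alt i j 6).
Proof.
move=> eij eji; split;
  move=> [|[? s1] [|[? s2] [|[? s3] [|[? s4] [|[? s5] [|[? s6] [|? ?]]]]]]] //;
  move=> [-> -> -> -> -> ->].
- have pi1 := subfree_g2pi1 s1 s2 s3 s4 s5 s6.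
  have pi2 := subfree_g2pi2 s1 s2 s3 s4 s5 s6.
  have pi3 := subfree_g2pi3 s1 s2 s3 s4 s5 s6.
  have pi4 := subfree_g2pi4 s1 s2 s3 s4 s5 s6.
  have p1 := subfree_div (subfree_g2mu s2 s3 s4 s5 s6) pi3.
  have p2 := subfree_div pi3 pi2.
  have p3 := subfree_div (subfreeX 3 pi2) (subfreeM pi3 pi4).
  have p4 := subfree_div pi4 (subfreeM pi1 pi2).
  have p5 := subfree_div (subfreeX 3 pi1) pi4.
  have p6 := subfree_div (subfree_g2nu s1 s2 s3 s4 s5) pi1.
  exists [:: (j, gen p1); (i, gen p2); (j, gen p3); (i, gen p4); (j, gen p5);
    (i, gen p6)] => // v v0.
  rewrite !word_prod_cons word_prod_nil !mulmx1 /gen /= !mulmxA.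
  have gt0 (s : subfree_fun) : 0 < sval s v := subfree_gt0 (svalP s) v0.
exact: (braid_g2 (eP i) (eP j) eij eji (gt0 s1) (gt0 s2) (gt0 s3) (gt0 s4)
  (gt0 s5) (gt0 s6)).
have pi1 := subfree_g2pi1 s6 s5 s4 s3 s2 s1.
have pi2 := subfree_g2pi2 s6 s5 s4 s3 s2 s1.
have pi3 := subfree_g2pi3 s6 s5 s4 s3 s2 s1.
have pi4 := subfree_g2pi4 s6 s5 s4 s3 s2 s1.
have p1 := subfree_div (subfree_g2mu s5 s4 s3 s2 s1) pi3.
have p2 := subfree_div pi3 pi2.
have p3 := subfree_div (subfreeX 3 pi2) (subfreeM pi3 pi4).
have p4 := subfree_div pi4 (subfreeM pi1 pi2).
have p5 := subfree_div (subfreeX 3 pi1) pi4.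
have p6 := subfree_div (subfree_g2nu s6 s5 s4 s3 s2) pi1.
exists [:: (i, gen p6); (j, gen p5); (i, gen p4); (j, gen p3); (i, gen p2);
  (j, gen p1)] => // v v0.
rewrite !word_prod_cons word_prod_nil !mulmx1 /gen /= !mulmxA.
have gt0 (s : subfree_fun) : 0 < sval s v := subfree_gt0 (svalP s) v0.
exact: (braid_g2_rev (eP i) (eP j) eij eji (gt0 s1) (gt0 s2) (gt0 s3) (gt0 s4)
  (gt0 s5) (gt0 s6)).
Qed.

Lemma transition_braid i j : i != j ->
  (forall k, coef_ge0 (dihedral_coef (- cartan j i) (- cartan i j) k)) \/
  exists2 m, dihedral i j m
    & forall z, transition (alt i j m ++ z) (alt j i m ++ z).
Proof.
move=> ij; have ji : j != i by rewrite eq_sym.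
have [a [aE a0 a1]] := serre eP fP ij; have [b [bE b0 b1]] := serre eP fP ji.
(* Both say that e_i and e_j commute. *)
have ab : a = 0%N <-> b = 0%N.
  split=> h; move: a0 a1 b0 b1; rewrite h.
    move=> /= h0 _; case: b {bE h} => // b _; rewrite iterSr brC h0 oppr0.
    suff -> : iter b (br (e j)) 0 = 0 by rewrite eqxx.
    by elim: b => //= b ->; rewrite br0r.
  move=> _ + /= h0 _; case: a {aE h} => // a; rewrite iterSr brC h0 oppr0.
  suff -> : iter a (br (e i)) 0 = 0 by rewrite eqxx.
  by elim: a => //= a ->; rewrite br0r.
rewrite aE bE !opprK.
have [|||inf|[[]|[]|[]|[]]] := @dihedral_cases a b _ _ _; rewrite ?le0z_nat //.
- by split=> -[]/ab ->.
- by left; apply: dihedral_infinite; rewrite ?le0z_nat.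
- move=> [a_0] [b_0]; right; exists 2%N; first by rewrite a_0 b_0.
  by move=> z; apply/transition_catr/transition_a1a1; rewrite a_0 in a0.
- move=> [a_1] [b_1]; right; exists 3%N; first by rewrite a_1 b_1.
  move=> z; apply/transition_catr/transition_a2; first by rewrite a_1 in a0.
  by rewrite b_1 in b0.
- move=> [[a_2] [b_1]]; right; exists 4%N; first by rewrite a_2 b_1.
  rewrite a_2 in a0; rewrite b_1 in b0.
  by move=> z; apply/transition_catr; have [] := transition_b2 a0 b0.
- move=> [[a_1] [b_2]]; right; exists 4%N; first by rewrite a_1 b_2.
  rewrite a_1 in a0; rewrite b_2 in b0.
  by move=> z; apply/transition_catr; have [] := transition_b2 b0 a0.
- move=> [[a_3] [b_1]]; right; exists 6%N; first by rewrite a_3 b_1.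
  rewrite a_3 in a0; rewrite b_1 in b0.
  by move=> z; apply/transition_catr; have [] := transition_g2 a0 b0.
move=> [[a_1] [b_3]]; right; exists 6%N; first by rewrite a_1 b_3.
rewrite a_1 in a0; rewrite b_3 in b0.
by move=> z; apply/transition_catr; have [] := transition_g2 b0 a0.
Qed.

Variable w : seq 'I_(srank D).
Hypothesis hw : reduced_longest w.

Lemma word_prod_letter i (F : subfree_fun) L : map fst L = w ->
  exists2 L', map fst L' = w & forall v, pos_point v ->
    xsub i (sval F v) *m word_prod L v = word_prod L' v.
Proof.
move=> Lw; have [redw longest] := hw.
have negi := longest_neg (@sroot_free N D) (cartan_diag2 eP) (weyl_root_sign eP)
  longest redw longest i.
have [u uE usz] := neg_descent (@sroot_free N D) (cartan_diag2 eP)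
  (weyl_root_sign eP)
  longest negi.
have redu := reduced_eq_size redw uE usz.
have conn := tits_reduced_words_connected (@sroot_free N D) (cartan_diag2 eP)
  (weyl_root_sign eP) longest transition_refl transition_trans
  transition_cons transition_braid.
have [[//|[k G] L1] [-> L1u] E1] := conn _ _ redw redu (esym uE) L Lw.
(* The new letter is absorbed by the first one: x_i(F) x_i(G) = x_i(F + G). *)
pose FG := gen (subfreeD (svalP F) (svalP G)).
have [|L2 L2w E2] := conn _ _ redu redw uE ((i, FG) :: L1);
  first by rewrite /= L1u.
exists L2 => // v v0; rewrite E1 // -E2 // !word_prod_cons /=.
by rewrite mulmxA -xsubD.
Qed.

Lemma word_prod_mul L1 L2 : map fst L2 = w ->
  exists2 L', map fst L' = w & forall v, pos_point v ->
    word_prod L1 v *m word_prod L2 v = word_prod L' v.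
Proof.
elim: L1 L2 => [|[i F] L1 IH] L2 L2w.
  by exists L2 => // v _; rewrite word_prod_nil mul1mx.
have [L3 L3w E3] := IH _ L2w; have [L4 L4w E4] := word_prod_letter i F L3w.
by exists L4 => // v v0; rewrite word_prod_cons -mulmxA E3 // E4.
Qed.

End WordProducts.

(** * Pulling back positive functions *)

Section SeparatelyLaurent.
Variable J : finType.
Implicit Types (v : J -> algC) (f g : (J -> algC) -> algC).

Definition upd v i s : J -> algC := fun k => if k == i then s else v k.

(** The exponent and the polynomial may depend on the other coordinates. This is stable under sums
    and products and enough to pass from positive points to torus points one coordinate at a
    time. *)
Definition sep_laurent f :=
  (forall v v', torus_point v -> v =1 v' -> f v = f v') /\
  forall v i, torus_point v -> exists (q : {poly algC}) k,
    forall s, s != 0 -> s ^+ k * f (upd v i s) = q.[s].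

Lemma upd_torus v i s : torus_point v -> s != 0 -> torus_point (upd v i s).
Proof. by move=> v0 s0 k; rewrite /upd; case: (k == i). Qed.

Lemma eq_sep_laurent f g : (forall v, torus_point v -> f v = g v) ->
  sep_laurent f -> sep_laurent g.
Proof.
move=> fg [fext fL]; split.
  move=> v v' v0 vv'; rewrite -!fg //; first exact: fext.
  by move=> k; rewrite -vv'.
move=> v i v0; have [q [k qE]] := fL v i v0; exists q, k => s s0.
by rewrite -fg ?qE //; apply: upd_torus.
Qed.

Lemma sep_laurent_cst c : sep_laurent (fun=> c).
Proof. by split=> // v i _; exists c%:P, 0%N => s _; rewrite hornerC mul1r. Qed.

Lemma sep_laurentD f g :
  sep_laurent f -> sep_laurent g -> sep_laurent (fun v => f v + g v).
Proof.
move=> [fext fL] [gext gL]; split=> [v v' v0 vv'|v i v0].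
  by rewrite (fext _ _ v0 vv') (gext _ _ v0 vv').
have [q [k qE]] := fL v i v0; have [r [l rE]] := gL v i v0.
exists ('X^l * q + 'X^k * r), (k + l)%N => s s0.
rewrite hornerD !hornerM !hornerXn -qE // -rE // mulrDr exprD -!mulrA.
by congr (_ + _); rewrite mulrCA.
Qed.

Lemma sep_laurentM f g :
  sep_laurent f -> sep_laurent g -> sep_laurent (fun v => f v * g v).
Proof.
move=> [fext fL] [gext gL]; split=> [v v' v0 vv'|v i v0].
  by rewrite (fext _ _ v0 vv') (gext _ _ v0 vv').
have [q [k qE]] := fL v i v0; have [r [l rE]] := gL v i v0.
exists (q * r), (k + l)%N => s s0.
by rewrite hornerM -qE // -rE // exprD mulrACA.
Qed.

Lemma sep_laurent_prod (I : Type) (l : seq I) (F : I -> (J -> algC) -> algC) :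
  (forall i, sep_laurent (F i)) -> sep_laurent (fun v => \prod_(i <- l) F i v).
Proof.
move=> FL; elim: l => [|i l IH].
  by apply: eq_sep_laurent (sep_laurent_cst 1) => v _; rewrite big_nil.
by apply: eq_sep_laurent (sep_laurentM (FL i) IH) => v _; rewrite big_cons.
Qed.

Lemma sep_laurent_sum (I : Type) (l : seq I) (F : I -> (J -> algC) -> algC) :
  (forall i, sep_laurent (F i)) -> sep_laurent (fun v => \sum_(i <- l) F i v).
Proof.
move=> FL; elim: l => [|i l IH].
  by apply: eq_sep_laurent (sep_laurent_cst 0) => v _; rewrite big_nil.
by apply: eq_sep_laurent (sep_laurentD (FL i) IH) => v _; rewrite big_cons.
Qed.

Lemma sep_laurent_coordX j (e : int) : sep_laurent (fun v => v j ^ e).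
Proof.
split=> [v v' _ -> //|v i v0]; rewrite /upd; case: (j == i); last first.
  by exists (v j ^ e)%:P, 0%N => s _; rewrite hornerC mul1r.
case: e => n; first by exists 'X^n, 0%N => s _; rewrite hornerXn mul1r.
by exists 1, n.+1 => s s0; rewrite hornerC divff // expf_neq0.
Qed.

Lemma sep_laurent_coord j : sep_laurent (fun v => v j).
Proof. by apply: eq_sep_laurent (sep_laurent_coordX j 1) => v _;
  rewrite expr1z. Qed.

Lemma sep_laurent_peval (F : nzRingType) (iota : F -> algC) (I : finType)
    (phi : I -> (J -> algC) -> algC) (p : {mpoly F[#|I|]}) :
  (forall i, sep_laurent (phi i))
    -> sep_laurent (fun v => peval iota p (phi^~ v)).
Proof.
move=> phiL; apply: peval_closed => //.
- by move=> f g fg; apply: eq_sep_laurent => v _; apply: fg.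
- by move=> c; apply: sep_laurent_cst.
- exact: sep_laurent_cst.
- exact: sep_laurent_cst.
- exact: sep_laurentD.
exact: sep_laurentM.
Qed.

Lemma sep_laurent_horner (q : {poly algC}) f :
  sep_laurent f -> sep_laurent (fun v => q.[f v]).
Proof.
move=> fL; apply: (@eq_sep_laurent (fun v => \sum_(i < size q)
  q`_i * f v ^+ i)).
  by move=> v _; rewrite horner_coef.
apply: sep_laurent_sum => i; apply: sep_laurentM (sep_laurent_cst _) _.
elim: (i : nat) => [|k IH]; first exact: sep_laurent_cst.
by apply: eq_sep_laurent (sep_laurentM fL IH) => v _; rewrite exprS.
Qed.

(* Zariski density of the positive points, one coordinate at a time. *)
Lemma sep_laurent_eq0 f : sep_laurent f ->
  (forall v, pos_point v -> f v = 0) -> forall v, torus_point v -> f v = 0.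
Proof.
move=> [fext fL] f0 v; have [n] := ubnP #|[pred i | ~~ (0 < v i)]|.
elim: n => // n IH in v *; rewrite ltnS => bad v0.
have [vpos|/forallPn[i vi]] := boolP [forall i, 0 < v i].
  by apply: f0 => i; exact: (forallP vpos).
have [q [k qE]] := fL v i v0.
have q0 : q = 0.
  have h (s : algC) : 0 < s -> q.[s] = 0.
    move=> s0; rewrite -qE ?gt_eqF // IH ?mulr0 //; last first.
      by apply: upd_torus; rewrite ?gt_eqF.
    apply: leq_trans bad; apply: proper_card; apply/properP; split.
      by apply/subsetP=> j; rewrite !inE /upd; case: (j == i) => //; rewrite s0.
    by exists i; rewrite !inE // /upd eqxx s0.
  by apply: poly_nat_inj => m; rewrite horner0 h // ltr0n.
have vi0 := v0 i; have /eqP := qE _ vi0.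
rewrite q0 horner0 mulf_eq0 expf_eq0 (negbTE vi0) andbF /= => /eqP <-.
by apply: fext => // l; rewrite /upd; case: eqP => [->|].
Qed.

End SeparatelyLaurent.

Section Regular.
Variables (N n : nat) (G : 'M[algC]_N -> Prop).

Lemma regular_comp n' (Phi : ('I_n -> 'M[algC]_N) -> 'I_n' -> 'M[algC]_N) f :
    (forall g, in_pow G g -> in_pow G (Phi g)) ->
    (forall j a b, regular_on_pow G (fun g => Phi g j a b)) ->
  regular_on_pow G f -> regular_on_pow G (f \o Phi).
Proof.
move=> PhiG PhiR [p pE].
have [q qE] : regular_on_pow G (fun g => peval (@ratr algC)
  p (tentries (Phi g))).
  apply: (@peval_closed _ _ _ _ _ (fun x g => tentries (Phi g) x)).
  - by move=> f1 f2 f12 [q qE]; exists q => g gG; rewrite -f12 qE.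
  - by move=> c; exists c%:MP => g _; rewrite pevalC.
  - by exists 0 => g _; rewrite /peval mmap0.
  - by exists 1%:MP => g _; rewrite peval1.
  - by move=> f1 f2 [q qE] [r rE]; exists (q + r) => g gG;
    rewrite pevalD qE ?rE.
  - by move=> f1 f2 [q qE] [r rE]; exists (q * r) => g gG;
    rewrite pevalM qE ?rE.
  by move=> x; apply: PhiR.
by exists q => g gG; rewrite /= pE ?qE //; apply: PhiG.
Qed.

Lemma regular_ext f (g g' : 'I_n -> 'M[algC]_N) : regular_on_pow G f ->
  in_pow G g -> g =1 g' -> f g = f g'.
Proof.
move=> [p pE] gG gg'; have gG' : in_pow G g' by move=> k; rewrite -gg'.
rewrite !pE //; apply: eq_peval => x; by rewrite /tentries gg'.
Qed.

Lemma regular_entry (k : 'I_n) a b : regular_on_pow G (fun g => g k a b).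
Proof.
exists 'X_(enum_rank (k, (a, b))) => g _.
by rewrite /peval mmapX mmap1U enum_rankK.
Qed.

Lemma regular_mul_entry (k l : 'I_n) a b :
  regular_on_pow G (fun g => (g k *m g l) a b).
Proof.
exists (\sum_c 'X_(enum_rank (k, (a, c))) * 'X_(enum_rank (l, (c, b)))) => g _.
rewrite mxE /peval rmorph_sum /=; apply: eq_bigr => c _.
by rewrite rmorphM /= !mmapX !mmap1U !enum_rankK.
Qed.

End Regular.

Section Chart.
Variables (N n : nat) (D : split_semisimple N) (w : seq 'I_(srank D)).
Local Notation coords := ('I_n * ('I_(sdim D) + 'I_(size w)))%type.
Implicit Types v : coords -> algC.

Definition uprod (t : 'I_(size w) -> algC) : 'M[algC]_N :=
  \big[mulmx/1%:M]_(l < size w) xsub (tnth (in_tuple w) l) (t l).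

Lemma big_mulmx_in (I : Type) (s : seq I) (F : I -> 'M[algC]_N) :
  (forall i, sG D (F i)) -> sG D (\big[mulmx/1%:M]_(i <- s) F i).
Proof. by move=> FG; apply: big_ind => //; [exact: sG1|exact: sGM]. Qed.

Lemma uprod_in t : sG D (uprod t).
Proof. by apply: big_mulmx_in => l; apply: xsub_in. Qed.

Lemma chart_in v : (forall k i, v (k, inl i) != 0) -> in_pow (sG D)
  (chart (w := w) v).
Proof.
move=> v0 k; apply: sGM; first by apply: stau_in => i; apply: v0.
exact/tr_in/uprod_in.
Qed.

Definition sep_laurent_mx (g : (coords -> algC) -> 'M[algC]_N) :=
  forall a b, sep_laurent (fun v => g v a b).

Lemma sep_laurent_mxM g h : sep_laurent_mx g -> sep_laurent_mx h ->
  sep_laurent_mx (fun v => g v *m h v).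
Proof.
move=> gL hL a b.
apply: (@eq_sep_laurent _ (fun v => \sum_c g v a c * h v c b)).
  by move=> v _; rewrite mxE.
by apply: sep_laurent_sum => c; apply: sep_laurentM.
Qed.

Lemma sep_laurent_morphism (A : 'M[algC]_N -> Prop) f g :
    morphism_on (@ratr algC) A f -> (forall v, A (g v)) ->
  sep_laurent_mx g -> sep_laurent_mx (fun v => f (g v)).
Proof.
move=> fA Ag gL a b; have [p pE] := fA a b.
apply: (@eq_sep_laurent _ (fun v => peval (@ratr algC) p (entries (g v)))).
  by move=> v _; rewrite pE.
by apply: (@sep_laurent_peval _ _ _ _ (fun x v => entries (g v) x)) => x;
  apply: gL.
Qed.

Lemma sep_laurent_chart k : sep_laurent_mx (fun v => chart (w := w) v k).
Proof.
apply: sep_laurent_mxM.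
  move=> a b; have [_ _ _ h _] := sH_split D; have [p [c pE]] := h a b.
  apply: (@eq_sep_laurent _ (fun v => peval (@ratr algC)
    p (fun i => v (k, inl i))
      * lmonom (fun i => v (k, inl i)) c)).
    by move=> v v0; rewrite pE // => i; apply: v0.
  apply: sep_laurentM.
    apply: (@sep_laurent_peval _ _ _ _ (fun i v => v (k, inl i))) => i.
    exact: sep_laurent_coord.
  by apply: sep_laurent_prod => i; apply: sep_laurent_coordX.
apply: sep_laurent_morphism (tr_morphism D) _ _ => [v|]; first exact: uprod_in.
rewrite /uprod; elim: (index_enum _) => [|l s IH].
  move=> a b; apply: eq_sep_laurent (sep_laurent_cst _ ((1%:M : 'M[algC]_N)
    a b)).
  by move=> v _; rewrite big_nil.
have xL : sep_laurent_mx (fun v => xsub (tnth (in_tuple w) l) (v (k, inr l))).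
  move=> a b; set i := tnth _ l.
  have [P PE] : curve (xsub i).
    exact: (curve_morphism (sl2_morphism i) SL2_upper curve_upper2).
  apply: (@eq_sep_laurent _ (fun v => (P a b).[v (k, inr l)])).
    by move=> v _; rewrite PE mxeval_entry.
  exact/sep_laurent_horner/sep_laurent_coord.
move=> a b; apply: eq_sep_laurent (sep_laurent_mxM xL IH a b) => v _.
by rewrite [in RHS]big_cons.
Qed.

Lemma sep_laurent_regular f : regular_on_pow (sG D) f ->
  sep_laurent (fun v => f (chart (n := n) (w := w) v)).
Proof.
move=> [p pE].
apply: (@eq_sep_laurent _ (fun v => peval (@ratr algC) p
   (tentries (chart (n := n) (w := w) v)))).
  by move=> v v0; rewrite pE //; apply: chart_in => k i; apply: v0.
apply: (@sep_laurent_peval _ _ _ _ (fun x v => tentries (chart (w := w) v) x))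
  => x.
exact: sep_laurent_chart.
Qed.

(** The torus coordinates stay fixed, so the shifted chart is polynomial, not merely Laurent, in
    s. *)
Definition shift_unipotent v (s : algC) : coords -> algC :=
  fun x => if x.2 is inr _ then v x + s else v x.

Lemma poly_fun_shift v f : (forall k i, v (k, inl i) != 0) ->
    regular_on_pow (sG D) f ->
  poly_fun (fun s => f (chart (w := w) (shift_unipotent v s))).
Proof.
move=> v0 [p pE].
have [q qE] : poly_fun (fun s => peval (@ratr algC) p
    (tentries (chart (w := w) (shift_unipotent v s)))).
  apply: (@poly_fun_peval _ _ _
    (fun x s => tentries (chart (w := w) (shift_unipotent v s)) x))
      => -[k [a b]].
  apply: (curve_entry (g := fun s => chart (w := w) (shift_unipotent v s) k)).
  apply: curveM; first by exists (mxcst (stau (fun i => v (k, inl i)))) => s;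
    rewrite mxeval_cst.
  apply: (curve_morphism (tr_morphism D)) => [s|]; first exact: uprod_in.
  elim: (index_enum _) => [|l ls IH].
    by exists (mxcst 1%:M) => s; rewrite mxeval_cst big_nil.
  set i := tnth (in_tuple w) l.
  have [P PE] : curve (xsub i).
    exact: (curve_morphism (sl2_morphism i) SL2_upper curve_upper2).
  have [Q QE] : curve (fun s => xsub i (v (k, inr l) + s)).
    exists (mxcomp P ('X + (v (k, inr l))%:P)) => s.
    by rewrite mxeval_comp hornerD hornerX hornerC addrC PE.
  by have [R RE] := IH; exists (Q *m R) => s; rewrite big_cons mxevalM -QE -RE.
by exists q => s; rewrite pE //; apply: chart_in => k i; apply: v0.
Qed.

Lemma exists_nonroot (q : {poly algC}) : q != 0 -> exists s, q.[s] != 0.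
Proof.
move=> q0; pose rs := [seq i%:R : algC | i <- iota 0 (size q)].
have [all0|/allPn[s _ qs]] := boolP (all (root q) rs); last by exists s.
case/eqP: q0; apply: roots_geq_poly_eq0 all0 _ _;
  rewrite ?size_map ?size_iota //.
by rewrite map_inj_uniq ?iota_uniq //; apply: (mulrIn (oner_neq0 _)).
Qed.

(** A degenerate point, with some unipotent coordinates equal to 0, is moved into the torus by a
    generic common shift, the value of f being a polynomial in s that is non-zero at 0. *)
Lemma torus_neq0_of_shift v f : (forall k i, v (k, inl i) != 0) ->
    regular_on_pow (sG D) f -> f (chart (w := w) v) != 0 ->
  exists2 v', torus_point v' & f (chart (w := w) v') != 0.
Proof.
move=> v0 fR fv; have [q qE] := poly_fun_shift v0 fR.
have q0 : q != 0.
  apply: contra_neq fv => q0; have := qE 0; rewrite q0 horner0 => <-.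
  apply: regular_ext fR (chart_in v0) _ => k; congr (_ *m tr _ _).
  by apply: eq_bigr => l _; rewrite /shift_unipotent /= addr0.
(* The product keeps all shifted coordinates away from 0. *)
have : q * \prod_(x : coords) ('X + (v x)%:P) != 0.
  rewrite mulf_neq0 //; apply/prodf_neq0 => x _.
  by rewrite -[X in 'X + X]opprK -polyCN polyXsubC_eq0.
move=> /exists_nonroot[s]; rewrite hornerM mulf_eq0 negb_or => /andP[qs ps].
exists (shift_unipotent v s); last by rewrite qE.
case=> k [i|l]; first exact: v0.
move: ps; rewrite horner_prod => /prodf_neq0/(_ (k, inr l) isT).
by rewrite hornerD hornerX hornerC addrC.
Qed.

End Chart.

(** * Invariance and positivity of a pullback *)

Section Pullback.
Variables (N : nat) (D : split_semisimple N) (w : seq 'I_(srank D))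
  (n n' : nat).
Variable Phi : ('I_n' -> 'M[algC]_N) -> 'I_n -> 'M[algC]_N.

Local Notation coords n := ('I_n * ('I_(sdim D) + 'I_(size w)))%type.

Hypothesis Phi_in : forall g, in_pow (sG D) g -> in_pow (sG D) (Phi g).
Hypothesis Phi_regular : forall j a b,
  regular_on_pow (sG D) (fun g => Phi g j a b).
Hypothesis Phi_onto : forall g, in_pow (sG D) g ->
  exists2 g', in_pow (sG D) g' & Phi g' =1 g.
Hypothesis Phi_equiv : forall u u' g g', sU D u -> sU D u' ->
  star_eq D (UU_act u u' g) g' -> exists v v', [/\ sU D v, sU D v'
    & star_eq D (UU_act v v' (Phi g)) (Phi g')].
Hypothesis Phi_chart : exists phi : coords n -> subfree_fun (coords n'),
  forall v, pos_point v ->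
    Phi (chart (w := w) v) =1 chart (w := w) (fun x => sval (phi x) v).
(** Only the torus coordinates of v' are non-zero: an identity factor has unipotent coordinates 0.
    [torus_neq0_of_shift] repairs this afterwards. *)
Hypothesis Phi_chart_onto : forall v : coords n -> algC, torus_point v ->
  exists2 v' : coords n' -> algC, forall k i, v' (k, inl i) != 0
    & Phi (chart (w := w) v') =1 chart (w := w) v.

Lemma rational_pullback f : rational_on_pow D f -> rational_on_pow D (pullback
  Phi f).
Proof.
move=> [numR denR [g gG den0]]; split.
- exact: (regular_comp Phi_in Phi_regular numR).
- exact: (regular_comp Phi_in Phi_regular denR).
have [g' g'G gg'] := Phi_onto gG; exists g' => //=.
by rewrite (regular_ext denR (Phi_in g'G) gg').
Qed.

Lemma UU_invariant_pullback f : UU_invariant D f -> UU_invariant D (pullback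
  Phi f).
Proof.
move=> [fR inv]; split=> [|u u' g g' uU u'U gG gg'];
  first exact: rational_pullback.
have [v [v' [vU v'U E]]] := Phi_equiv uU u'U gg'.
exact: inv vU v'U (Phi_in gG) E.
Qed.

Lemma nonneg_laurent_poly (I : finType) (p : {mpoly rat[#|I|]}) :
  nonneg_poly p -> nonneg_laurent (fun v => peval (@ratr algC) p v).
Proof.
move=> [p0 pge0]; exists p, (fun=> 0); split=> // v _.
by rewrite lmonom0 mulr1.
Qed.

Lemma positive_pullback f : positive w f -> positive w (pullback Phi f).
Proof.
move=> [f' [f'R ff' [v0 v0T den0] [a [b [aP bP ab]]]]].
have [numR denR _] := rational_pullback f'R; have [numR' denR' _] := f'R.
exists (pullback Phi f'); split=> //.
- exact: rational_pullback.
- by move=> g gG; apply: ff'; apply: Phi_in.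
- have [v' v'0 E] := Phi_chart_onto v0T.
  apply: (torus_neq0_of_shift v'0 denR) => /=.
  by rewrite (regular_ext denR' (Phi_in (chart_in v'0)) E).
have [phi phiE] := Phi_chart; pose F x v := sval (phi x) v.
have FP x : subfree (F x) by apply: svalP.
have [p1 [q1 [p1P q1P aE]]] := subfree_nonneg_laurent FP aP.
have [p2 [q2 [p2P q2P bE]]] := subfree_nonneg_laurent FP bP.
(* With a = p1 / q1 and b = p2 / q2 after substitution, a / b = p1 q2 / (p2 q1). *)
exists (peval (@ratr algC) (p1 * q2)), (peval (@ratr algC) (p2 * q1)); split.
- exact/nonneg_laurent_poly/nonneg_polyM.
- exact/nonneg_laurent_poly/nonneg_polyM.
(* The difference is put in the form x + (-1) y, to which the closure lemmas for [sep_laurent]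
   apply. *)
move=> v vT; apply/eqP; rewrite -subr_eq0 -mulN1r; apply/eqP.
apply: (sep_laurent_eq0 (f := fun v =>
   num (pullback Phi f') (chart (w := w) v) * peval (@ratr algC) (p2 * q1) v
   + -1 * (peval (@ratr algC) (p1 * q2) v * den (pullback Phi f')
     (chart (w := w) v)))) vT.
  apply: sep_laurentD; first apply: sep_laurentM.
  - exact: sep_laurent_regular.
  - exact: (@sep_laurent_peval _ _ (@ratr algC) _ (fun i v => v i)
    _ (@sep_laurent_coord _)).
  apply: sep_laurentM (sep_laurent_cst _ _) _; apply: sep_laurentM.
    exact: (@sep_laurent_peval _ _ (@ratr algC) _ (fun i v => v i)
      _ (@sep_laurent_coord _)).
  exact: sep_laurent_regular.
move=> {}v vpos.
have chG : in_pow (sG D) (Phi (chart (w := w) v)).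
  by apply/Phi_in/chart_in => k i; apply: pos_torus.
have FT : torus_point (F^~ v) by move=> x;
  rewrite gt_eqF // (subfree_gt0 (FP x)).
have := ab _ FT; rewrite aE // bE // => E.
rewrite /= (regular_ext numR' chG (phiE _ vpos))
  (regular_ext denR' chG (phiE _ vpos)).
rewrite !pevalM; move: E; rewrite -/(F^~ v).
set x := num _ _; set y := den _ _.
have := peval_gt0 q1P vpos; have := peval_gt0 q2P vpos.
set Q1 := peval _ q1 v; set Q2 := peval _ q2 v.
set P1 := peval _ p1 v; set P2 := peval _ p2 v => Q2pos Q1pos E.
have Q1n : Q1 != 0 by rewrite gt_eqF.
have Q2n : Q2 != 0 by rewrite gt_eqF.
have -> : x * (P2 * Q1) = x * (P2 / Q2) * (Q1 * Q2) by field.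
by rewrite E; field.
Qed.

Lemma UU_invariant_positive_pullback f :
  UU_invariant_positive w f -> UU_invariant_positive w (pullback Phi f).
Proof.
by move=> [fU fP]; split; [exact: UU_invariant_pullback|exact:
  positive_pullback].
Qed.

End Pullback.

(** * The maps p, q and m_k *)

Section Instances.
Variables (N : nat) (D : split_semisimple N) (w : seq 'I_(srank D)) (n : nat).
Local Notation coords n := ('I_n * ('I_(sdim D) + 'I_(size w)))%type.

Lemma sU_in u : sU D u -> sG D u.
Proof.
move=> uU; have [[_ _ _ BG _] _] := sB_borel D;
  have [_ [UB _] _ _] := sU_radical D.
exact/BG/UB.
Qed.

Lemma sU_unit u : sU D u -> u \in unitmx.
Proof. by move=> /sU_in/sG_unit. Qed.

Lemma tr1 : tr D 1%:M = 1%:M.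
Proof.
have u := sG_unit (tr_in (sG1 D)); have := tr_anti (sG1 D) (sG1 D).
by rewrite mulmx1 => /(congr1 (mulmx (invmx (tr D 1%:M))));
  rewrite mulVmx // mulKmx.
Qed.

Lemma stau1 : stau (s := D) (fun=> 1) = 1%:M.
Proof.
have T1 : torus_point (fun=> 1 : algC) (I := 'I_(sdim D)) by move=> k;
  rewrite oner_eq0.
have u := stau_unit (D := D) T1; have := stauM (D := D) T1 T1.
have -> : stau (s := D) (fun=> 1 * 1) = stau (s := D) (fun=> 1).
  by apply: eq_stau => // k; rewrite ?mulr1 ?oner_eq0.
by move=> /(congr1 (mulmx (invmx (stau (s := D) (fun=> 1)))));
  rewrite mulVmx // mulKmx.
Qed.

Lemma uprod0 : uprod (D := D) (w := w) (fun=> 0) = 1%:M.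
Proof.
rewrite /uprod; elim: (index_enum _) => [|l s IH]; first by rewrite big_nil.
by rewrite big_cons IH mulmx1 xsub0.
Qed.

Lemma eq_chart n1 n2 (v1 : coords n1 -> algC) (v2 : coords n2 -> algC) k1 k2 :
    (forall i, v1 (k1, inl i) != 0) -> (forall x, v1 (k1, x) = v2 (k2, x)) ->
  chart (w := w) v1 k1 = chart (w := w) v2 k2.
Proof.
move=> v10 v12; rewrite /chart; congr (_ *m tr _ _).
  by apply: eq_stau => // i; rewrite v12.
by apply: eq_bigr => l _; rewrite v12.
Qed.

Lemma chart1 n1 (v : coords n1 -> algC) k : (forall i, v (k, inl i) = 1) ->
  (forall l, v (k, inr l) = 0) -> chart (w := w) v k = 1%:M.
Proof.
move=> v1 v0; rewrite /chart.
have -> : stau (s := D) (fun i => v (k, inl i)) = 1%:M.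
  by rewrite -stau1; apply: eq_stau => i; rewrite v1 ?oner_eq0.
have -> : \big[mulmx/1%:M]_(l < size w) xsub (tnth (in_tuple w) l)
  (v (k, inr l)) = 1%:M.
  by rewrite -[RHS]uprod0; apply: eq_bigr => l _; rewrite v0.
by rewrite tr1 mulmx1.
Qed.

Let sf_coord (x : coords n.+1) : subfree_fun (coords n.+1) :=
  exist _ (fun v => v x) (subfree_coord x).

Lemma p_map_pullback f : UU_invariant_positive w f ->
  UU_invariant_positive w (pullback (@p_map N n) f).
Proof.
apply: UU_invariant_positive_pullback.
- by move=> g gG j; apply: gG.
- by move=> j a b; apply: regular_entry.
- move=> g gG; exists (fun k => if unlift ord0 k is Some j then g j else 1%:M).
    by move=> k; case: unlift => [j|]; [apply: gG|apply: sG1].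
  by move=> j; rewrite /p_map liftK.
- move=> u u' g g' uU u'U [t [tU gg']].
  (* The element moved between the first two factors becomes the left translation of the remaining
     product; u is lost with the first factor. *)
  exists (t 1%N), u'; split=> //; exists (fun k => t k.+1); split=> // j.
  rewrite /p_map gg' /UU_act /= !eqSS -[bump 0 j]/(j.+1).
  by case: ((j : nat) =P 0%N) => [->|_]; rewrite !mul1mx !mulmxA.
- exists (fun x => sf_coord (lift ord0 x.1, x.2)) => v v0 j.
  by apply: eq_chart => //= i; apply: pos_torus.
move=> v v0; exists (fun x => if unlift ord0 x.1 is Some j then v (j, x.2)
  else 1).
  by move=> k i /=; case: unlift => [j|]; [apply: v0|rewrite oner_eq0].
by move=> j; apply: eq_chart => [i|x] /=; rewrite liftK.
Qed.

Let wid (j : 'I_n) : 'I_n.+1 := widen_ord (leqnSn n) j.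

Let suc (j : 'I_n) : 'I_n.+1 := lift ord0 j.

Let widK (j : 'I_n) : insub (wid j : nat) = Some j. Proof. exact: (valK j). Qed.
Let sucK (j : 'I_n) : insub (suc j).-1 = Some j. Proof. exact: (valK j). Qed.

Lemma q_map_pullback f : UU_invariant_positive w f ->
  UU_invariant_positive w (pullback (@q_map N n) f).
Proof.
apply: UU_invariant_positive_pullback.
- by move=> g gG j; apply: gG.
- by move=> j a b; apply: regular_entry.
(* [insub] fails exactly at the last index, where the identity is inserted. *)
- move=> g gG; exists (fun k => if insub (k : nat)
  is Some j then g j else 1%:M).
    by move=> k; case: insub => [j|]; [apply: gG|apply: sG1].
  by move=> j; rewrite /q_map -/(wid j) widK.
- move=> u u' g g' uU u'U [t [tU gg']].
  (* The element moved between the last two factors acts on the kept product by its inverse, from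
     the right. *)
  exists u, (invmx (t n)); split=> //.
    by have [[[_ [_ _ _ Uinv]] _] _ _ _] := sU_radical D; apply: Uinv.
  exists t; split=> // j; rewrite /q_map gg' /UU_act /= eqSS.
  have jn : (j : nat) == n = false by rewrite ltn_eqF.
  rewrite jn mulmx1; case: (j.+1 =P n) => [->|_]; last by rewrite mulmx1.
  by rewrite mulmx1 !mulmxA.
- exists (fun x => sf_coord (wid x.1, x.2)) => v v0 j.
  by apply: eq_chart => //= i; apply: pos_torus.
move=> v v0; exists (fun x : coords n.+1 => if insub (x.1 : nat)
  is Some j then v (j, x.2) else 1).
  by move=> k i /=; case: insub => [j|]; [apply: v0|rewrite oner_eq0].
by move=> j; apply: eq_chart => [i|x] /=; rewrite -/(wid j) widK.
Qed.

Hypothesis hw : reduced_longest w.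

Lemma uprod_of_word_prod (J : finType) (u : seq 'I_(srank D))
    (L : seq ('I_(srank D) * subfree_fun J)) : map fst L = u ->
  exists F : 'I_(size u) -> subfree_fun J, forall v,
    word_prod L v = \big[mulmx/1%:M]_(l < size u)
                      xsub (tnth (in_tuple u) l) (sval (F l) v).
Proof.
move=> <-; pose c := cast_ord (size_map fst L).
exists (fun l => (tnth (in_tuple L) (c l)).2) => v.
have castE m1 m2 (E : m1 = m2) (A : 'I_m2 -> 'M[algC]_N) :
    \big[mulmx/1%:M]_(i < m2) A i = \big[mulmx/1%:M]_(i < m1) A (cast_ord E i).
  by case: m2 / E A => A; apply: eq_bigr => i _; rewrite cast_ord_id.
rewrite /word_prod big_tnth (castE _ _ (size_map fst L)).
apply: eq_bigr => l _; congr (xsub _ _); pose p0 := tnth (in_tuple L) (c l).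
rewrite [RHS](tnth_nth p0.1) [in LHS](tnth_nth p0) /= (nth_map p0) //.
by rewrite -(size_map fst L).
Qed.

Lemma stau_conj_uprod z t : torus_point z ->
  stau (s := D) z *m uprod (w := w) t
  = uprod (w := w) (fun l => lmonom z (sroot (tnth (in_tuple w) l) 0) * t l)
    *m stau z.
Proof.
move=> z0; rewrite /uprod; elim: (index_enum _) => [|l s IH].
  by rewrite !big_nil mulmx1 mul1mx.
rewrite !big_cons -mulmxA -IH !mulmxA; congr (_ *m _).
by apply: mulmx_inv_swap (stau_unit z0) _; rewrite /xsub sl2_upper_root.
Qed.

(* With h' in H, conjugation by h' rescales the unipotent coordinates t, and
   t^T t'^T = (t' t)^T. *)
Lemma chart_mul (J : finType) (F1 F2 : 'I_(sdim D) + 'I_(size w)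
  -> subfree_fun J) :
  exists F : 'I_(sdim D) + 'I_(size w) -> subfree_fun J,
  forall v, pos_point v ->
    (stau (fun i => sval (F1 (inl i)) v)
      *m tr D (uprod (fun l => sval (F1 (inr l)) v)))
     *m (stau (fun i => sval (F2 (inl i)) v)
       *m tr D (uprod (fun l => sval (F2 (inr l)) v)))
    = stau (fun i => sval (F (inl i)) v)
      *m tr D (uprod (fun l => sval (F (inr l)) v)).
Proof.
have [e eP] := fin_all_exists (@one_param_xsub N D).
have [f fP] := fin_all_exists (@one_param_ysub N D).
pose letters (G : 'I_(size w) -> subfree_fun J) :=
  [seq (tnth (in_tuple w) l, G l) | l <- enum 'I_(size w)].
have lettersw G : map fst (letters G) = w.
  by rewrite /letters -map_comp [LHS]map_tnth_enum.
have lettersE G v : word_prod (letters G) v = uprod (fun l => sval (G l) v).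
  by rewrite /word_prod /letters big_map enumT /uprod /= [index_enum _]unlock.
have scaleP l : subfree (fun v =>
    lmonom (fun i => sval (F2 (inl i)) v) (sroot (tnth (in_tuple w) l) 0)
    * sval (F1 (inr l)) v).
  apply: subfreeM (svalP _); apply: subfree_lmonom => i; exact: svalP.
pose G l : subfree_fun J := exist _ _ (scaleP l).
have [L Lw LE] := word_prod_mul eP fP hw (letters (fun l => F2 (inr l)))
  (lettersw G).
have [K KE] := uprod_of_word_prod Lw.
have prodP i : subfree (fun v => sval (F1 (inl i)) v * sval (F2 (inl i)) v).
  exact: subfreeM (svalP _) (svalP _).
exists (fun x => match x with inl i => exist _ _ (prodP i) | inr l => K l end).
move=> v v0 /=; have := LE v v0; rewrite KE !lettersE -/(uprod _) => {LE KE} <-.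
set z := fun i => sval (F1 (inl i)) v; set z' := fun i => sval (F2 (inl i)) v.
have zT : torus_point z by move=> i; rewrite gt_eqF // (subfree_gt0 (svalP _)).
have zT' : torus_point z' by move=> i;
  rewrite gt_eqF // (subfree_gt0 (svalP _)).
have sH_stau y : torus_point y -> sH D (stau (s := D) y).
  by move=> y0; have [_ _ h _ _] := sH_split D; apply/h; exists y.
have := congr1 (@tr _ D) (stau_conj_uprod (fun l => sval (F1 (inr l)) v) zT').
rewrite (tr_anti (stau_in zT') (uprod_in _)) (tr_anti (uprod_in _)
  (stau_in zT')).
rewrite (tr_H (sH_stau _ zT')) => E.
rewrite -mulmxA (mulmxA (tr D _)) E -!mulmxA !mulmxA -stauM //.
by rewrite (tr_anti (uprod_in _) (uprod_in _)) -!mulmxA.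
Qed.

Lemma mk_map_pullback (k : 'I_n) f : UU_invariant_positive w f ->
  UU_invariant_positive w (pullback (@mk_map N n k) f).
Proof.
apply: UU_invariant_positive_pullback.
- move=> g gG j; rewrite /mk_map; case: ifP => // _; case: ifP => // _.
  by apply: sGM.
- move=> j a b; rewrite /mk_map; case: (j < k)%N; first exact: regular_entry.
  by case: (j == k); [exact: regular_mul_entry|exact: regular_entry].
(* The identity is inserted as factor k + 1, and later factors are shifted by one. *)
- move=> g gG; pose g' (l : 'I_n.+1) : 'M[algC]_N :=
    if (l <= k)%N then (if insub (l : nat) is Some j then g j else 1%:M)
    else if l == suc k then 1%:M else (if insub (l.-1)
      is Some j then g j else 1%:M).
  have g'G : in_pow (sG D) g'.
    move=> l; rewrite /g'; case: ifP => _; last case: ifP => _; try exact: sG1;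
      by case: insub => [j|]; [apply: gG|apply: sG1].
  exists g' => // j; rewrite /mk_map -/(wid j) -/(suc j).
  case: (ltngtP j k) => [jk|kj|jk].
  + by rewrite /g' ltnW //= widK.
  + rewrite -val_eqE /= gtn_eqF // /g' leqNgt ltnS ltnW //= -val_eqE /= eqSS
    gtn_eqF //.
    by rewrite sucK.
  have -> : j = k by apply: val_inj.
  by rewrite eqxx /g' /= leqnn ltnn eqxx widK mulmx1.
- move=> u u' g g' uU u'U [t [tU gg']].
  (* The element [t k.+1], moved between the factors k and k + 1, cancels in their product, so it is
     skipped. *)
  exists u, u'; split=> //; exists (fun l => if (l <= k)%N then t l else t
    l.+1).
  split=> [l|j]; first by case: ifP.
  rewrite /mk_map /UU_act -/(wid j) -/(suc j) !gg' /UU_act /= !eqSS.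
  have jn : (j : nat) == n = false by rewrite ltn_eqF.
  rewrite jn; case: (ltngtP j k) => [jk|kj|jk] /=.
  + have jn1 : j.+1 == n = false by rewrite ltn_eqF // (leq_trans _ (ltn_ord
    k)).
    by rewrite jn1 mulmx1.
  + rewrite -val_eqE /= gtn_eqF //.
    by case: (j : nat) kj => //= j' _; rewrite !mul1mx.
  have -> : j = k by apply: val_inj.
  rewrite eqxx; have tU1 := sU_unit (tU k.+1).
  rewrite mulmx1 !mul1mx !mulmxA mulmxKV //.
- have [F FE] := chart_mul (fun x => sf_coord (wid k, x))
  (fun x => sf_coord (suc k, x)).
  exists (fun x : coords n => if (x.1 < k)%N then sf_coord (wid x.1, x.2)
    else if x.1 == k then F x.2 else sf_coord (suc x.1, x.2)) => v v0 j.
  rewrite /mk_map -/(wid j) -/(suc j); case: (ltngtP j k) => [jk|kj|jk].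
  + by apply: eq_chart => [i|x] /=; rewrite ?jk //; apply: pos_torus.
  + rewrite -val_eqE /= gtn_eqF //.
    apply: eq_chart => [i|x] /=; first exact: pos_torus.
    by rewrite ltnNge ltnW // -val_eqE /= gtn_eqF.
  have jkE : j = k by apply: val_inj.
  rewrite jkE eqxx [LHS]FE //.
  have -> : chart (w := w) (fun x : coords n => sval (if (x.1 < k)%N then
    sf_coord (wid x.1, x.2)
      else if x.1 == k then F x.2 else sf_coord (suc x.1, x.2)) v) k =
    stau (fun i => sval (F (inl i)) v)
      *m tr D (uprod (fun l => sval (F (inr l)) v)).
    rewrite /chart /= ltnn eqxx //.
  by [].
(* Torus coordinates 1 and unipotent coordinates 0 make factor k the identity; the point of index k
   goes to factor k + 1. *)
move=> v v0; exists (fun x : coords n.+1 => if (x.1 < k)%N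
   then (if insub (x.1 : nat) is Some j then v (j, x.2) else 1)
   else if x.1 == wid k then (if x.2 is inl _ then 1 else 0)
   else if insub x.1.-1 is Some j then v (j, x.2) else 1).
  move=> l i /=; case: ifP => _; first by case: insub => [j|];
    rewrite ?oner_eq0.
  by case: ifP => _; rewrite ?oner_eq0 //; case: insub => [j|];
    rewrite ?oner_eq0.
move=> j; rewrite /mk_map -/(wid j) -/(suc j); case: (ltngtP j k) => [jk|kj|jk].
- by apply: eq_chart => [i|x] /=; rewrite jk widK.
- have sk : (suc j < k)%N = false by rewrite ltnNge /= ltnW // ltnS ltnW.
  have sw : (suc j == wid k) = false by rewrite -val_eqE /= gtn_eqF // ltnS
    ltnW.
  have -> : (j == k) = false by rewrite -val_eqE /= gtn_eqF.
  by apply: eq_chart => [i|x] /=; rewrite sk sw sucK.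
have jkE : j = k by apply: val_inj.
have sk : (suc k < k)%N = false by rewrite ltnNge leqnSn.
have sw : (suc k == wid k) = false by rewrite -val_eqE /= gtn_eqF.
rewrite jkE eqxx chart1 ?mul1mx => [|i|l] /=; rewrite ?ltnn ?eqxx //.
by apply: eq_chart => [i|x] /=; rewrite sk sw sucK.
Qed.

End Instances.

Theorem proposition4p23 (N : nat) (D : split_semisimple N)
    (w : seq 'I_(srank D)) (hw : reduced_longest w)
    (n : nat) (hn : (3 <= n.+1)%N)
    (Delta : fraction N n) (hDelta : UU_invariant_positive w Delta) :
  (forall k : 'I_n, UU_invariant_positive w (pullback (@mk_map N n k) Delta)) /\
  UU_invariant_positive w (pullback (@p_map N n) Delta) /\
  UU_invariant_positive w (pullback (@q_map N n) Delta).
Proof.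
split; first by move=> k; apply: mk_map_pullback.
by split; [apply: p_map_pullback|apply: q_map_pullback].
Qed.
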